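(* Let $\ell\ge2$ and let $q\in\mathbb C^\times$ be such that $q^2$ is a primitive $\ell$-th root of unity. Let $i,r,s\in\mathbb Z_{\ge0}$ satisfy $s<\ell-1$ and $i=r\ell+s$, and put $j=i+2(\ell-s-1)$. Let $T_q(i)$ be the complex vector space with basis $\{m_0,\dots,m_j,n_0,\dots,n_i\}$. Then the formulas $$Km_k=q^{j-2k}m_k,\qquad Kn_p=q^{i-2p}n_p,$$ $$E^{(v)}m_k=\begin{bmatrix}j-k+v\\ v\end{bmatrix}_qm_{k-v},\qquad E^{(v)}n_p=\begin{bmatrix}i-p+v\\ v\end{bmatrix}_qn_{p-v}+\gamma_{p,v}\,m_{\ell-s+p-v-1},$$ $$F^{(v)}m_k=\begin{bmatrix}k+v\\ v\end{bmatrix}_qm_{k+v},\qquad F^{(v)}n_p=\begin{bmatrix}p+v\\ v\end{bmatrix}_qn_{p+v}+\omega_{p,v}\,m_{\ell-s+p+v-1}$$ define a $\mathcal LU_q$-module structure on $T_q(i)$, where the complex numbers $\gamma_{p,v}$, $\omega_{p,v}$ are $$\gamma_{p,v}=\lim_{t\to q}\frac1{[v]_t!}\sum_{u=0}^{v-1}\begin{bmatrix}\ell-s+p-u-2\\ p-u\end{bmatrix}_t\ \prod_{a=1}^u[i-p+a]_t\prod_{b=u+1}^{v-1}[i+\ell-s-p+b]_t,$$ $$\omega_{p,v}=\begin{cases}\displaystyle\lim_{t\to q}\frac1{[\ell-s+i]_t}\begin{bmatrix}\ell-s+p+v-1\\ p+v\end{bmatrix}_t\begin{bmatrix}p+v\\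 v\end{bmatrix}_t&\text{if }v>i-p,\\ 0&\text{if }v\le i-p.\end{cases}$$ With this structure $T_q(i)\simeq P_q(i)$. Moreover the submodule $\mathsf M$ of $T_q(i)$ generated by $\{m_0,\dots,m_j\}$ is isomorphic to $\Delta_q(j)$ and $T_q(i)/\mathsf M\simeq\Delta_q(i)$. Also, the unrolled generator $H$ acts on $T_q(i)$ by $Hm_k=(j-2k)m_k$ and $Hn_p=(i-2p)n_p$.
   Context: **$q$-numbers.** $[n]_t=\frac{t^n-t^{-n}}{t-t^{-1}}$, $[n]_t!=[n]_t[n-1]_t\cdots[1]_t$, $[0]_t!=1$, $\begin{bmatrix}m\\ n\end{bmatrix}_t=\frac{[m]_t!}{[n]_t![m-n]_t!}$ if $m\ge n\ge0$ and $0$ otherwise; at $t=q$, $q$-binomials are understood as limits $t\to q$ (they are Laurent polynomials in $t$). **Conventions.** $m_k=0$ for $k\notin\{0,\dots,j\}$, $n_p=0$ for $p\notin\{0,\dots,i\}$; the terms $\gamma_{p,v}m_{\ell-s+p-v-1}$ and $\omega_{p,v}m_{\ell-s+p+v-1}$ are read as $0$ (and no limit is considered) when the index of $m$ lies outside $\{0,\dots,j\}$. Here $v\ge0$, $0\le k\le j$, $0\le p\le i$. **Lusztig's quantum group.** For a formal parameter $t$, $U_t\mathfrak{sl}_2$ is the $\mathbb Q(t)$-algebra generated by $E,F,K^{\pm1}$ with $KEK^{-1}=t^2E$, $KFK^{-1}=t^{-2}F$, $KK^{-1}=K^{-1}K=1$, $K-K^{-1}=(t-t^{-1})(EF-FE)$.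 $U_{\mathrm{res}}$ is its $\mathbb Z[t,t^{-1}]$-subalgebra generated by $K^{\pm1}$ and the divided powers $E^{(n)}=E^n/[n]_t!$, $F^{(n)}=F^n/[n]_t!$, $n\ge0$. $\mathcal LU_q$ is the $\mathbb C$-algebra obtained from $U_{\mathrm{res}}$ by specializing $t\mapsto q$. The element $(K^{2\ell}-1)/\Phi_\ell(t^2)$, $\Phi_\ell$ the $\ell$-th cyclotomic polynomial, lies in $U_{\mathrm{res}}$; the unrolled generator $H\in\mathcal LU_q$ is $\epsilon_q^{-1}$ times its specialization, where $\epsilon_q=\lim_{t\to q}(t^{2\ell}-1)/\Phi_\ell(t^2)\in\mathbb C^\times$. **Modules.** For $i\ge0$ the Weyl module $\Delta_q(i)$ has basis $m_0,\dots,m_i$ with $Km_k=q^{i-2k}m_k$, $E^{(n)}m_k=\begin{bmatrix}i-k+n\\ n\end{bmatrix}_qm_{k-n}$, $F^{(n)}m_k=\begin{bmatrix}k+n\\ n\end{bmatrix}_qm_{k+n}$ ($m_s=0$ for $s<0$ or $s>i$). Its head $L_q(i)=\operatorname{top}\Delta_q(i)$ is simple. Type I modules: finite-dimensional modules that are direct sums of subspaces, indexed by integers $n$, on which $H$ acts as $n$ and $K$ as $q^n$. $P_q(i)$ is the projective cover of $L_q(i)$ in the category of finite-dimensional type I $\mathcal LU_q$-modules. *)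

(* Defs.v *)
From HB Require Import structures.
From mathcomp Require Import all_boot all_order all_algebra all_field.
From mathcomp Require Import boolp classical_sets reals topology normedtype.
From mathcomp Require Import complex.

Set Implicit Arguments.
Unset Strict Implicit.
Unset Printing Implicit Defensive.

Import Order.TTheory GRing.Theory Num.Theory.
Import numFieldNormedType.Exports.

Local Open Scope classical_set_scope.
Local Open Scope ring_scope.

Section Presentation.
Variables (k : comNzRingType) (X : Type).

Inductive nc_expr : Type :=
  | Gen of X
  | Cst of k
  | Add of nc_expr & nc_expr
  | Mul of nc_expr & nc_expr.

HB.instance Definition _ := gen_eqMixin nc_expr.
HB.instance Definition _ := gen_choiceMixin nc_expr.

Variable rels : nc_expr -> nc_expr -> Prop.

(* The least congruence that contains [rels] and makes the quotient an
   associative unital k-algebra; [Cst c] stands for c times the unit. *)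
Inductive pres_eq : nc_expr -> nc_expr -> Prop :=
  | pres_rel a b : rels a b -> pres_eq a b
  | pres_refl a : pres_eq a a
  | pres_sym a b : pres_eq a b -> pres_eq b a
  | pres_trans b a c : pres_eq a b -> pres_eq b c -> pres_eq a c
  | pres_addl a b c : pres_eq a b -> pres_eq (Add a c) (Add b c)
  | pres_mull a b c : pres_eq a b -> pres_eq (Mul a c) (Mul b c)
  | pres_mulr a b c : pres_eq a b -> pres_eq (Mul c a) (Mul c b)
  | pres_addC a b : pres_eq (Add a b) (Add b a)
  | pres_addA a b c : pres_eq (Add a (Add b c)) (Add (Add a b) c)
  | pres_add0 a : pres_eq (Add (Cst 0) a) a
  | pres_mul0 a : pres_eq (Mul (Cst 0) a) (Cst 0)
  | pres_mulA a b c : pres_eq (Mul a (Mul b c)) (Mul (Mul a b) c)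
  | pres_mul1 a : pres_eq (Mul (Cst 1) a) a
  | pres_mulDl a b c : pres_eq (Mul (Add a b) c) (Add (Mul a c) (Mul b c))
  | pres_mulDr a b c : pres_eq (Mul c (Add a b)) (Add (Mul c a) (Mul c b))
  | pres_cstD x y : pres_eq (Cst (x + y)) (Add (Cst x) (Cst y))
  | pres_cstM x y : pres_eq (Cst (x * y)) (Mul (Cst x) (Cst y))
  | pres_cstC x a : pres_eq (Mul (Cst x) a) (Mul a (Cst x)).

Definition pres_eqb : rel nc_expr := fun a b => `[< pres_eq a b >].

Fact pres_eqb_refl : reflexive pres_eqb.
Proof. by move=> a; apply/asboolP/pres_refl. Qed.

Fact pres_eqb_sym : symmetric pres_eqb.
Proof. by move=> a b; apply/asboolP/asboolP => /pres_sym. Qed.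

Fact pres_eqb_trans : transitive pres_eqb.
Proof. by move=> b a c /asboolP ab /asboolP bc; apply/asboolP/(pres_trans ab). Qed.

Canonical pres_equiv := EquivRel pres_eqb pres_eqb_refl pres_eqb_sym pres_eqb_trans.

Definition presAlg := {eq_quot pres_equiv}%qT.
HB.instance Definition _ := Choice.on presAlg.

Definition pcls (a : nc_expr) : presAlg := \pi_presAlg%qT a.
Definition prep (x : presAlg) : nc_expr := generic_quotient.repr x.

Lemma pclsP a b : pcls a = pcls b <-> pres_eq a b.
Proof.
rewrite /pcls; split=> [/eqmodP/asboolP //|h].
by apply/eqmodP/asboolP.
Qed.

Lemma prepK x : pcls (prep x) = x.
Proof. exact: reprK. Qed.

Lemma pclsK a : pres_eq (prep (pcls a)) a.
Proof. by apply/pclsP; rewrite prepK. Qed.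

Lemma pcls_ind (P : presAlg -> Prop) : (forall a, P (pcls a)) -> forall x, P x.
Proof. by move=> h x; rewrite -(prepK x). Qed.

Definition padd x y := pcls (Add (prep x) (prep y)).
Definition pmul x y := pcls (Mul (prep x) (prep y)).
Definition pcst c := pcls (Cst c).
Definition pgen g := pcls (Gen g).
Definition popp x := pmul (pcst (-1)) x.

Lemma paddE a b : padd (pcls a) (pcls b) = pcls (Add a b).
Proof.
apply/pclsP/(pres_trans (pres_addl _ (pclsK a))).
apply: pres_trans (pres_addC _ _) (pres_trans _ (pres_addC _ _)).
exact/pres_addl/pclsK.
Qed.

Lemma pmulE a b : pmul (pcls a) (pcls b) = pcls (Mul a b).
Proof.
apply/pclsP/(pres_trans (pres_mull _ (pclsK a))).
exact/pres_mulr/pclsK.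
Qed.

Fact paddA : associative padd.
Proof.
elim/pcls_ind=> a; elim/pcls_ind=> b; elim/pcls_ind=> c.
by rewrite !paddE; apply/pclsP/pres_addA.
Qed.

Fact paddC : commutative padd.
Proof.
elim/pcls_ind=> a; elim/pcls_ind=> b.
by rewrite !paddE; apply/pclsP/pres_addC.
Qed.

Fact padd0 : left_id (pcst 0) padd.
Proof. by elim/pcls_ind=> a; rewrite paddE; apply/pclsP/pres_add0. Qed.

Fact pmulA : associative pmul.
Proof.
elim/pcls_ind=> a; elim/pcls_ind=> b; elim/pcls_ind=> c.
by rewrite !pmulE; apply/pclsP/pres_mulA.
Qed.

Fact pmul1 : left_id (pcst 1) pmul.
Proof. by elim/pcls_ind=> a; rewrite pmulE; apply/pclsP/pres_mul1. Qed.

Lemma pcstC c x : pmul (pcst c) x = pmul x (pcst c).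
Proof. by elim/pcls_ind: x => a; rewrite !pmulE; apply/pclsP/pres_cstC. Qed.

Fact pmulr1 : right_id (pcst 1) pmul.
Proof. by move=> x; rewrite -pcstC pmul1. Qed.

Fact pmulDl : left_distributive pmul padd.
Proof.
elim/pcls_ind=> a; elim/pcls_ind=> b; elim/pcls_ind=> c.
by rewrite !(paddE, pmulE); apply/pclsP/pres_mulDl.
Qed.

Fact pmulDr : right_distributive pmul padd.
Proof.
elim/pcls_ind=> c; elim/pcls_ind=> a; elim/pcls_ind=> b.
by rewrite !(paddE, pmulE); apply/pclsP/pres_mulDr.
Qed.

Lemma pcstD c d : pcst (c + d) = padd (pcst c) (pcst d).
Proof. by rewrite paddE; apply/pclsP/pres_cstD. Qed.

Lemma pcstM c d : pcst (c * d) = pmul (pcst c) (pcst d).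
Proof. by rewrite pmulE; apply/pclsP/pres_cstM. Qed.

Lemma pmul0 x : pmul (pcst 0) x = pcst 0.
Proof. by elim/pcls_ind: x => a; rewrite pmulE; apply/pclsP/pres_mul0. Qed.

Fact paddN : left_inverse (pcst 0) popp padd.
Proof.
by move=> x; rewrite /popp -{2}(pmul1 x) -pmulDl -pcstD addNr pmul0.
Qed.

HB.instance Definition _ :=
  GRing.isZmodule.Build presAlg paddA paddC padd0 paddN.
HB.instance Definition _ :=
  GRing.Zmodule_isPzRing.Build presAlg pmulA pmul1 pmulr1 pmulDl pmulDr.

Definition pscale c x := pmul (pcst c) x.

Fact pscaleA a b v : pscale a (pscale b v) = pscale (a * b) v.
Proof. by rewrite /pscale pmulA pcstM. Qed.

Fact pscale1 : left_id 1 pscale.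
Proof. exact: pmul1. Qed.

Fact pscaleDr : right_distributive pscale +%R.
Proof. by move=> c x y; rewrite /pscale pmulDr. Qed.

Fact pscaleDl v : {morph pscale^~ v : a b / a + b}.
Proof. by move=> a b; rewrite /pscale pcstD pmulDl. Qed.

HB.instance Definition _ := GRing.Zmodule_isLmodule.Build k presAlg
  pscaleA pscale1 pscaleDr pscaleDl.

End Presentation.

Arguments Gen {k X} _.
Arguments Cst {k X} _.
Arguments pgen {k X} rels _.

Section Modules.
Variables (k : fieldType) (X : Type) (rels : nc_expr k X -> nc_expr k X -> Prop).
Local Notation A := (presAlg rels).

Record module_on (V : vectType k) := ModuleOn {
  action :> A -> 'End(V);
  action1 : action 1 = \1%VF;
  actionM : forall a b, action (a * b) = (action a \o action b)%VF;
  actionP : forall c a b, action (c *: a + b) = c *: action a + action b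
}.

Record fdmod := FdMod { carrier :> vectType k; structure : module_on carrier }.

Definition act (M : fdmod) (a : A) : 'End(M) := structure M a.

Definition is_hom (M N : fdmod) (f : 'Hom(M, N)) : Prop :=
  forall a v, f (act M a v) = act N a (f v).

Definition isomorphic (M N : fdmod) : Prop :=
  exists f : 'Hom(M, N), is_hom f /\ bijective f.

Definition stable (M : fdmod) (U : {vspace M}) : Prop :=
  forall a v, v \in U -> act M a v \in U.

Record submodule (M : fdmod) := Submodule {
  subspace :> {vspace M};
  submodP : stable subspace
}.

Section Sub.
Variables (M : fdmod) (U : submodule M).

Definition sub_action (a : A) : 'End(subvs_of U) :=
  (linfun (vsproj U) \o act M a \o linfun (@vsval k M U))%VF.

Lemma sub_actionE a w : vsval (sub_action a w) = act M a (vsval w).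
Proof. by rewrite !comp_lfunE !lfunE /= vsprojK // submodP // subvsP. Qed.

Fact sub_action1 : sub_action 1 = \1%VF.
Proof.
apply/lfunP=> w; apply: val_inj; rewrite /= sub_actionE.
by rewrite /act action1 !lfunE.
Qed.

Fact sub_actionM a b : sub_action (a * b) = (sub_action a \o sub_action b)%VF.
Proof.
apply/lfunP=> w; apply: val_inj; rewrite /= comp_lfunE !sub_actionE.
by rewrite /act actionM comp_lfunE.
Qed.

Fact sub_actionP c a b :
  sub_action (c *: a + b) = c *: sub_action a + sub_action b.
Proof.
apply/lfunP=> w; apply: val_inj.
rewrite /= sub_actionE add_lfunE scale_lfunE linearP /= !sub_actionE.
by rewrite /act actionP add_lfunE scale_lfunE.
Qed.

Definition submod : fdmod := FdMod (ModuleOn sub_action1 sub_actionM sub_actionP).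

(* M / U is realised on the complement U^C of U: [quot_proj] is the projection
   of M onto U^C along U, and is the quotient map. *)
Definition quot_proj : 'Hom(M, subvs_of (U^C)%VS) :=
  (linfun (vsproj (U^C)%VS) \o daddv_pi (U^C)%VS U)%VF.

Definition quot_action (a : A) : 'End(subvs_of (U^C)%VS) :=
  (quot_proj \o act M a \o linfun (@vsval k M (U^C)%VS))%VF.

Lemma quot_projE v : vsval (quot_proj v) = daddv_pi (U^C)%VS U v.
Proof. by rewrite comp_lfunE lfunE /= vsprojK // memv_pi. Qed.

Lemma capCv : (U^C :&: U)%VS = 0%VS.
Proof. by rewrite capvC capv_compl. Qed.

Lemma quot_projK w : quot_proj (vsval w) = w.
Proof. by apply: val_inj; rewrite /= quot_projE daddv_pi_id ?capCv ?subvsP. Qed.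

Lemma quot_decomp v : v - vsval (quot_proj v) \in (U : {vspace M}).
Proof.
rewrite quot_projE -{1}(daddv_pi_add capCv (w := v)).
  by rewrite addrC addKr memv_pi.
by rewrite addvC addv_complf memvf.
Qed.

Lemma quot_proj_eq0 v : (quot_proj v == 0) = (v \in (U : {vspace M})).
Proof.
apply/eqP/idP=> [e|vU]; first by have := quot_decomp v; rewrite e /= subr0.
apply: val_inj; rewrite /= quot_projE.
have := daddv_pi_add capCv (w := v); rewrite addvC addv_complf memvf => /(_ isT).
rewrite (daddv_pi_id (U := U)) ?capv_compl // => /(congr1 (fun x => x - v)).
by rewrite addrK subrr.
Qed.

Lemma quot_projM a v : quot_proj (act M a v) = quot_action a (quot_proj v).
Proof.
have -> : quot_action a (quot_proj v)
        = quot_proj (act M a (vsval (quot_proj v))).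
  by rewrite /quot_action; move: quot_proj => P; rewrite !comp_lfunE lfunE.
by apply/eqP; rewrite -subr_eq0 -2!linearB quot_proj_eq0 submodP // quot_decomp.
Qed.

Fact quot_action1 : quot_action 1 = \1%VF.
Proof. by apply/lfunP=> w; rewrite -[w]quot_projK -quot_projM /act action1 !lfunE. Qed.

Fact quot_actionM a b : quot_action (a * b) = (quot_action a \o quot_action b)%VF.
Proof.
apply/lfunP=> w; rewrite -[w]quot_projK -quot_projM comp_lfunE -!quot_projM.
by rewrite /act actionM comp_lfunE.
Qed.

Fact quot_actionP c a b :
  quot_action (c *: a + b) = c *: quot_action a + quot_action b.
Proof.
apply/lfunP=> w; rewrite -[w]quot_projK -quot_projM add_lfunE scale_lfunE.
by rewrite -!quot_projM /act actionP add_lfunE scale_lfunE linearP.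
Qed.

Definition quotmod : fdmod :=
  FdMod (ModuleOn quot_action1 quot_actionM quot_actionP).

End Sub.

Lemma bigcap_submodule_ex (M : fdmod) (P : submodule M -> Prop) :
  exists U : submodule M,
    forall v, (v \in (U : {vspace M})) <->
      (forall W : submodule M, P W -> v \in (W : {vspace M})).
Proof.
pose big (n : nat) := `[< exists U : submodule M, \dim U = n /\
  forall v, (forall W : submodule M, P W -> v \in (W : {vspace M})) ->
    v \in (U : {vspace M}) >].
have exn : exists n, big n.
  exists (\dim {:M}); apply/asboolP.
  have st : stable (M := M) fullv by move=> *; rewrite memvf.
  by exists (Submodule st); split=> // v _; rewrite memvf.
case: (ex_minnP exn) => n /asboolP[U [dU hU]] minn.
exists U => v; split=> [vU W PW|]; last exact: hU.
have st : stable (M := M) (U :&: W)%VS.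
  by move=> a w /memv_capP[wU wW]; apply/memv_capP; split; apply: submodP.
have : (n <= \dim (U :&: W)%VS)%N.
  apply: minn; apply/asboolP; exists (Submodule st); split=> // w hw.
  by apply/memv_capP; split; [apply: hU | apply: hw].
rewrite -dU => le; have /eqP e : (U :&: W)%VS == U.
  by rewrite eqEdim capvSl.
by move: vU; rewrite -e => /memv_capP[].
Qed.

Definition bigcap_submodule (M : fdmod) (P : submodule M -> Prop) : submodule M :=
  sval (cid (bigcap_submodule_ex P)).

Definition generated (M : fdmod) (S : set M) : submodule M :=
  bigcap_submodule
    (fun U : submodule M => forall v, S v -> v \in (U : {vspace M})).

Definition maximal_submodule (M : fdmod) (U : submodule M) : Prop :=
  (U : {vspace M}) <> fullv /\
  forall W : submodule M, (U <= W)%VS ->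
    (W : {vspace M}) = U \/ (W : {vspace M}) = fullv.

Definition radical (M : fdmod) : submodule M :=
  bigcap_submodule (@maximal_submodule M).

Definition top (M : fdmod) : fdmod := quotmod (radical M).

(* projectivity in the full subcategory of the modules that satisfy [Cat] *)
Definition projective_in (Cat : fdmod -> Prop) (P : fdmod) : Prop :=
  forall (M N : fdmod) (g : 'Hom(M, N)) (f : 'Hom(P, N)),
    Cat M -> Cat N -> is_hom g -> is_hom f -> limg g = fullv ->
    exists h : 'Hom(P, M), is_hom h /\ (g \o h)%VF = f.

Definition superfluous (M : fdmod) (U : {vspace M}) : Prop :=
  forall W : submodule M, (U + W)%VS = fullv -> (W : {vspace M}) = fullv.

Definition projective_cover (Cat : fdmod -> Prop) (P L : fdmod) : Prop :=
  [/\ Cat P, projective_in Cat P &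
      exists f : 'Hom(P, L), [/\ is_hom f, limg f = fullv & superfluous (lker f)]].

End Modules.

Section QNumbers.
Variables (F : fieldType) (t : F).

Definition qint (n : int) : F := (t ^ n - t ^ (- n)) / (t - t^-1).

Definition qfact (n : nat) : F := \prod_(1 <= k < n.+1) qint k%:Z.

Definition qbin (m n : int) : F :=
  if (0 <= n) && (n <= m)
  then qfact `|m|%N / (qfact `|n|%N * qfact `|m - n|%N) else 0.

(* P(t) / t^n; every element of Z[t, t^-1] has this form *)
Definition laurent (P : {poly int}) (n : nat) : F :=
  (map_poly intr P).[t] / t ^+ n.

End QNumbers.

Notation Qt := {fraction {poly rat}}.
Definition tQ : Qt := (tofrac 'X).

Variant uq_gen := GE | GF | GK | GKinv.

Definition expr_sub (k : comNzRingType) X (a b : nc_expr k X) : nc_expr k X :=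
  Add a (Mul (Cst (-1)) b).

Local Notation uexpr := (nc_expr Qt uq_gen).

Variant uq_rel : uexpr -> uexpr -> Prop :=
  | uq_KE : uq_rel (Mul (Mul (Gen GK) (Gen GE)) (Gen GKinv))
                   (Mul (Cst (tQ ^+ 2)) (Gen GE))
  | uq_KF : uq_rel (Mul (Mul (Gen GK) (Gen GF)) (Gen GKinv))
                   (Mul (Cst (tQ ^- 2)) (Gen GF))
  | uq_KKinv : uq_rel (Mul (Gen GK) (Gen GKinv)) (Cst 1)
  | uq_KinvK : uq_rel (Mul (Gen GKinv) (Gen GK)) (Cst 1)
  | uq_EF : uq_rel (expr_sub (Gen GK) (Gen GKinv))
                   (Mul (Cst (tQ - tQ^-1))
                      (expr_sub (Mul (Gen GE) (Gen GF)) (Mul (Gen GF) (Gen GE)))).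

Definition Ut := presAlg uq_rel.

Definition uE : Ut := pgen uq_rel GE.
Definition uF : Ut := pgen uq_rel GF.
Definition uK : Ut := pgen uq_rel GK.
Definition uKinv : Ut := pgen uq_rel GKinv.

Definition divpow (x : Ut) (n : nat) : Ut := (qfact tQ n)^-1 *: x ^+ n.

Inductive in_Ures : Ut -> Prop :=
  | in_Ures_K : in_Ures uK
  | in_Ures_Kinv : in_Ures uKinv
  | in_Ures_E n : in_Ures (divpow uE n)
  | in_Ures_F n : in_Ures (divpow uF n)
  | in_Ures_1 : in_Ures 1
  | in_Ures_add x y : in_Ures x -> in_Ures y -> in_Ures (x + y)
  | in_Ures_mul x y : in_Ures x -> in_Ures y -> in_Ures (x * y)
  | in_Ures_scale P n x : in_Ures x -> in_Ures (laurent tQ P n *: x).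

Definition ures_pred : {pred Ut} := fun x => `[< in_Ures x >].

Lemma ures_predP x : reflect (in_Ures x) (x \in ures_pred).
Proof. exact: asboolP. Qed.

Fact ures_subring : subring_closed ures_pred.
Proof.
split=> [|x y /ures_predP hx /ures_predP hy|x y /ures_predP hx /ures_predP hy].
- exact/ures_predP/in_Ures_1.
- apply/ures_predP/in_Ures_add => //.
  have -> : - y = laurent tQ (-1) 0 *: y.
    by rewrite /laurent rmorphN1 expr0 divr1 hornerN hornerC scaleN1r.
  exact: in_Ures_scale.
- exact/ures_predP/in_Ures_mul.
Qed.

Record Ures := MkUres { ures_val :> Ut; uresP : ures_val \in ures_pred }.
HB.instance Definition _ := [isSub for ures_val].
HB.instance Definition _ := [Choice of Ures by <:].
HB.instance Definition _ := 
  GRing.SubChoice_isSubPzRing.Build Ut ures_pred Ures ures_subring.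

Definition mk_ures x (h : in_Ures x) : Ures := MkUres (introT (ures_predP x) h).

Definition ures_scale (P : {poly int}) (n : nat) (u : Ures) : Ures :=
  mk_ures (in_Ures_scale P n (elimT (ures_predP u) (uresP u))).

Section Specialization.
Variables (C : fieldType) (q : C).

(* Base change of U_res along Z[t, t^-1] -> C, t |-> q: the C-algebra
   generated by the image of U_res, in which U_res keeps its ring operations
   and a Laurent polynomial acts through its value at q. *)
Variant spec_rel : nc_expr C Ures -> nc_expr C Ures -> Prop :=
  | spec_add u v : spec_rel (Gen (u + v)) (Add (Gen u) (Gen v))
  | spec_mul u v : spec_rel (Gen (u * v)) (Mul (Gen u) (Gen v))
  | spec_one : spec_rel (Gen 1) (Cst 1)
  | spec_scale P n u :
      spec_rel (Gen (ures_scale P n u)) (Mul (Cst (laurent q P n)) (Gen u)).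

Definition LU := presAlg spec_rel.

Definition specialize (u : Ures) : LU := pgen spec_rel u.

Definition LK : LU := specialize (mk_ures in_Ures_K).
Definition LE (n : nat) : LU := specialize (mk_ures (in_Ures_E n)).
Definition LF (n : nat) : LU := specialize (mk_ures (in_Ures_F n)).

End Specialization.

Notation LUmod q := (fdmod (spec_rel q)).

Section AtQ.
Variables (C : numFieldType) (q : C).

Definition cvg_at_q (f : C -> C) : Prop := cvg (f t @[t --> q^']).
Definition lim_at_q (f : C -> C) : C := lim (f t @[t --> q^']).

Definition qbinq (m n : int) : C := lim_at_q (fun t => qbin t m n).

Definition cyclo_at (F : fieldType) (l : nat) (x : F) : F :=
  (map_poly intr 'Phi_l).[x].

Definition epsq (l : nat) : C :=
  lim_at_q (fun t => (t ^+ (2 * l) - 1) / cyclo_at l (t ^+ 2)).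

Definition unrolled_num (l : nat) : Ut :=
  (cyclo_at l (tQ ^+ 2))^-1 *: (uK ^+ (2 * l) - 1).

(* [unrolled_num l] does lie in U_res, so the default value 0 is not used. *)
Definition LH (l : nat) : LU q :=
  (epsq l)^-1 *: specialize q (insubd (0 : Ures) (unrolled_num l)).

Definition typeI (l : nat) (M : LUmod q) : Prop :=
  exists (N : nat) (wt : 'I_N -> int) (W : 'I_N -> {vspace M}),
    [/\ injective wt, directv (\sum_n W n)%VS, (\sum_n W n)%VS = fullv &
        forall n v, v \in W n ->
          act M (LH l) v = (wt n)%:~R *: v /\ act M (LK q) v = q ^ wt n *: v].

(* the k-th standard basis vector of C^d.+1, and 0 when k is not in {0,...,d} *)
Definition bvec (d : nat) (k : int) : 'rV[C]_d.+1 :=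
  if (0 <= k) && (k <= d%:Z) then delta_mx 0 (inord `|k|%N) else 0.

Definition weyl_formulas (d : nat) (D : module_on (spec_rel q) 'rV[C]_d.+1) :=
  forall k : nat, (k <= d)%N ->
    D (LK q) (bvec d k) = q ^ (d%:Z - (2 * k)%:Z) *: bvec d k /\
    forall n : nat,
      D (LE q n) (bvec d k)
        = qbinq (d%:Z - k%:Z + n%:Z) n *: bvec d (k%:Z - n%:Z) /\
      D (LF q n) (bvec d k) = qbinq (k%:Z + n%:Z) n *: bvec d (k%:Z + n%:Z).

Section Tilting.
Variables (l s i j : nat).

Definition gamma_fun (p v : nat) (t : C) : C :=
  (qfact t v)^-1 *
  \sum_(0 <= u < v)
    qbin t (l%:Z - s%:Z + p%:Z - u%:Z - 2) (p%:Z - u%:Z) *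
    (\prod_(1 <= a < u.+1) qint t (i%:Z - p%:Z + a%:Z)) *
    (\prod_(u.+1 <= b < v) qint t (i%:Z + l%:Z - s%:Z - p%:Z + b%:Z)).

Definition omega_fun (p v : nat) (t : C) : C :=
  (qint t (l%:Z - s%:Z + i%:Z))^-1 *
  qbin t (l%:Z - s%:Z + p%:Z + v%:Z - 1) (p%:Z + v%:Z) *
  qbin t (p%:Z + v%:Z) v%:Z.

Definition gamma (p v : nat) : C := lim_at_q (gamma_fun p v).

Definition omega (p v : nat) : C :=
  if i%:Z - p%:Z < v%:Z then lim_at_q (omega_fun p v) else 0.

(* indices of the vector m that goes with gamma p v and omega p v *)
Definition idxE (p v : nat) : int := l%:Z - s%:Z + p%:Z - v%:Z - 1.
Definition idxF (p v : nat) : int := l%:Z - s%:Z + p%:Z + v%:Z - 1.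

Definition Tspace : vectType C := ('rV[C]_j.+1 * 'rV[C]_i.+1)%type.
Definition mvec (k : int) : Tspace := (bvec j k, 0).
Definition nvec (p : int) : Tspace := (0, bvec i p).

Definition limits_exist : Prop :=
  forall p v : nat, (p <= i)%N ->
    (0 <= idxE p v <= j%:Z -> cvg_at_q (gamma_fun p v)) /\
    (0 <= idxF p v <= j%:Z -> i%:Z - p%:Z < v%:Z -> cvg_at_q (omega_fun p v)).

(* [mvec] vanishes outside {0,...,j}, so the values of [gamma] and [omega] are
   irrelevant there, even where the limits do not exist. *)
Definition tilting_formulas (T : module_on (spec_rel q) Tspace) : Prop :=
  (forall k : nat, (k <= j)%N ->
     T (LK q) (mvec k) = q ^ (j%:Z - (2 * k)%:Z) *: mvec k /\
     forall v : nat,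
       T (LE q v) (mvec k)
         = qbinq (j%:Z - k%:Z + v%:Z) v *: mvec (k%:Z - v%:Z) /\
       T (LF q v) (mvec k) = qbinq (k%:Z + v%:Z) v *: mvec (k%:Z + v%:Z)) /\
  (forall p : nat, (p <= i)%N ->
     T (LK q) (nvec p) = q ^ (i%:Z - (2 * p)%:Z) *: nvec p /\
     forall v : nat,
       T (LE q v) (nvec p)
         = qbinq (i%:Z - p%:Z + v%:Z) v *: nvec (p%:Z - v%:Z)
           + gamma p v *: mvec (idxE p v) /\
       T (LF q v) (nvec p)
         = qbinq (p%:Z + v%:Z) v *: nvec (p%:Z + v%:Z)
           + omega p v *: mvec (idxF p v)).

End Tilting.

End AtQ.

(* Main.v *)
Require Import Defs.
From HB Require Import structures.
From mathcomp Require Import all_boot all_order all_algebra all_field.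
From mathcomp Require Import boolp classical_sets reals topology normedtype.
From mathcomp Require Import complex ring zify.

Set Implicit Arguments.
Unset Strict Implicit.
Unset Printing Implicit Defensive.

Import Order.TTheory GRing.Theory Num.Theory.
Import numFieldNormedType.Exports.

Local Open Scope ring_scope.

(** Put [a = l - s - 1] and [N = i + a + 1 = (r + 1) l]. Over Q(t) the operators
    E, F, K given by the formulas of the statement for v = 1 satisfy the defining relations of
    U_t sl_2, and the closed formulas for E^(v), F^(v) show that the lattice spanned by the m_k and
    n_p over the rational functions regular at q is stable under U_res: the only pole comes from
    1/[N]_t, and it is simple and cancelled by a zero of the q-binomial. Specializing gives T_q(i);
    limits at q are values at q of regular rational functions.

    For projectivity, let y be a vector of weight i in a type I module. The sequences
    theta = psi + zetaF_a / [j choose a]_t and zeta, which are regular at q although psi and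
    1/[j choose a]_t are not, define Y = sum_b theta_b F^(b)E^(b) y and
    Z = sum_b zeta_b F^(b)E^(b+a) y such that E^(n) Z = 0 and E^(n) Y is a multiple of some F^(k) Z
    for every n > 0. So the F^(p) Y (p <= i) and F^(k) Z (k <= j) span a submodule of dimension at
    most dim T_q(i). Given a surjection g : M -> N and f : T_q(i) -> N, apply this to
    (n_0, y) in T_q(i) + M, where y has weight i and g y = f n_0. The component of Y in T_q(i) is
    n_0 + d m_a, which generates T_q(i), so the submodule is the graph of a lift of f. The same
    generation property makes the kernel of T_q(i) -> top of Delta_q(i) superfluous. *)

(** * Presented algebras and their modules *)

(** At q the E^(n) with n >= l are not polynomials in E, so being killed by E says little.
    Statements about all E^(n) are reduced to n = 1 over Q(t), where quantum integers can be
    cancelled, and only then specialized; hence every coefficient must be regular at q. The sequence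
    psi is the one with psi_0 = 1 for which E kills sum_b psi_b F^(b) E^(b) y. From b = a on it
    contains 1/[N], which has a pole at q. The remedy is to add a multiple of F^(a) Z, which has the
    same weight: its coefficient 1/[j choose a] owes its pole to the same [N], and the two singular
    parts cancel.

    A second obstacle is that K sees a weight n only through q^n, while moving E^(n) past F^(b)
    requires the scalar by which [K; c choose d] acts, which for d >= l depends on n itself. H
    supplies it: up to a polynomial in K^2 its numerator is a multiple of K^l [K; 0 choose l],
    because prod_x (X - t^(2x)) and X^l - 1 agree modulo Phi_l(t^2). *)

Section PresentedAlgebra.
Variables (k : comNzRingType) (X : Type) (rels : nc_expr k X -> nc_expr k X -> Prop).
Local Notation A := (presAlg rels).

Lemma pres_scalerAl (c : k) (x y : A) : c *: (x * y) = (c *: x) * y.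
Proof. exact: pmulA. Qed.

Lemma pres_scalerAr (c : k) (x y : A) : c *: (x * y) = x * (c *: y).
Proof.
transitivity (pmul (pcst rels c) (pmul x y)); first by [].
by rewrite pmulA pcstC -pmulA.
Qed.

Lemma pcstE c : pcst rels c = c *: (1 : A).
Proof. by rewrite -[pcst rels c]mulr1. Qed.

Lemma pclsD a b : pcls rels (Add a b) = pcls rels a + pcls rels b.
Proof. by rewrite -paddE. Qed.

Lemma pclsM a b : pcls rels (Mul a b) = pcls rels a * pcls rels b.
Proof. by rewrite -pmulE. Qed.

Lemma pcls_rel a b : rels a b -> pcls rels a = pcls rels b.
Proof. by move=> ab; apply/pclsP/pres_rel. Qed.

Lemma presAlg_ind (P : A -> Prop) :
  (forall g, P (pgen rels g)) -> (forall c, P (c *: (1 : A))) ->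
  (forall x y, P x -> P y -> P (x + y)) ->
  (forall x y, P x -> P y -> P (x * y)) -> forall x, P x.
Proof.
move=> hg hc hD hM; elim/pcls_ind; elim=> [g|c|a ha b hb|a ha b hb].
- exact: hg.
- by rewrite -[pcls _ _]/(pcst rels c) pcstE.
- by rewrite pclsD; apply: hD.
- by rewrite pclsM; apply: hM.
Qed.

End PresentedAlgebra.

(** * Modules given by operators on the generators that satisfy the relations *)

Section ModuleFromGenerators.
Variables (k : fieldType) (X : Type) (rels : nc_expr k X -> nc_expr k X -> Prop).
Variables (V : vectType k) (f : X -> 'End(V)).

Fixpoint expr_op (a : nc_expr k X) : 'End(V) :=
  match a with
  | Gen g => f g
  | Cst c => c *: \1%VF
  | Add a b => expr_op a + expr_op b
  | Mul a b => (expr_op a \o expr_op b)%VF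
  end.

Hypothesis frel : forall a b, rels a b -> expr_op a = expr_op b.

Lemma expr_op_eq a b : pres_eq rels a b -> expr_op a = expr_op b.
Proof.
elim=> {a b} /=; try by move=> *; congruence.
- exact: frel.
- by move=> a b; rewrite addrC.
- by move=> a b c; rewrite addrA.
- by move=> a; rewrite scale0r add0r.
- by move=> a; rewrite scale0r comp_lfun0l.
- by move=> a b c; rewrite comp_lfunA.
- by move=> a; rewrite scale1r comp_lfun1l.
- by move=> a b c; rewrite comp_lfunDl.
- by move=> a b c; rewrite comp_lfunDr.
- by move=> x y; rewrite scalerDl.
- by move=> x y; rewrite -comp_lfunZl comp_lfun1l scalerA.
- by move=> x a; rewrite -comp_lfunZl -comp_lfunZr comp_lfun1l comp_lfun1r.
Qed.

Definition gen_action (x : presAlg rels) : 'End(V) := expr_op (prep x).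

Lemma gen_actionE a : gen_action (pcls rels a) = expr_op a.
Proof. exact/expr_op_eq/pclsK. Qed.

Fact gen_action1 : gen_action 1 = \1%VF.
Proof. by rewrite [1]/(pcls rels (Cst 1)) gen_actionE /= scale1r. Qed.

Fact gen_actionM x y : gen_action (x * y) = (gen_action x \o gen_action y)%VF.
Proof.
by elim/pcls_ind: x => a; elim/pcls_ind: y => b; rewrite -pclsM !gen_actionE.
Qed.

Fact gen_actionP c x y : gen_action (c *: x + y) = c *: gen_action x + gen_action y.
Proof.
elim/pcls_ind: x => a; elim/pcls_ind: y => b.
have -> : c *: pcls rels a + pcls rels b = pcls rels (Add (Mul (Cst c) a) b).
  by rewrite pclsD pclsM.
by rewrite !gen_actionE /= -comp_lfunZl comp_lfun1l.
Qed.

Definition gen_module : module_on rels V :=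
  ModuleOn gen_action1 gen_actionM gen_actionP.

Lemma gen_module_gen g : gen_module (pgen rels g) = f g.
Proof. exact: gen_actionE. Qed.

End ModuleFromGenerators.

Section ModuleTheory.
Variables (k : fieldType) (X : Type) (rels : nc_expr k X -> nc_expr k X -> Prop).
Implicit Types (V : vectType k) (M N : fdmod rels) (a b : presAlg rels).

Lemma actionD V (T : module_on rels V) a b : T (a + b) = T a + T b.
Proof. by rewrite -[a]scale1r actionP !scale1r. Qed.

Lemma action0 V (T : module_on rels V) : T 0 = 0.
Proof. by apply: (addrI (T 0)); rewrite -actionD !addr0. Qed.

Lemma actionZ V (T : module_on rels V) c a : T (c *: a) = c *: T a.
Proof. by rewrite -[c *: a]addr0 actionP action0 addr0. Qed.

Lemma actMv M a b v : act M (a * b) v = act M a (act M b v).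
Proof. by rewrite /act actionM comp_lfunE. Qed.

Lemma actDv M a b v : act M (a + b) v = act M a v + act M b v.
Proof. by rewrite /act actionD add_lfunE. Qed.

Lemma act0v M v : act M 0 v = 0.
Proof. by rewrite /act action0 zero_lfunE. Qed.

Lemma actZv M c a v : act M (c *: a) v = c *: act M a v.
Proof. by rewrite /act actionZ scale_lfunE. Qed.

Lemma act1v M v : act M 1 v = v.
Proof. by rewrite /act action1 id_lfunE. Qed.

Lemma actBv M a b v : act M (a - b) v = act M a v - act M b v.
Proof. by rewrite -scaleN1r actDv actZv scaleN1r. Qed.

Lemma act_sumv M I (r : seq I) (P : pred I) (F : I -> presAlg rels) v :
  act M (\sum_(x <- r | P x) F x) v = \sum_(x <- r | P x) act M (F x) v.
Proof.
elim/big_rec2: _ => [|x a b _ <-]; first exact: act0v.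
by rewrite actDv.
Qed.

Lemma act_suml M a I (r : seq I) (P : pred I) (F : I -> M) :
  act M a (\sum_(x <- r | P x) F x) = \sum_(x <- r | P x) act M a (F x).
Proof. exact: linear_sum. Qed.

End ModuleTheory.

Section LinearFunctions.
Variables (k : fieldType) (U V : vectType k).

(** The sigma type gives an opaque map known only by its values, so that nothing later unfolds it to
    a matrix. *)
Lemma lfun_of_linear (f : U -> V) : linear f -> {h : 'Hom(U, V) | h =1 f}.
Proof.
move=> lf; pose g : {linear U -> V} := HB.pack f (GRing.isLinear.Build k U V *:%R f lf).
by exists (linfun g) => x; rewrite lfunE.
Qed.

End LinearFunctions.

Section DirectSum.
Variables (k : fieldType) (X : Type) (rels : nc_expr k X -> nc_expr k X -> Prop).
Variables M N : fdmod rels.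
Local Notation MN := (M * N)%type.

Fact dsum_linear a : linear (fun x : MN => (act M a x.1, act N a x.2)).
Proof. by move=> c x y; rewrite /= !linearP. Qed.

Definition dsum_action a : 'End(MN) := sval (lfun_of_linear (dsum_linear a)).

Lemma dsum_actionE a (x : MN) : dsum_action a x = (act M a x.1, act N a x.2).
Proof. exact: (svalP (lfun_of_linear (dsum_linear a))). Qed.

Fact dsum_action1 : dsum_action 1 = \1%VF.
Proof. by apply/lfunP=> x; rewrite dsum_actionE !act1v id_lfunE -surjective_pairing. Qed.

Fact dsum_actionM a b : dsum_action (a * b) = (dsum_action a \o dsum_action b)%VF.
Proof. by apply/lfunP=> x; rewrite comp_lfunE !dsum_actionE !actMv. Qed.

Fact dsum_actionP c a b :
  dsum_action (c *: a + b) = c *: dsum_action a + dsum_action b.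
Proof.
apply/lfunP=> x; rewrite add_lfunE scale_lfunE !dsum_actionE.
by rewrite !actDv !actZv.
Qed.

(** Lifts of maps out of T_q(i) are found as submodules of a direct sum T_q(i) + M that are
    graphs. *)
Definition dsum : fdmod rels :=
  FdMod (ModuleOn dsum_action1 dsum_actionM dsum_actionP).

Lemma dsumE a (x : MN) : act dsum a x = (act M a x.1, act N a x.2).
Proof. exact: dsum_actionE. Qed.

End DirectSum.

(** * Quantum integers *)

Lemma expfz_split (F : fieldType) (t : F) : t != 0 ->
  prod (forall m n : int, t ^ (m + n) = t ^ m * t ^ n)
       (forall m : int, t ^ (- m) = (t ^ m)^-1).
Proof. by move=> t0; split=> *; rewrite ?expfzDr ?invr_expz. Qed.

(** Treats 1/(t - 1/t) as a common factor, splits the exponents, and replaces every remaining power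
    of t by a nonzero variable, so that [field] only sees a rational identity. *)
Ltac qfield t t0 :=
  rewrite /qint; move: (t - t^-1)^-1 => ?;
  rewrite ?PoszD ?PoszM ?intS ?PoszD ?(expfz_split t0) ?expr1z ?expr0z;
  repeat match goal with |- context [exprz t ?x] =>
    let h := fresh in have h : t ^ x != 0 by [rewrite expfz_neq0];
    move: (t ^ x) h => ? ?
  end;
  field; rewrite -?andbA; repeat (apply/andP; split); try by [rewrite ?oner_eq0].

Section QIntegers.
Variables (F : fieldType) (t : F).
Hypothesis t0 : t != 0.
Local Notation qn := (qint t).

Lemma qint0 : qn 0 = 0.
Proof. by rewrite /qint oppr0 subrr mul0r. Qed.

Lemma qintN n : qn (- n) = - qn n.
Proof. by rewrite /qint opprK -mulNr opprB. Qed.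

Lemma qint_shift (x d : int) : t ^ (- d) * qn (x - d) + t ^ (x - d) * qn d = qn x.
Proof. by qfield t t0. Qed.

(** The three-term (Plücker) relation of quantum integers, the source of [qint_comm],
    [gq_three_term] and [shiftE1_zetaF]. *)
Lemma qint_cross (x w d : int) :
  qn (x - d) * qn (w - d) + qn (x + w - d) * qn d = qn x * qn w.
Proof. by qfield t t0. Qed.

Hypothesis t1 : t - t^-1 != 0.

Lemma qint1 : qn 1 = 1.
Proof. by rewrite /qint expr1z exprN1 divff. Qed.

Lemma qfact0 : qfact t 0 = 1.
Proof. by rewrite /qfact big_geq. Qed.

Lemma qfactS n : qfact t n.+1 = qn n.+1 * qfact t n.
Proof. by rewrite /qfact big_nat_recr //= mulrC. Qed.

(* The q-binomial [c choose d] for an arbitrary integer c. *)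
Fixpoint gq (c : int) (d : nat) : F :=
  if d is d'.+1 then (qn d)^-1 * (qn c * gq (c - 1) d') else 1.

Lemma gqS c d : gq c d.+1 = (qn d.+1)^-1 * (qn c * gq (c - 1) d).
Proof. by []. Qed.

Lemma gq1 c : gq c 1 = qn c.
Proof. by rewrite /= qint1 invr1 mul1r mulr1. Qed.

Lemma gqSr c d : gq c d.+1 = (qn d.+1)^-1 * (qn (c - d%:Z) * gq c d).
Proof.
elim: d c => [|d IH] c; first by rewrite /= subr0.
rewrite gqS IH [gq c d.+1]gqS.
have -> : c - 1 - d%:Z = c - d.+1%:Z by rewrite -addn1 PoszD opprD addrA addrAC.
ring.
Qed.

End QIntegers.

Section GenericParameter.
Variables (F : fieldType) (t : F).
Hypotheses (t0 : t != 0) (tgen : forall n, (0 < n)%N -> t ^+ (n * 2) != 1).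
Local Notation qn := (qint t).

Lemma generic_subV_neq0 : t - t^-1 != 0.
Proof.
apply/eqP => h; have := @tgen 1 isT; rewrite mul1n expr2.
by move: h => /(congr1 (fun x => x * t)); rewrite mulrBl mulVf // mul0r => /eqP;
  rewrite subr_eq0 => ->.
Qed.
Local Notation t1 := generic_subV_neq0.

Lemma qint_neq0 (n : int) : n != 0 -> qn n != 0.
Proof.
have H (m : nat) : (0 < m)%N -> qn m%:Z != 0.
  move=> m0; rewrite mulf_neq0 ?invr_eq0 ?t1 //; apply/eqP => h.
  move: h => /(congr1 (fun x => x * t ^ m%:Z)).
  rewrite mulrBl mul0r -!expfzDr // addNr expr0z -PoszD => /eqP.
  rewrite subr_eq0 => h; move/negP: (tgen m0); apply.
  by rewrite muln2 -addnn; exact: h.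
case: n => [[|n]|n] // _; first exact: H.
by rewrite NegzE qintN oppr_eq0 H.
Qed.

Lemma qfact_neq0 n : qfact t n != 0.
Proof. by elim: n => [|n IH]; rewrite ?qfact0 ?oner_eq0 // qfactS mulf_neq0 ?qint_neq0. Qed.

(** The q-Pascal rule. Its coefficients are units of Z[t, 1/t], so it can be used to move c in both
    directions. *)
Lemma gq_shift c d :
  gq t (c + 1) d.+1 = t ^ (d.+1%:Z) * gq t c d.+1 + t ^ (d%:Z - c) * gq t c d.
Proof.
rewrite gqS addrK gqSr ?t1 //.
have h : qn d.+1 != 0 by apply: qint_neq0.
have -> : qn (c + 1) = t ^ (d.+1%:Z) * qn (c - d%:Z) + t ^ (d%:Z - c) * qn d.+1.
  by qfield t t0.
by field.
Qed.

(** Both sides are [c][c - 1]...[c - a - b + 1] divided by [a]! [b]!. *)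
Lemma gqM c a b : gq t c a * gq t (c - a%:Z) b = gq t (a + b)%:Z a * gq t c (a + b).
Proof.
elim: a c => [|a IH] c; first by rewrite subr0.
rewrite addSn !gqS -mulrA -(mulrA (qn c)).
have -> : c - a.+1%:Z = c - 1 - a%:Z by rewrite intS; ring.
rewrite IH (_ : (a + b).+1%:Z - 1 = (a + b)%:Z); last by rewrite intS addrC addKr.
have h : qn (a + b).+1 != 0 by apply: qint_neq0.
by field; rewrite h qint_neq0.
Qed.

Lemma gq_fact c d : qfact t d * gq t c d = \prod_(x < d) qn (c - x%:Z).
Proof.
elim: d => [|d IH]; first by rewrite big_ord0 qfact0 mulr1.
rewrite big_ord_recr /= -IH qfactS -[_ * (_ * _)]/(_ * gq t c d.+1) gqSr ?t1 //.
by field; rewrite qint_neq0.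
Qed.

Lemma gq_nat (m d : nat) : (d <= m)%N ->
  gq t m%:Z d = qfact t m / (qfact t d * qfact t (m - d)).
Proof.
elim: d m => [|d IH] [|m] //= dm.
- by rewrite qfact0 mulr1 divr1.
- by rewrite qfact0 mul1r subn0 divff ?qfact_neq0.
rewrite (_ : m.+1%:Z - 1 = m%:Z); last by rewrite intS addrC addKr.
rewrite IH // subSS !qfactS.
by field; rewrite !qfact_neq0 qint_neq0.
Qed.

Lemma gq_gt (m d : nat) : (m < d)%N -> gq t m%:Z d = 0.
Proof.
elim: d m => [|d IH] [|m] //= md; first by rewrite qint0 mul0r mulr0.
rewrite (_ : m.+1%:Z - 1 = m%:Z); last by rewrite intS addrC addKr.
by rewrite IH // !mulr0.
Qed.

Lemma gq_qbin (m d : nat) : qbin t m%:Z d%:Z = gq t m%:Z d.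
Proof.
rewrite /qbin /= lez_nat; case: leqP => dm; last by rewrite gq_gt.
by rewrite subzn // gq_nat.
Qed.

Lemma gq_diag (m : nat) : gq t m%:Z m = 1.
Proof. by rewrite gq_nat // subnn qfact0 mulr1 divff ?qfact_neq0. Qed.

Lemma gq_sym (m n : nat) : gq t (m + n)%:Z m = gq t (m + n)%:Z n.
Proof.
by rewrite !gq_nat ?leq_addr ?leq_addl // addKn addnK (mulrC (qfact t n)).
Qed.

End GenericParameter.

(** * Values and limits of rational functions *)

Lemma tQ_neq0 : tQ != 0.
Proof. by rewrite tofrac_eq0 polyX_eq0. Qed.

Lemma tQ_generic n : (0 < n)%N -> tQ ^+ (n * 2) != 1.
Proof.
move=> n0; rewrite -tofracXn -tofrac1 tofrac_eq; apply/eqP => /(congr1 (fun p : {poly rat} => size p)).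
by rewrite size_polyXn size_poly1 => -[] /eqP; rewrite muln_eq0 eqn0Ngt n0.
Qed.

Section Evaluation.
Variable C : numFieldType.
Implicit Types (x y z : C) (f g : Qt).

Definition pev x (P : {poly rat}) : C := (map_poly ratr P).[x].

Lemma pevD x P Q : pev x (P + Q) = pev x P + pev x Q.
Proof. by rewrite /pev rmorphD hornerD. Qed.
Lemma pevM x P Q : pev x (P * Q) = pev x P * pev x Q.
Proof. by rewrite /pev rmorphM hornerM. Qed.
Lemma pevC x c : pev x c%:P = ratr c.
Proof. by rewrite /pev map_polyC hornerC. Qed.
Lemma pevX x : pev x 'X = x.
Proof. by rewrite /pev map_polyX hornerX. Qed.

(** A relation rather than a function, because f may have a pole at x: it says that f is regular at
    x with value y. *)
Definition ev x f y : Prop := exists P Q : {poly rat},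
  [/\ f = tofrac P / tofrac Q, pev x Q != 0 & y = pev x P / pev x Q].

Lemma pev_neq0 x Q : pev x Q != 0 -> tofrac Q != 0.
Proof.
by apply: contraNneq => /eqP; rewrite tofrac_eq0 => /eqP->; rewrite pevC raddf0.
Qed.

Lemma ev_unique x f y z : ev x f y -> ev x f z -> y = z.
Proof.
move=> [P [Q [-> hQ ->]]] [P' [Q' [e hQ' ->]]].
have /eqP := e; rewrite (eqr_div _ _ (pev_neq0 hQ) (pev_neq0 hQ')) -!tofracM tofrac_eq => /eqP {}e.
by apply/eqP; rewrite eqr_div // -!pevM e.
Qed.

Lemma ev_poly x P : ev x (tofrac P) (pev x P).
Proof.
exists P, 1; split.
- by rewrite tofrac1 divr1.
- by rewrite pevC rmorph1 oner_eq0.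
- by rewrite pevC rmorph1 divr1.
Qed.

Lemma evD x f g y z : ev x f y -> ev x g z -> ev x (f + g) (y + z).
Proof.
move=> [P [Q [-> hQ ->]]] [P' [Q' [-> hQ' ->]]].
exists (P * Q' + P' * Q), (Q * Q'); split.
- by rewrite (addf_div _ _ (pev_neq0 hQ) (pev_neq0 hQ')) -!tofracM -tofracD.
- by rewrite pevM mulf_neq0.
- by rewrite addf_div // pevD !pevM.
Qed.

Lemma evM x f g y z : ev x f y -> ev x g z -> ev x (f * g) (y * z).
Proof.
move=> [P [Q [-> hQ ->]]] [P' [Q' [-> hQ' ->]]].
exists (P * P'), (Q * Q'); split.
- by rewrite mulf_div -!tofracM.
- by rewrite pevM mulf_neq0.
- by rewrite mulf_div !pevM.
Qed.

Lemma evV x f y : y != 0 -> ev x f y -> ev x f^-1 y^-1.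
Proof.
move=> y0 [P [Q [-> hQ ey]]]; exists Q, P; split; rewrite ?invf_div //.
  by apply: contraNneq y0 => P0; rewrite ey P0 mul0r.
by rewrite ey invf_div.
Qed.

Lemma ev_rat x c : ev x (tofrac c%:P) (ratr c).
Proof. by have := ev_poly x c%:P; rewrite pevC. Qed.

Lemma ev1 x : ev x 1 1.
Proof. by have := ev_rat x 1; rewrite tofrac1 rmorph1. Qed.

Lemma ev0 x : ev x 0 0.
Proof. by have := ev_rat x 0; rewrite tofrac0 rmorph0. Qed.

Lemma evN x f y : ev x f y -> ev x (- f) (- y).
Proof.
move=> h; rewrite -mulN1r -(mulN1r y); apply: evM h.
by have := ev_rat x (-1); rewrite polyCN polyC1 tofracN tofrac1 raddfN /= rmorph1.
Qed.

Lemma evB x f g y z : ev x f y -> ev x g z -> ev x (f - g) (y - z).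
Proof. by move=> h /evN; apply: evD. Qed.

Lemma ev_div x f g y z : z != 0 -> ev x f y -> ev x g z -> ev x (f / g) (y / z).
Proof. by move=> z0 hf /(evV z0); apply: evM. Qed.

Lemma evX x f y n : ev x f y -> ev x (f ^+ n) (y ^+ n).
Proof. by move=> h; elim: n => [|n IH]; [exact: ev1 | rewrite !exprS; apply: evM]. Qed.

Lemma evXz x f y (n : int) : y != 0 -> ev x f y -> ev x (f ^ n) (y ^ n).
Proof.
move=> y0 h; case: n => n; first exact: evX.
by apply: evV; [rewrite expf_neq0 | apply: evX].
Qed.

Lemma ev_sum x I (r : seq I) (P : pred I) (F : I -> Qt) (G : I -> C) :
  (forall i, P i -> ev x (F i) (G i)) ->
  ev x (\sum_(i <- r | P i) F i) (\sum_(i <- r | P i) G i).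
Proof.
by move=> h; elim/big_rec2: _ => [|i f g Pi hf]; [exact: ev0 | apply: evD; first exact: h].
Qed.

Lemma ev_prod x I (r : seq I) (P : pred I) (F : I -> Qt) (G : I -> C) :
  (forall i, P i -> ev x (F i) (G i)) ->
  ev x (\prod_(i <- r | P i) F i) (\prod_(i <- r | P i) G i).
Proof.
by move=> h; elim/big_rec2: _ => [|i f g Pi hf]; [exact: ev1 | apply: evM; first exact: h].
Qed.

Lemma ev_tQ x : ev x tQ x.
Proof. by have := ev_poly x 'X; rewrite pevX. Qed.

Lemma ev_int x (n : int) : ev x n%:~R n%:~R.
Proof.
have H (m : nat) : ev x m%:R m%:R.
  by elim: m => [|m IH]; [exact: ev0 | rewrite -!natr1; apply: evD IH (ev1 x)].
case: n => n; first by rewrite -!pmulrn; apply: H.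
by rewrite NegzE !mulrNz; apply: evN; rewrite -!pmulrn; apply: H.
Qed.

Lemma ev_intpoly x f y (P : {poly int}) :
  ev x f y -> ev x (map_poly intr P).[f] (map_poly intr P).[y].
Proof.
move=> h; elim/poly_ind: P => [|P c IH]; first by rewrite !rmorph0 !horner0; apply: ev0.
rewrite !rmorphD !rmorphM /= !map_polyX !map_polyC /= !hornerE.
by apply: evD; [apply: evM | apply: ev_int].
Qed.

Lemma ev_laurent x P n : x != 0 -> ev x (laurent tQ P n) (laurent x P n).
Proof.
move=> x0; apply: ev_div; rewrite ?expf_neq0 //; first exact/ev_intpoly/ev_tQ.
exact/evX/ev_tQ.
Qed.

Lemma ev_qint x n : x != 0 -> x - x^-1 != 0 -> ev x (qint tQ n) (qint x n).
Proof.
move=> x0 x1; apply: ev_div => //; apply: evB; try exact/evXz/ev_tQ.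
  exact: ev_tQ.
exact/evV/ev_tQ.
Qed.

Lemma ev_qfact x n : x != 0 -> x - x^-1 != 0 -> ev x (qfact tQ n) (qfact x n).
Proof. by move=> x0 x1; apply: ev_prod => i _; apply: ev_qint. Qed.

End Evaluation.

Section Limits.
Local Open Scope classical_set_scope.
Variable C : numFieldType.
Implicit Types (q : C) (f : Qt).

Lemma poly_continuous (P : {poly C}) : continuous (horner P).
Proof.
elim/poly_ind: P => [|P c IH] x.
  rewrite (_ : horner 0 = fun=> 0); last by apply/funext => y; rewrite horner0.
  exact: cst_continuous.
rewrite (_ : horner _ = fun y => P.[y] * y + c); last first.
  by apply/funext => y; rewrite !hornerE.
have h : (horner P \* id) y @[y --> x] --> P.[x] * x.
  exact: cvgM (IH x) cvg_id.
exact: cvgD h (cvg_cst c).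
Qed.

(** Induction on the degree removes the factors X - q, which have no zero in the punctured
    neighbourhood; what is left is nonzero at q, hence near q by continuity. *)
Lemma poly_neq0_near q (P : {poly C}) : P != 0 -> \forall t \near q^', P.[t] != 0.
Proof.
have [n] := ubnP (size P); elim: n P => // n IH P sP P0.
have [/factor_theorem [Q eP]|Pq] := boolP (root P q); last first.
  apply: nbhs_dnbhs.
  have : nbhs P.[q] [set y | y != 0].
    apply/nbhs_ballP; exists `|P.[q]|; first by rewrite /= normr_gt0.
    by move=> y; rewrite /ball /=; apply: contraTneq => ->; rewrite subr0 ltxx.
  by move/(@poly_continuous P q).
have Q0 : Q != 0 by apply: contraNneq P0 => Q0; rewrite eP Q0 mul0r.
have sQ : (size Q < n)%N.
  by move: sP; rewrite eP size_mul ?polyXsubC_eq0 // size_XsubC addn2 /= ltnS.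
have h1 := IH _ sQ Q0; have h2 := @nbhs_dnbhs_neq _ q.
apply: filterS2 h1 h2 => t Qt tq; by rewrite eP hornerM mulf_neq0 // !hornerE subr_eq0.
Qed.

Lemma ev_cvg q f (g : C -> C) y :
  (\forall t \near q^', ev t f (g t)) -> ev q f y -> g t @[t --> q^'] --> y.
Proof.
move=> hg [P [Q [ef hQ ->]]].
have cpev U : pev t U @[t --> q] --> pev q U.
  exact: (@poly_continuous (map_poly ratr U) q).
have cP : pev t P / pev t Q @[t --> q] --> pev q P / pev q Q.
  exact: cvgM (cpev P) (cvgV hQ (cpev Q)).
have Q0 : map_poly ratr Q != 0 :> {poly C}.
  by apply: contraNneq hQ => Q0; rewrite /pev Q0 horner0.
have hn := poly_neq0_near q Q0.
have cP' : pev t P / pev t Q @[t --> q^'] --> pev q P / pev q Q.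
  exact: cvg_trans (cvg_app _ (@nbhs_dnbhs _ q)) cP.
apply: cvg_trans cP'; apply: near_eq_cvg; near=> t.
have ht : ev t f (g t) by near: t.
apply: (ev_unique _ ht); exists P, Q; split => //; near: t; exact: hn.
Unshelve. all: by end_near.
Qed.

Lemma ev_lim q f (g : C -> C) y :
  (\forall t \near q^', ev t f (g t)) -> ev q f y -> lim_at_q q g = y.
Proof.
by move=> hg /(ev_cvg hg) h; apply: cvg_lim h; apply: norm_hausdorff.
Qed.

Lemma near_generic q (n : nat) :
  \forall t \near q^', [/\ t != 0, t - t^-1 != 0 & qfact t n != 0].
Proof.
(* The zeros of [k] are among those of X^(2k) - 1. The range reaches n + 1 so that k = 1, which
   gives t <> 1/t, is present even for n = 0. *)
pose P : {poly C} := 'X * \prod_(1 <= k < n.+2) ('X^(k * 2) - 1).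
have P0 : P != 0.
  rewrite mulf_neq0 ?polyX_eq0 // prodf_seq_neq0; apply/allP => k.
  rewrite mem_index_iota => /andP[k0 _] /=.
  by rewrite monic_neq0 // -polyC1 monicXnsubC // muln_gt0 k0.
apply: filterS (poly_neq0_near q P0) => t; rewrite hornerM mulf_eq0 negb_or hornerX.
move=> /andP[t0]; rewrite horner_prod prodf_seq_neq0 => /allP h.
have hk k : (0 < k <= n.+1)%N -> t ^+ (k * 2) != 1.
  move=> hk; have : (k \in index_iota 1 n.+2) by rewrite mem_index_iota.
  by move/h; rewrite !hornerE subr_eq0.
have t1 : t - t^-1 != 0.
  apply/eqP => e; have /negP := hk 1%N isT; apply; rewrite mul1n expr2.
  move: e => /(congr1 (fun x => x * t)); rewrite mulrBl mulVf // mul0r => /eqP.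
  by rewrite subr_eq0.
split=> //; rewrite /qfact prodf_seq_neq0; apply/allP => k.
rewrite mem_index_iota => /andP[k0 kn] /=.
rewrite mulf_neq0 ?invr_eq0 //; apply/eqP => e; have := hk k; rewrite k0 ltnW // => /(_ isT)/negP.
apply; move: e => /(congr1 (fun x => x * t ^ k%:Z)).
rewrite mulrBl mul0r -!expfzDr // addNr expr0z -PoszD => /eqP.
by rewrite subr_eq0 muln2 -addnn => h'; exact: h'.
Qed.

End Limits.

Lemma frac_cancel (F : fieldType) (p g a z e : F) : g != 0 -> a != 0 -> z != 0 ->
  p * g / a * (e / (z * g)) = p / (a * z) * e.
Proof. by move=> *; field; apply/and3P. Qed.

Definition tQ_sub_neq0 := generic_subV_neq0 tQ_neq0 tQ_generic.
Definition qintQ_neq0 := qint_neq0 tQ_neq0 tQ_generic.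
Definition qfactQ_neq0 := qfact_neq0 tQ_neq0 tQ_generic.

(** * Integral Laurent polynomials among the rational functions *)

Definition is_laurent (f : Qt) : Prop := exists P n, f = laurent tQ P n.

Lemma int_updown_ind (P : int -> Prop) :
  P 0 -> (forall c, P c -> P (c + 1)) -> (forall c, P (c + 1) -> P c) -> forall c, P c.
Proof.
move=> P0 up down; case=> n.
  by elim: n => [//|n IH]; rewrite intS addrC; apply: up.
by rewrite NegzE; elim: n => [|n IH]; apply: down;
  [rewrite addNr | rewrite [n.+2%:Z]intS opprD addrAC addNr add0r].
Qed.

Lemma laurent_pad P n m : laurent tQ P n = laurent tQ (P * 'X^m) (n + m).
Proof.
rewrite /laurent rmorphM /= map_polyXn hornerM hornerXn exprD.
by rewrite -mulf_div divff ?mulr1 // expf_neq0 ?tQ_neq0.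
Qed.

Lemma is_laurentD f g : is_laurent f -> is_laurent g -> is_laurent (f + g).
Proof.
move=> [P [n ->]] [Q [m ->]]; exists (P * 'X^m + Q * 'X^n), (n + m)%N.
by rewrite (laurent_pad P n m) (laurent_pad Q m n) (addnC m) /laurent -mulrDl rmorphD hornerD.
Qed.

Lemma is_laurentM f g : is_laurent f -> is_laurent g -> is_laurent (f * g).
Proof.
move=> [P [n ->]] [Q [m ->]]; exists (P * Q), (n + m)%N.
by rewrite /laurent rmorphM hornerM exprD mulf_div.
Qed.

Lemma is_laurent_int (c : int) : is_laurent c%:~R.
Proof. by exists c%:P, 0%N; rewrite /laurent map_polyC hornerC expr0 divr1. Qed.

Lemma is_laurent1 : is_laurent 1. Proof. exact: (is_laurent_int 1). Qed.
Lemma is_laurent0 : is_laurent 0. Proof. exact: (is_laurent_int 0). Qed.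

Lemma is_laurentN f : is_laurent f -> is_laurent (- f).
Proof. by move=> h; rewrite -mulN1r; apply: is_laurentM h; apply: (is_laurent_int (-1)). Qed.

Lemma is_laurentXz (n : int) : is_laurent (tQ ^ n).
Proof.
case: n => n; first by exists 'X^n, 0%N; rewrite /laurent map_polyXn hornerXn expr0 divr1.
by exists 1, n.+1; rewrite /laurent rmorph1 hornerC mul1r.
Qed.

Lemma is_laurent_sum I (r : seq I) (P : pred I) (F : I -> Qt) :
  (forall i, P i -> is_laurent (F i)) -> is_laurent (\sum_(i <- r | P i) F i).
Proof. by move=> h; elim/big_ind: _ => //; [exact: is_laurent0 | exact: is_laurentD]. Qed.

Lemma is_laurent_qint n : is_laurent (qint tQ n).
Proof.
have H (m : nat) : is_laurent (qint tQ m%:Z).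
  elim: m => [|m IH]; first by rewrite qint0; apply: is_laurent0.
  rewrite -(qint_shift tQ_neq0 m.+1%:Z 1) (_ : m.+1%:Z - 1 = m%:Z); last first.
    by rewrite intS addrC addKr.
  rewrite (qint1 tQ_sub_neq0) mulr1; apply: is_laurentD; last exact: is_laurentXz.
  by apply: is_laurentM IH; apply: is_laurentXz.
by case: n => n; rewrite ?NegzE ?qintN; [| apply: is_laurentN]; apply: H.
Qed.

(** Induction on d, then on c upwards and downwards from c = 0, where the q-binomial is 0 for d > 0.
    The q-Pascal rule can be solved for the smaller c because t^(d+1) is a unit. *)
Lemma is_laurent_gq c d : is_laurent (gq tQ c d).
Proof.
elim: d c => [|d IH] c; first exact: is_laurent1.
have step c' : is_laurent (tQ ^ (d%:Z - c') * gq tQ c' d).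
  by apply: is_laurentM; [apply: is_laurentXz | apply: IH].
have base : is_laurent (gq tQ 0 d.+1) by rewrite gqS qint0 mul0r mulr0; apply: is_laurent0.
move: c; apply: int_updown_ind => // c hc.
  rewrite (gq_shift tQ_neq0 tQ_generic).
  by apply: is_laurentD => //; apply: is_laurentM => //; apply: is_laurentXz.
have -> : gq tQ c d.+1 = tQ ^ (- d.+1%:Z) * (gq tQ (c + 1) d.+1 - tQ ^ (d%:Z - c) * gq tQ c d).
  by rewrite (gq_shift tQ_neq0 tQ_generic) addrK mulrA -expfzDr ?tQ_neq0 // addNr expr0z mul1r.
apply: is_laurentM; first exact: is_laurentXz.
by apply: is_laurentD => //; apply: is_laurentN.
Qed.

(** * Regularity at a root of unity *)

Section RootOfUnity.
Variables (C : numFieldType) (q : C) (l : nat).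
Hypotheses (hl : (2 <= l)%N) (hq : q != 0) (hql : l.-primitive_root (q ^+ 2)).
Local Notation ev := (@ev C q).

Lemma q_sub_neq0 : q - q^-1 != 0.
Proof.
apply/eqP => e; have := prim_order_dvd hql 1; rewrite dvdn1 (gtn_eqF hl) expr1.
move: e => /(congr1 (fun x => x * q)); rewrite mulrBl mulVf // mul0r => /eqP.
by rewrite subr_eq0 -expr2 => ->.
Qed.

Lemma qintq_nat_eq0 (n : nat) : (qint q n%:Z == 0) = (l %| n)%N.
Proof.
rewrite /qint mulf_eq0 invr_eq0 (negPf q_sub_neq0) orbF subr_eq0 (prim_order_dvd hql).
rewrite -exprM mul2n -addnn exprD -invr_expz -(inj_eq (mulIf (expf_neq0 n hq))).
by rewrite mulVf ?expf_neq0 // -exprnP.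
Qed.

(** q^(2l) = 1 makes q^l its own inverse. *)
Lemma qpow_l (k : int) : q ^ (- (l%:Z * k)) = q ^ (l%:Z * k).
Proof.
rewrite -invr_expz -!exprz_exp; have h : q ^ l%:Z * q ^ l%:Z = 1.
  by rewrite -expfzDr // -PoszD addnn -mul2n -exprnP exprM (prim_expr_order hql).
have : (q ^ l%:Z) ^ k * (q ^ l%:Z) ^ k = 1 by rewrite -expfzMl h exp1rz.
move=> e; apply: (mulfI (x := (q ^ l%:Z) ^ k)); first by rewrite !expfz_neq0.
by rewrite e divff // !expfz_neq0.
Qed.

Lemma qintq_addl (k x : int) : qint q (l%:Z * k + x) = q ^ (l%:Z * k) * qint q x.
Proof. by rewrite /qint opprD !expfzDr // qpow_l -mulrBr mulrA. Qed.

Definition reg (f : Qt) : Prop := exists y, ev f y.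

(* Equal to 0 when [f] has a pole at [q]. *)
Definition evq (f : Qt) : C := xget 0 [set y | ev f y]%classic.

Lemma evqP f : reg f -> ev f (evq f).
Proof. exact: (@xgetPex _ 0 [set y | ev f y]%classic). Qed.

Lemma evq_eq f y : ev f y -> evq f = y.
Proof. by move=> h; apply: (ev_unique _ h); apply: evqP; exists y. Qed.

Lemma regD f g : reg f -> reg g -> reg (f + g).
Proof. by move=> [y hy] [z hz]; exists (y + z); apply: evD. Qed.
Lemma regM f g : reg f -> reg g -> reg (f * g).
Proof. by move=> [y hy] [z hz]; exists (y * z); apply: evM. Qed.
Lemma regN f : reg f -> reg (- f).
Proof. by move=> [y hy]; exists (- y); apply: evN. Qed.
Lemma reg0 : reg 0. Proof. by exists 0; apply: ev0. Qed.
Lemma reg1 : reg 1. Proof. by exists 1; apply: ev1. Qed.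
Lemma reg_sum I (r : seq I) (P : pred I) (F : I -> Qt) :
  (forall i, P i -> reg (F i)) -> reg (\sum_(i <- r | P i) F i).
Proof. by move=> h; elim/big_ind: _ => //; [exact: reg0 | exact: regD]. Qed.
Lemma reg_prod I (r : seq I) (P : pred I) (F : I -> Qt) :
  (forall i, P i -> reg (F i)) -> reg (\prod_(i <- r | P i) F i).
Proof. by move=> h; elim/big_ind: _ => //; [exact: reg1 | exact: regM]. Qed.

Lemma evqD f g : reg f -> reg g -> evq (f + g) = evq f + evq g.
Proof. by move=> hf hg; apply/evq_eq/evD; apply: evqP. Qed.
Lemma evqM f g : reg f -> reg g -> evq (f * g) = evq f * evq g.
Proof. by move=> hf hg; apply/evq_eq/evM; apply: evqP. Qed.
Lemma evq0 : evq 0 = 0. Proof. exact/evq_eq/ev0. Qed.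
Lemma evq1 : evq 1 = 1. Proof. exact/evq_eq/ev1. Qed.
Lemma evq_sum I (r : seq I) (P : pred I) (F : I -> Qt) : (forall i, P i -> reg (F i)) ->
  evq (\sum_(i <- r | P i) F i) = \sum_(i <- r | P i) evq (F i).
Proof. by move=> h; apply/evq_eq/ev_sum => i Pi; apply/evqP/h. Qed.
Lemma regV f : reg f -> evq f != 0 -> reg f^-1.
Proof. by move=> hf f0; exists (evq f)^-1; apply: evV => //; apply: evqP. Qed.

Lemma ev_laurentq P n : ev (laurent tQ P n) (laurent q P n).
Proof. exact: ev_laurent. Qed.

Lemma reg_laurent f : is_laurent f -> reg f.
Proof. by move=> [P [n ->]]; exists (laurent q P n); apply: ev_laurentq. Qed.

Lemma ev_qintq n : ev (qint tQ n) (qint q n).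
Proof. by apply: ev_qint => //; apply: q_sub_neq0. Qed.

Lemma evq_qint n : evq (qint tQ n) = qint q n.
Proof. exact/evq_eq/ev_qintq. Qed.

Lemma reg_qint n : reg (qint tQ n).
Proof. by exists (qint q n); apply: ev_qintq. Qed.

(** At q this is a quotient of two zeros. Its value comes from [qint_shift] by induction on u,
    without derivatives. *)
Lemma ev_qint_ratio (u : nat) :
  ev (qint tQ (l * u)%:Z / qint tQ l%:Z) (u%:R * q ^ (l%:Z * (u%:Z - 1))).
Proof.
have l0 : qint tQ l%:Z != 0 by apply: qintQ_neq0; rewrite eqz_nat -lt0n ltnW.
elim: u => [|u IH]; first by rewrite muln0 qint0 !mul0r; apply: ev0.
rewrite -(qint_shift tQ_neq0 _ l%:Z) (_ : (l * u.+1)%:Z - l%:Z = (l * u)%:Z); last first.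
  by rewrite mulnS PoszD addrC addKr.
rewrite mulrDl mulfK // -mulrA.
have -> : u.+1%:R * q ^ (l%:Z * (u.+1%:Z - 1))
        = q ^ (- l%:Z) * (u%:R * q ^ (l%:Z * (u%:Z - 1))) + q ^ (l * u)%:Z :> C.
  rewrite -natr1 mulrDl mul1r (_ : l%:Z * (u.+1%:Z - 1) = (l * u)%:Z); last first.
    by rewrite intS addrC addKr -PoszM.
  congr (_ + _); rewrite mulrCA; congr (_ * _).
  have := qpow_l 1; rewrite mulr1 => ->; rewrite -expfzDr //; congr (_ ^ _).
  by rewrite PoszM; ring.
by apply: evD; [apply: evM IH |]; apply: evXz => //; apply: ev_tQ.
Qed.

(** If l does not divide y, then [lm + y] is q^(lm) [y] at q. Otherwise numerator and denominator
    both vanish at q, and [ev_qint_ratio] compares each of them with [l]. *)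
Lemma ratio_unit (m y : nat) : (0 < y)%N ->
  exists2 v, ev (qint tQ (l * m + y)%:Z / qint tQ y%:Z) v &
    v != 0 /\ (~~ (l %| y)%N -> v = q ^ (l * m)%:Z).
Proof.
move=> y0; have [/dvdnP[k ey]|ly] := boolP (l %| y)%N; last first.
  have qy : qint q y%:Z != 0 by rewrite qintq_nat_eq0.
  exists (q ^ (l * m)%:Z); last by split=> [|_]; rewrite ?expfz_neq0.
  have -> : q ^ (l * m)%:Z = qint q (l * m + y)%:Z / qint q y%:Z.
    by rewrite PoszD PoszM qintq_addl mulfK.
  by apply: ev_div => //; apply: ev_qintq.
have k0 : (0 < k)%N by move: y0; rewrite ey muln_gt0 => /andP[].
have l0 : qint tQ l%:Z != 0 by apply: qintQ_neq0; rewrite eqz_nat -lt0n ltnW.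
have nz (u : nat) : (0 < u)%N -> u%:R * q ^ (l%:Z * (u%:Z - 1)) != 0 :> C.
  by move=> u0; rewrite mulf_neq0 ?expfz_neq0 // pnatr_eq0 -lt0n.
exists (((m + k)%:R * q ^ (l%:Z * ((m + k)%:Z - 1))) / (k%:R * q ^ (l%:Z * (k%:Z - 1)))).
  rewrite ey (mulnC k) -mulnDr.
  have -> : qint tQ (l * (m + k))%:Z / qint tQ (l * k)%:Z
     = (qint tQ (l * (m + k))%:Z / qint tQ l%:Z) / (qint tQ (l * k)%:Z / qint tQ l%:Z).
    by rewrite invf_div mulrA divfK.
  by apply: ev_div; [apply: nz | apply: ev_qint_ratio | apply: ev_qint_ratio].
split=> [|/negP h]; last by case: h.
by rewrite mulf_neq0 ?invr_eq0 ?nz // addn_gt0 k0 orbT.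
Qed.

(** The zero of [l] at q is simple. As q need not be rational, X - q cannot be divided out over Q;
    the gcd G of the numerator and Z = X^(2l) - 1 is used instead. It vanishes at q, and Z/G does
    not, because the derivative of Z is nonzero there. *)
Lemma reg_div_qint_l f : ev f 0 -> reg (f / qint tQ l%:Z).
Proof.
move=> [P [Q [ef hQ /esym/eqP]]]; rewrite mulf_eq0 invr_eq0 (negPf hQ) orbF => /eqP P0.
pose Z : {poly rat} := 'X^(2 * l) - 1; pose G := gcdp P Z.
have l0 : (0 < 2 * l)%N by lia.
have Zq : pev q Z = 0.
  rewrite /Z pevD /pev map_polyXn hornerXn exprM (prim_expr_order hql) rmorphN rmorph1.
  by rewrite hornerN hornerC subrr.
have Z'q : pev q Z^`() != 0.
  rewrite /Z derivB derivXn -polyC1 derivC subr0 /pev rmorphMn /= map_polyXn hornerMn hornerXn.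
  by rewrite mulrn_eq0 negb_or -lt0n l0 expf_neq0.
have Gq : pev q G = 0.
  by apply/eqP; rewrite -[_ == 0]/(root _ _) gcdp_map root_gcd !rootE -!/(pev q _) P0 Zq eqxx.
have /dvdpP[P1 eP] : G %| P := dvdp_gcdl P Z.
have /dvdpP[Z1 eZ] : G %| Z := dvdp_gcdr P Z.
have Z1q : pev q Z1 != 0.
  apply: contraNneq Z'q => Z1q; rewrite eZ derivM pevD !pevM Z1q Gq mulr0 mul0r addr0 //.
have G0 : tofrac G != 0.
  rewrite tofrac_eq0; apply: contraNneq Z'q => G0; rewrite eZ G0 mulr0 deriv0.
  by rewrite /pev rmorph0 horner0.
have eZt : tofrac Z = tQ ^+ (2 * l) - 1 by rewrite tofracB tofracXn tofrac1.
have -> : f / qint tQ l%:Z = (tofrac P1 / tofrac (Q * Z1)) * (tQ ^+ l * (tQ - tQ^-1)).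
  have tl : tQ ^+ l != 0 by rewrite expf_neq0 ?tQ_neq0.
  have -> : qint tQ l%:Z = tofrac Z / (tQ ^+ l * (tQ - tQ^-1)).
    rewrite /qint -invr_expz -exprnP eZt invfM mulrA; congr (_ / _).
    by apply: (mulIf tl); rewrite divfK // mulrBl mulVf // -exprD addnn mul2n.
  by rewrite invf_div ef eP eZ !tofracM (frac_cancel _ _ G0 (pev_neq0 hQ) (pev_neq0 Z1q)).
apply: regM; last first.
  exists (q ^+ l * (q - q^-1)); apply: evM; first exact/evX/ev_tQ.
  by apply: evB; [apply: ev_tQ | apply: evV => //; apply: ev_tQ].
by exists (pev q P1 / pev q (Q * Z1)), P1, (Q * Z1); rewrite pevM mulf_neq0.
Qed.

Lemma reg_div_qint (m : nat) f : (0 < m)%N -> ev f 0 -> reg (f / qint tQ (l * m)%:Z).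
Proof.
move=> m0 /reg_div_qint_l hf; have [v hv [v0 _]] := ratio_unit m.-1 (ltnW hl).
have l0 : qint tQ l%:Z != 0 by apply: qintQ_neq0; rewrite eqz_nat -lt0n ltnW.
have -> : f / qint tQ (l * m)%:Z = (f / qint tQ l%:Z) * (qint tQ (l * m.-1 + l)%:Z / qint tQ l%:Z)^-1.
  by rewrite invf_div -mulnSr prednK // mulrA divfK.
by apply: regM => //; exists v^-1; apply: evV.
Qed.

Lemma reg_gq c d : reg (gq tQ c d).
Proof. exact/reg_laurent/is_laurent_gq. Qed.

Lemma qfactq_neq0 (d : nat) : (d < l)%N -> evq (qfact tQ d) != 0.
Proof.
move=> dl; rewrite (evq_eq (ev_qfact d hq q_sub_neq0)) prodf_seq_neq0.
apply/allP => k; rewrite mem_index_iota qintq_nat_eq0 /= => /andP[k0 kd].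
by rewrite gtnNdvd // (leq_trans kd).
Qed.

Lemma reg_qfact d : reg (qfact tQ d).
Proof. by exists (qfact q d); apply: ev_qfact => //; apply: q_sub_neq0. Qed.

(** Among the l consecutive factors of the numerator only [d - (d mod l)] vanishes at q, and the
    factor [l] of [l]! cancels this zero. *)
Lemma gqq_l_neq0 (d : nat) : (l <= d)%N -> evq (gq tQ d%:Z l) != 0.
Proof.
move=> ld; have l0 : (0 < l)%N by rewrite ltnW.
have ed := divn_eq d l; have d0l : (d %% l < l)%N by rewrite ltn_mod.
have k0 : (0 < d %/ l)%N by rewrite divn_gt0.
pose x0 := Ordinal d0l.
have ql : qint tQ l%:Z != 0 by apply: qintQ_neq0; rewrite eqz_nat -lt0n.
have e : gq tQ d%:Z l = (qint tQ (l * (d %/ l))%:Z / qint tQ l%:Z)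
    * (\prod_(x < l | x != x0) qint tQ (d%:Z - x%:Z) / qfact tQ l.-1).
  have := gq_fact tQ_neq0 tQ_generic d%:Z l; rewrite (bigD1 x0) //= .
  have -> : d%:Z - (d %% l)%N%:Z = (l * (d %/ l))%:Z by rewrite {1}ed PoszD addrK mulnC.
  move=> h; apply: (mulfI (qfactQ_neq0 l)); rewrite h.
  have ef : qfact tQ l = qint tQ l%:Z * qfact tQ l.-1 by rewrite -{1}(prednK l0) qfactS prednK.
  by rewrite ef mulf_div [RHS]mulrC (divfK (mulf_neq0 ql (qfactQ_neq0 _))).
have h1 : ev (qint tQ (l * (d %/ l))%:Z / qint tQ l%:Z)
    ((d %/ l)%:R * q ^ (l%:Z * ((d %/ l)%:Z - 1))) by apply: ev_qint_ratio.
have h2 : ev (\prod_(x < l | x != x0) qint tQ (d%:Z - x%:Z) / qfact tQ l.-1)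
    (\prod_(x < l | x != x0) qint q (d%:Z - x%:Z) / evq (qfact tQ l.-1)).
  apply: ev_div; [by apply: qfactq_neq0; rewrite prednK| | exact/evqP/reg_qfact].
  by apply: ev_prod => x _; apply: ev_qintq.
rewrite e (evq_eq (evM h1 h2)) !mulf_neq0 ?expfz_neq0 ?pnatr_eq0 -?lt0n // ?invr_eq0;
  last by apply: qfactq_neq0; rewrite prednK.
apply/prodf_neq0 => x; apply: contraNneq => /eqP.
rewrite subzn; last by rewrite (leq_trans _ ld) // ltnW.
rewrite qintq_nat_eq0 -eqn_mod_dvd; last by rewrite (leq_trans _ ld) // ltnW.
by rewrite [(x %% l)%N]modn_small // => /eqP h; apply/eqP/val_inj; rewrite /= h.
Qed.

(** A factor of the numerator vanishes at q, and [a]! does not since a < l. *)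
Lemma gqq_eq0 (d a : nat) : (a < l)%N -> (exists2 x, (x < a)%N & (l %| d - x)%N && (x <= d)%N) ->
  evq (gq tQ d%:Z a) = 0.
Proof.
move=> al [x xa /andP[ldx xd]].
have := gq_fact tQ_neq0 tQ_generic d%:Z a => /(congr1 evq).
rewrite evqM ?(evq_eq (ev_prod _ (fun (x : 'I_a) _ => ev_qintq (d%:Z - x%:Z)))) //;
  [|exact: reg_qfact|exact: reg_gq].
rewrite (bigD1 (Ordinal xa)) //= subzn //; move/eqP: (qintq_nat_eq0 (d - x)).
rewrite ldx => /eqP/eqP-> /eqP; rewrite mul0r mulf_eq0 (negPf (qfactq_neq0 al)).
by move/eqP.
Qed.

End RootOfUnity.

Lemma uK_Kinv : uK * uKinv = 1.
Proof. by rewrite -pclsM (pcls_rel uq_KKinv). Qed.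

Lemma uKinv_K : uKinv * uK = 1.
Proof. by rewrite -pclsM (pcls_rel uq_KinvK). Qed.

Lemma uKEK : uK * uE * uKinv = tQ ^+ 2 *: uE.
Proof. by have := pcls_rel uq_KE; rewrite !pclsM. Qed.

Lemma uKFK : uK * uF * uKinv = tQ ^- 2 *: uF.
Proof. by have := pcls_rel uq_KF; rewrite !pclsM. Qed.

Lemma uEFFE : uE * uF - uF * uE = (tQ - tQ^-1)^-1 *: (uK - uKinv).
Proof.
have := pcls_rel uq_EF; rewrite /expr_sub !(pclsD, pclsM) -!/(pcst _ _) !pcstE.
rewrite -!pres_scalerAl !mul1r !scaleN1r -/uE -/uF -/uK -/uKinv => ->.
by rewrite scalerA mulVf ?scale1r // tQ_sub_neq0.
Qed.

(** * Commutation of divided powers and the integral form *)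

Section Commutation.
Variables (F : fieldType) (t : F).
Hypotheses (t0 : t != 0) (tgen : forall n, (0 < n)%N -> t ^+ (n * 2) != 1).
Variables (X : Type) (rels : nc_expr F X -> nc_expr F X -> Prop).
Local Notation A := (presAlg rels).
Local Notation AL := (@pres_scalerAl F X rels).
Local Notation AR := (@pres_scalerAr F X rels).

Variables e f k ki : A.
Hypothesis kki : k * ki = 1.
Hypothesis kik : ki * k = 1.
Hypothesis kek : k * e * ki = t ^ 2 *: e.
Hypothesis kfk : k * f * ki = t ^ (-2) *: f.
Hypothesis eff : e * f - f * e = (t - t^-1)^-1 *: (k - ki).
Let t1 := generic_subV_neq0 t0 tgen.

(* [dpow] and [kbr] are locked to keep unification from unfolding the operations of [presAlg]. *)
Definition dpow (x : A) (n : nat) : A := locked ((qfact t n)^-1 *: x ^+ n).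

Lemma dpowE x n : dpow x n = (qfact t n)^-1 *: x ^+ n.
Proof. by rewrite /dpow -lock. Qed.

Definition kbr (c : int) : A :=
  locked ((t - t^-1)^-1 *: (t ^ c *: k - t ^ (- c) *: ki)).

Lemma kbrE c : kbr c = (t - t^-1)^-1 *: (t ^ c *: k - t ^ (- c) *: ki).
Proof. by rewrite /kbr -lock. Qed.

(* Lusztig's element [K; c choose d]. *)
Fixpoint kap (c : int) (d : nat) : A :=
  if d is d'.+1 then (qint t d)^-1 *: (kbr c * kap (c - 1) d') else 1.

Lemma kapS c d : kap c d.+1 = (qint t d.+1)^-1 *: (kbr c * kap (c - 1) d).
Proof. by []. Qed.

(** The two hypotheses compare the coefficients of K and of K^-1. *)
Lemma kbr_lin (x y z : int) (a b : F) :
  a * t ^ x + b * t ^ y = t ^ z -> a * t ^ (- x) + b * t ^ (- y) = t ^ (- z) ->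
  a *: kbr x + b *: kbr y = kbr z.
Proof.
move=> h1 h2; rewrite !kbrE !(scalerA _ (t - t^-1)^-1) !(mulrC _ (t - t^-1)^-1).
rewrite -!(scalerA (t - t^-1)^-1) -scalerDr; congr (_ *: _).
by rewrite !scalerBr !scalerA addrACA -opprD -!scalerDl h1 h2.
Qed.

Lemma kbrC x y : kbr x * kbr y = kbr y * kbr x.
Proof.
rewrite !kbrE -!AL -!AR !mulrBl !mulrBr -!AL -!AR kki kik !scalerA.
congr (_ *: _); rewrite !(mulrC (t ^ x)) !(mulrC (t ^ (- x))) !opprB !addrA.
by rewrite -!addrA; congr (_ + _); rewrite addrCA [RHS]addrCA [X in _ + X]addrC.
Qed.

Lemma kbr_kap x c d : kbr x * kap c d = kap c d * kbr x.
Proof.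
elim: d c => [|d IH] c /=; first by rewrite mulr1 mul1r.
by rewrite -AR -AL; congr (_ *: _); rewrite mulrA kbrC -mulrA IH mulrA.
Qed.

Lemma kapSr c d : kap c d.+1 = (qint t d.+1)^-1 *: (kbr (c - d%:Z) * kap c d).
Proof.
elim: d c => [|d IH] c; first by rewrite /= subr0.
rewrite kapS IH [kap c d.+1]kapS -!AR.
have -> : c - 1 - d%:Z = c - d.+1%:Z by rewrite intS; ring.
by congr (_ *: (_ *: _)); rewrite mulrA kbrC -mulrA.
Qed.

Lemma k_kbr c : k * kbr c = kbr c * k.
Proof. by rewrite kbrE -AR -AL mulrBr mulrBl -!AR -!AL kki kik. Qed.

Lemma k_kap c d : k * kap c d = kap c d * k.
Proof.
elim: d c => [|d IH] c /=; first by rewrite mulr1 mul1r.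
by rewrite -AR -AL; congr (_ *: _); rewrite mulrA k_kbr -mulrA IH mulrA.
Qed.

Lemma ke_comm : k * e = t ^ 2 *: (e * k).
Proof. by rewrite AL -kek -mulrA kik mulr1. Qed.

Lemma e_ki_comm : e * ki = t ^ 2 *: (ki * e).
Proof.
by rewrite AR -kek !mulrA kik mul1r.
Qed.

Lemma kf_comm : k * f = t ^ (-2) *: (f * k).
Proof. by rewrite AL -kfk -mulrA kik mulr1. Qed.

Lemma f_ki_comm : f * ki = t ^ (-2) *: (ki * f).
Proof. by rewrite AR -kfk !mulrA kik mul1r. Qed.

Lemma expzK (n : int) : t ^ n * t ^ (- n) = 1.
Proof. by rewrite -expfzDr // subrr expr0z. Qed.

Lemma e_kbr c : e * kbr c = kbr (c - 2) * e.
Proof.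
rewrite !kbrE -AR -AL; congr (_ *: _); rewrite mulrBr mulrBl -!AR -!AL.
rewrite ke_comm e_ki_comm !scalerA -!expfzDr //.
by congr (_ *: _ - _ *: _); congr (_ ^ _); ring.
Qed.

Lemma kbr_f c : kbr c * f = f * kbr (c - 2).
Proof.
rewrite !kbrE -AR -AL; congr (_ *: _); rewrite mulrBr mulrBl -!AR -!AL.
rewrite kf_comm f_ki_comm !scalerA -!expfzDr //.
by congr (_ *: _ - _ *: _); congr (_ ^ _); ring.
Qed.

Lemma e_kap c d : e * kap c d = kap (c - 2) d * e.
Proof.
elim: d c => [|d IH] c /=; first by rewrite mulr1 mul1r.
rewrite -AR -AL; congr (_ *: _); rewrite mulrA e_kbr -!mulrA IH.
by congr (_ * (kap _ _ * _)); ring.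
Qed.

Local Notation de n := (dpow e n).
Local Notation df n := (dpow f n).

Lemma dpow0 (x : A) : dpow x 0 = 1.
Proof. by rewrite !dpowE qfact0 invr1 scale1r. Qed.

Lemma dpowS (x : A) n : x * dpow x n = qint t n.+1 *: dpow x n.+1.
Proof.
rewrite !dpowE -AR -exprS qfactS scalerA; congr (_ *: _).
by rewrite invfM mulrA mulfV ?mul1r // (qint_neq0 t0 tgen).
Qed.

Lemma dpowM (x : A) m n : dpow x m * dpow x n = gq t (m + n)%:Z m *: dpow x (m + n).
Proof.
rewrite !dpowE -AL -AR -exprD !scalerA; congr (_ *: _).
rewrite (gq_nat t0 tgen) ?leq_addr // addKn mulrAC divff ?(qfact_neq0 t0 tgen) //.
by rewrite mul1r invfM.
Qed.

Lemma scaler_qint_inj n (x y : A) : qint t n.+1 *: x = qint t n.+1 *: y -> x = y.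
Proof.
move=> /(congr1 (fun z => (qint t n.+1)^-1 *: z)); rewrite !scalerA mulVf ?scale1r //.
exact: (qint_neq0 t0 tgen).
Qed.

Lemma kbr_df c m : kbr c * df m = df m * kbr (c - (2 * m)%:Z).
Proof.
elim: m c => [|m IH] c; first by rewrite dpow0 mul1r mulr1 muln0 subr0.
apply: (@scaler_qint_inj m); rewrite (AR (qint _ _)) (AL (qint _ _)) -dpowS mulrA kbr_f -mulrA IH mulrA.
by congr (_ * kbr _); lia.
Qed.

Lemma e_df m : e * df m.+1 = df m.+1 * e + df m * kbr (- m%:Z).
Proof.
have kbr0 : e * f = f * e + kbr 0.
  by rewrite !kbrE oppr0 !expr0z !scale1r -eff addrC subrK.
elim: m => [|m IH].
  rewrite oppr0 !dpow0 mul1r (_ : df 1 = f) // dpowE expr1.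
  by rewrite qfactS qfact0 (qint1 t1) mulr1 invr1 scale1r.
apply: (@scaler_qint_inj m.+1).
have e1 : f * (df m.+1 * e) = qint t m.+2 *: (df m.+2 * e).
  by rewrite mulrA dpowS (AL (qint _ _)).
have e2 : f * (df m * kbr (- m%:Z)) = df m.+1 * (qint t m.+1 *: kbr (- m%:Z)).
  by rewrite mulrA dpowS -(AL (qint _ _)) (AR (qint _ _)).
rewrite (AR (qint _ _)) -dpowS mulrA kbr0 mulrDl -mulrA IH mulrDr e1 e2 scalerDr.
rewrite -addrA; congr (_ + _).
rewrite kbr_df -mulrDr (AR (qint _ _)); congr (_ * _).
have h : qint t m.+2 != 0 by apply: (qint_neq0 t0 tgen).
have aux (x y z : F) : qint t m.+1 * x + y = qint t m.+2 * z ->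
    qint t m.+1 / qint t m.+2 * x + (qint t m.+2)^-1 * y = z.
  by move=> xyz; apply: (mulfI h); rewrite -xyz; field.
rewrite -(@kbr_lin (- m%:Z) (0 - (2 * m.+1)%:Z) (- m.+1%:Z) (qint t m.+1 / qint t m.+2) (qint t m.+2)^-1).
- by rewrite scalerDr !scalerA mulrC divfK // divff // scale1r.
- by apply: aux; rewrite -[t ^ (0 - _)]mulr1 -(qint1 t1) mul2n -addnn; qfield t t0.
- by apply: aux; rewrite -[t ^ (- (0 - _))]mulr1 -(qint1 t1) mul2n -addnn; qfield t t0.
Qed.

(** The test matters: for d > b, truncated subtraction would give F^(0) = 1 instead of 0. *)
Definition dpsub b d : A := if (d <= b)%N then df (b - d) else 0.

Lemma e_dpsub b d : e * dpsub b d = dpsub b d * e + dpsub b d.+1 * kbr (d.+1%:Z - b%:Z).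
Proof.
rewrite /dpsub; case: ltngtP => [db|bd|->].
- rewrite -(subnSK db) e_df; congr (_ + _ * kbr _).
  by rewrite -subzn // opprB.
- by rewrite !mulr0 !mul0r addr0.
- by rewrite subnn dpow0 mulr1 mul1r mul0r addr0.
Qed.

Lemma kap_step (n b D : nat) : (D < n.+1)%N ->
  let c := (2 * D.+1)%:Z - n.+1%:Z - b%:Z in
  qint t (n - D)%:Z *: kap (c - 1) D.+1 + kbr (D.+1%:Z - b%:Z) * kap (c - 1) D
  = qint t n.+1 *: kap c D.+1.
Proof.
move=> Dn c; rewrite [kap c _]kapS kapSr !scalerA !(AL _ _ (kap (c - 1) D)) -mulrDl; congr (_ * _).
have h : qint t D.+1 != 0 by apply: (qint_neq0 t0 tgen).
have h' : qint t n.+1 != 0 by apply: (qint_neq0 t0 tgen).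
have aux (x y z : F) : qint t (n - D)%:Z * x + qint t D.+1 * y = qint t n.+1 * z ->
    qint t (n - D)%:Z / qint t n.+1 * x + qint t D.+1 / qint t n.+1 * y = z.
  by move=> xyz; apply: (mulfI h'); rewrite -xyz; field.
rewrite -(@kbr_lin (c - 1 - D%:Z) (D.+1%:Z - b%:Z) c (qint t (n - D)%:Z / qint t n.+1) (qint t D.+1 / qint t n.+1)).
- rewrite scalerDr !scalerA; congr (_ *: _ + _); first by field; apply/andP.
  by rewrite (_ : _ * _ = 1) ?scale1r //; field; apply/andP.
- apply: aux; rewrite /c -subzn // mul2n -addnn; qfield t t0.
- apply: aux; rewrite /c -subzn // mul2n -addnn; qfield t t0.
Qed.

(** Kostant's formula. Multiplying the formula for n by E gives [n + 1] times the formula for n + 1: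
    E passes F^(b - d) at the cost of one bracket [K; .], and [kap_step] merges the two
    contributions to each d. *)
Lemma commutation n b : de n * df b =
  \sum_(d < n.+1) dpsub b d * kap ((2 * d)%:Z - n%:Z - b%:Z) d * de (n - d).
Proof.
elim: n => [|n IH].
  by rewrite big_ord1 /dpsub /= subn0 dpow0 mulr1 mul1r mulr1.
apply: (@scaler_qint_inj n); rewrite (AL (qint _ _)) -dpowS -mulrA IH mulr_sumr.
pose S1 d := dpsub b d * (qint t (n.+1 - d)%:Z *: kap ((2 * d)%:Z - n%:Z - b%:Z - 2) d * de (n.+1 - d)).
pose S2 d := dpsub b d.+1 * (kbr (d.+1%:Z - b%:Z) * kap ((2 * d)%:Z - n%:Z - b%:Z) d * de (n - d)).
transitivity (\sum_(d < n.+1) (S1 d + S2 d)).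
  apply: eq_bigr => d _; rewrite !mulrA e_dpsub !mulrDl /S1 /S2; congr (_ + _); last first.
    by rewrite !mulrA.
  rewrite -!mulrA; congr (_ * _); rewrite (mulrA e) e_kap -mulrA dpowS.
  have dn : (d <= n)%N by rewrite -ltnS.
  by rewrite -(subSn dn) -(AR (qint _ _)) (AL (qint _ _)) -(AL (qint _ _)).
(* The zero term lets the first sum run up to n + 1, so that dropping its d = 0 term aligns it with
   the second sum. *)
have S1n : S1 n.+1 = 0 by rewrite /S1 subnn qint0 scale0r mul0r mulr0.
have S1E : \sum_(d < n.+1) S1 d = \sum_(d < n.+2) S1 d by rewrite [RHS]big_ord_recr /= S1n addr0.
rewrite big_split /= S1E big_ord_recl -addrA -big_split.
rewrite [in RHS]big_ord_recl scalerDr; congr (_ + _).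
  rewrite /S1 !subn0 [kap _ _]/(1 : A) [kap _ ord0]/(1 : A) mulr1.
  by rewrite -(AL (qint _ _)) mul1r (AR (qint _ _)).
rewrite scaler_sumr; apply: eq_bigr => d _; rewrite !lift0 /S1 /S2 subSS.
have := kap_step b (ltn_ord d); set c := _ - _ - _ => /= step.
rewrite -mulrDr -mulrDl.
have -> : (2 * d.+1)%:Z - n%:Z - b%:Z - 2 = c - 1 by rewrite /c; lia.
have -> : (2 * d)%:Z - n%:Z - b%:Z = c - 1 by rewrite /c; lia.
by rewrite step -(AL (qint _ _)) -(AR (qint _ _)) mulrA.
Qed.

Lemma kbr_shift c d :
  kbr (c + 1) = t ^ d.+1%:Z *: kbr (c - d%:Z) + (t ^ (d%:Z - c) * qint t d.+1) *: ki.
Proof.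
rewrite !kbrE !scalerBr !scalerA -!scaleNr -addrA -scalerDl.
by congr (_ *: _ + _ *: _); qfield t t0.
Qed.

Lemma kap_shift c d :
  kap (c + 1) d.+1 = t ^ d.+1%:Z *: kap c d.+1 + t ^ (d%:Z - c) *: (ki * kap c d).
Proof.
rewrite kapS addrK kapSr (kbr_shift c d) mulrDl scalerDr -!AL !scalerA.
congr (_ *: _ + _ *: _); first by rewrite mulrC.
by rewrite mulrCA mulVf ?mulr1 // (qint_neq0 t0 tgen).
Qed.

Lemma kapM c a b : kap c a * kap (c - a%:Z) b = gq t (a + b)%:Z a *: kap c (a + b).
Proof.
elim: a c => [|a IH] c; first by rewrite subr0 mul1r scale1r.
rewrite addSn !kapS -(AL (qint _ _)^-1) -mulrA.
have -> : c - a.+1%:Z = c - 1 - a%:Z by rewrite intS; ring.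
rewrite IH -(AR (gq _ _ _)) !scalerA gqS.
rewrite (_ : (a + b).+1%:Z - 1 = (a + b)%:Z); last by rewrite intS addrC addKr.
congr (_ *: _); have h : qint t (a + b).+1 != 0 by apply: (qint_neq0 t0 tgen).
have h' : qint t a.+1 != 0 by apply: (qint_neq0 t0 tgen).
by field; rewrite h h'.
Qed.

End Commutation.

Section PolynomialEvaluation.
Variables (F : fieldType) (X : Type) (rels : nc_expr F X -> nc_expr F X -> Prop).
Local Notation A := (presAlg rels).
Variable x : A.

Definition aeval (P : {poly F}) : A := \sum_(i < size P) P`_i *: x ^+ i.

Lemma aeval_widen n (P : {poly F}) : (size P <= n)%N -> aeval P = \sum_(i < n) P`_i *: x ^+ i.
Proof.
move=> sP; rewrite /aeval (big_ord_widen n (fun i => P`_i *: x ^+ i)) // big_mkcond /=.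
by apply: eq_bigr => i _; case: ltnP => // h; rewrite nth_default // scale0r.
Qed.

Lemma aevalD P Q : aeval (P + Q) = aeval P + aeval Q.
Proof.
pose n := maxn (size P) (size Q).
rewrite !(@aeval_widen n) ?leq_maxl ?leq_maxr ?(leq_trans (size_polyD _ _)) //.
by rewrite -big_split; apply: eq_bigr => i _; rewrite coefD scalerDl.
Qed.

Lemma aevalZ c P : aeval (c *: P) = c *: aeval P.
Proof.
rewrite (@aeval_widen (size P)) ?size_scale_leq // scaler_sumr.
by apply: eq_bigr => i _; rewrite coefZ scalerA.
Qed.

Lemma aevalN P : aeval (- P) = - aeval P.
Proof. by rewrite -scaleN1r aevalZ scaleN1r. Qed.

Lemma aevalXn n : aeval 'X^n = x ^+ n.
Proof.
rewrite (@aeval_widen n.+1) ?size_polyXn // big_ord_recr /= coefXn eqxx scale1r.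
by rewrite big1 ?add0r // => i _; rewrite coefXn ltn_eqF // scale0r.
Qed.

Lemma aevalMX P : aeval (P * 'X) = aeval P * x.
Proof.
rewrite (@aeval_widen (size P).+1); last first.
  by rewrite (leq_trans (size_polyMleq _ _)) // size_polyX addn2.
rewrite big_ord_recl coefMX /= scale0r add0r mulr_suml; apply: eq_bigr => i _.
by rewrite coefMX /= -pres_scalerAl -exprSr.
Qed.

Lemma aeval_prod n (c : nat -> F) :
  aeval (\prod_(i < n) ('X - (c i)%:P)) = \prod_(i < n) (x - c i *: (1 : A)).
Proof.
elim: n => [|n IH]; first by rewrite !big_ord0 (aevalXn 0).
rewrite !big_ord_recr /= mulrBr aevalD aevalMX aevalN mulrC mul_polyC aevalZ IH.
by rewrite mulrBr -pres_scalerAr mulr1.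
Qed.

End PolynomialEvaluation.

Notation KAP := (kap tQ uK uKinv).
Notation UL := (@pres_scalerAl Qt uq_gen uq_rel).
Notation UR := (@pres_scalerAr Qt uq_gen uq_rel).

Lemma divpowE x n : divpow x n = dpow tQ x n.
Proof. by rewrite dpowE. Qed.

Lemma uKEKz : uK * uE * uKinv = tQ ^ 2 *: uE. Proof. exact: uKEK. Qed.
Lemma uKFKz : uK * uF * uKinv = tQ ^ (-2) *: uF. Proof. exact: uKFK. Qed.

Lemma uKFKs : uKinv * uF * uK = tQ ^ 2 *: uF.
Proof.
have h : uKinv * (uK * uF * uKinv) * uK = uF.
  by rewrite !mulrA uKinv_K mul1r -mulrA uKinv_K mulr1.
by rewrite -{2}h uKFKz -UR -UL scalerA (expzK tQ_neq0) scale1r.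
Qed.

Lemma uKEKs : uKinv * uE * uK = tQ ^ (-2) *: uE.
Proof.
have h : uKinv * (uK * uE * uKinv) * uK = uE.
  by rewrite !mulrA uKinv_K mul1r -mulrA uKinv_K mulr1.
by rewrite -{2}h uKEKz -UR -UL scalerA mulrC (expzK tQ_neq0) scale1r.
Qed.

Lemma uFEEF : uF * uE - uE * uF = (tQ - tQ^-1)^-1 *: (uKinv - uK).
Proof. by rewrite -opprB uEFFE -scalerN opprB. Qed.

Lemma kbr_swap c : kbr tQ uKinv uK c = - kbr tQ uK uKinv (- c).
Proof. by rewrite !kbrE opprK -[RHS]scalerN opprB. Qed.

(** The relations are symmetric under exchanging E with F and K with K^-1, so [commutation] also
    gives F^(n) E^(b). This rewrites the brackets in K^-1 that appear there in terms of K. *)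
Lemma kap_swap c d : kap tQ uKinv uK c d = (-1) ^+ d *: KAP (d%:Z - 1 - c) d.
Proof.
elim: d c => [|d IH] c; first by rewrite expr0 scale1r.
rewrite kapS (kapSr tQ uK_Kinv uKinv_K) IH kbr_swap.
have -> : d%:Z - 1 - (c - 1) = d.+1%:Z - 1 - c by rewrite intS; ring.
have -> : d.+1%:Z - 1 - c - d%:Z = - c by rewrite intS; ring.
rewrite -UR mulNr scalerN -scaleNr scalerA exprS mulN1r.
by rewrite [in RHS]scalerA [in RHS]mulrC.
Qed.

Section Ures.

Lemma in_Ures_laurent f u : is_laurent f -> in_Ures u -> in_Ures (f *: u).
Proof. by move=> [P [n ->]]; apply: in_Ures_scale. Qed.

Lemma in_Ures_opp u : in_Ures u -> in_Ures (- u).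
Proof. by move=> h; rewrite -scaleN1r; apply: in_Ures_laurent h; apply: (is_laurent_int (-1)). Qed.

Lemma in_Ures0 : in_Ures 0.
Proof. by rewrite -(scale0r (1 : Ut)); apply: in_Ures_laurent in_Ures_1; apply: is_laurent0. Qed.

Lemma in_Ures_sum I (r : seq I) (P : pred I) (F : I -> Ut) :
  (forall i, P i -> in_Ures (F i)) -> in_Ures (\sum_(i <- r | P i) F i).
Proof. by move=> h; elim/big_ind: _ => //; [exact: in_Ures0 | exact: in_Ures_add]. Qed.

Lemma in_Ures_exp u n : in_Ures u -> in_Ures (u ^+ n).
Proof.
by move=> h; elim: n => [|n IH]; [exact: in_Ures_1 | rewrite exprS; apply: in_Ures_mul].
Qed.

Lemma ut_commutation n b : divpow uE n * divpow uF b =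
  \sum_(d < n.+1) dpsub tQ uF b d * KAP ((2 * d)%:Z - n%:Z - b%:Z) d * divpow uE (n - d).
Proof.
rewrite !divpowE (commutation tQ_neq0 tQ_generic uK_Kinv uKinv_K uKEKz uKFKz uEFFE).
by apply: eq_bigr => d _; rewrite divpowE.
Qed.

Lemma in_Ures_dpsub b d : in_Ures (dpsub tQ uF b d).
Proof.
rewrite /dpsub; case: ifP => _; last exact: in_Ures0.
by rewrite -divpowE; apply: in_Ures_F.
Qed.

(** For c = 0 the element is the last term of the commutation formula for E^(d) F^(d), whose other
    terms lie in U_res by induction on d. The Pascal rule [kap_shift] then moves c up and down. *)
Lemma in_Ures_kap d c : in_Ures (KAP c d).
Proof.
elim/ltn_ind: d c => -[|d] IH c; first exact: in_Ures_1.
move: c; apply: int_updown_ind => [|c hc|c hc].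
- have := ut_commutation d.+1 d.+1; rewrite big_ord_recr subnn {2}/dpsub leqnn subnn.
  rewrite dpow0 [divpow uE 0]divpowE dpow0 mul1r mulr1.
  have -> : (2 * d.+1)%:Z - d.+1%:Z - d.+1%:Z = 0 by lia.
  set S := \sum_(x < _) _ => h.
  have -> : KAP 0 d.+1 = divpow uE d.+1 * divpow uF d.+1 - S.
    have {}h : divpow uE d.+1 * divpow uF d.+1 = S + KAP 0 d.+1 := h.
    by rewrite h [S + _]addrC addrK.
  apply: in_Ures_add.
    by apply: in_Ures_mul; [apply: in_Ures_E | apply: in_Ures_F].
  apply/in_Ures_opp/in_Ures_sum => x _; apply: in_Ures_mul; last exact: in_Ures_E.
  by apply: in_Ures_mul; [apply: in_Ures_dpsub | apply: (IH _ (ltn_ord x))].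
- rewrite (kap_shift tQ_neq0 tQ_generic uK_Kinv uKinv_K); apply: in_Ures_add.
    by apply: in_Ures_laurent hc; apply: is_laurentXz.
  apply: in_Ures_laurent; first exact: is_laurentXz.
  by apply: in_Ures_mul; [exact: in_Ures_Kinv | apply: IH].
- have -> : KAP c d.+1 = tQ ^ (- d.+1%:Z) *: (KAP (c + 1) d.+1 - tQ ^ (d%:Z - c) *: (uKinv * KAP c d)).
    rewrite (kap_shift tQ_neq0 tQ_generic uK_Kinv uKinv_K) addrK scalerA mulrC.
    by rewrite (expzK tQ_neq0) scale1r.
  apply: in_Ures_laurent; first exact: is_laurentXz.
  apply: in_Ures_add => //; apply: in_Ures_opp.
  apply: in_Ures_laurent; first exact: is_laurentXz.
  by apply: in_Ures_mul; [exact: in_Ures_Kinv | apply: IH].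
Qed.

End Ures.

(** * The unrolled generator and Lusztig's element [K; 0 choose l] *)

Section Unrolled.

(** Modulo Phi_l(t) the powers t^x with x < l are the l-th roots of unity, so the product becomes
    X^l - 1. For each coefficient in X, vanishing at a primitive complex root gives divisibility
    over Q, and over Z because Phi_l is monic. *)
Lemma prod_sub_exp_cyclotomic l : (0 < l)%N ->
  exists R : {poly {poly int}},
    \prod_(x < l) ('X - ('X^x)%:P) = 'X^l - 1 + ('Phi_l)%:P * R.
Proof.
move=> l0; pose D : {poly {poly int}} := \prod_(x < l) ('X - ('X^x)%:P) - ('X^l - 1).
have [z pz] := C_prim_root_exists l0.
have Dz i : (map_poly (intr : int -> algC) D`_i).[z] = 0.
  pose phi : {rmorphism {poly int} -> algC} := horner_eval z \o map_poly intr.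
  rewrite -[LHS]/(phi D`_i) -coef_map.
  have -> : map_poly phi D = 0; last by rewrite coef0.
  rewrite rmorphB rmorph_prod /= rmorphB /= map_polyXn rmorph1.
  rewrite -(factor_Xn_sub_1 pz) big_mkord; apply/eqP; rewrite subr_eq0; apply/eqP.
  apply: eq_bigr => x _; rewrite rmorphB /= map_polyX map_polyC /=.
  by rewrite /horner_eval /= map_polyXn hornerXn.
have dvd i : exists r, D`_i = 'Phi_l * r.
  suff : 'Phi_l %| D`_i by case/dvdpP_int => r; rewrite zprimitive_monic ?Cyclotomic_monic //; exists r.
  rewrite -dvdp_rat_int; have [p [Dp _] dvp] := minCpolyP z.
  have ep : p = map_poly intr 'Phi_l.
    apply: (map_inj_poly (fmorph_inj (ratr : {rmorphism rat -> algC}))); first exact: rmorph0.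
    rewrite -Dp (minCpoly_cyclotomic pz) -(Cintr_Cyclotomic pz) -map_poly_comp.
    by apply: eq_map_poly => c /=; rewrite ratr_int.
  rewrite -ep -dvp /root -map_poly_comp.
  by rewrite (eq_map_poly (g := intr)) ?Dz // => c /=; rewrite ratr_int.
have [r Dr] := choice dvd.
exists (\poly_(i < size D) r i); rewrite -[LHS](subrK ('X^l - 1)) -/D addrC; congr (_ + _).
apply/polyP => i; rewrite coefCM coef_poly; case: ltnP => [_|h]; first exact: Dr.
by rewrite mulr0 nth_default.
Qed.

Definition cyclo_cofactor l : {poly int} := \prod_(d <- rem l (divisors l)) 'Phi_d.

Lemma cyclo_cofactorE l : (0 < l)%N -> 'Phi_l * cyclo_cofactor l = 'X^l - 1.
Proof.
by move=> l0; rewrite -prod_Cyclotomic // (big_rem l) //= -dvdn_divisors.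
Qed.

(** The factor for x equals (t^(2x+2) - 1)/t. *)
Definition kprod_coef d : Qt := \prod_(x < d) ((tQ - tQ^-1) * tQ ^+ x * qint tQ x.+1).

Lemma is_laurent_kprod_coef d : is_laurent (kprod_coef d).
Proof.
apply: (big_ind is_laurent); [exact: is_laurent1 | exact: is_laurentM |] => x _.
apply: is_laurentM; last exact: is_laurent_qint.
apply: is_laurentM; last exact: (is_laurentXz x).
by apply: is_laurentD; [exact: (is_laurentXz 1) | exact/is_laurentN/(is_laurentXz (-1))].
Qed.

Lemma is_laurent_intpoly (P : {poly int}) : is_laurent (map_poly intr P).[tQ ^+ 2].
Proof.
exists (P \Po 'X^2), 0%N.
by rewrite /laurent expr0 divr1 map_comp_poly horner_comp map_polyXn hornerXn.
Qed.

(** Each factor K^2 - t^(2x) is (t - 1/t) t^x K [K; -x]. *)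
Lemma kprod d : \prod_(x < d) (uK ^+ 2 - (tQ ^+ 2) ^+ x *: (1 : Ut))
  = kprod_coef d *: (uK ^+ d * KAP 0 d).
Proof.
elim: d => [|d IH]; first by rewrite /kprod_coef !big_ord0 scale1r mul1r.
rewrite big_ord_recr /= IH /kprod_coef big_ord_recr /= -/(kprod_coef d).
have -> : uK ^+ 2 - (tQ ^+ 2) ^+ d *: (1 : Ut)
    = ((tQ - tQ^-1) * tQ ^+ d) *: (uK * kbr tQ uK uKinv (- d%:Z)).
  rewrite kbrE opprK -UR mulrBr -!UR uK_Kinv !scalerA mulrAC divff ?tQ_sub_neq0 // mul1r.
  rewrite scalerBr !scalerA -exprM mul2n -addnn exprD -expr2.
  by rewrite [tQ ^+ d * _](expzK tQ_neq0 d) scale1r.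
rewrite -UL -UR scalerA -[in RHS]scalerA.
have -> : (tQ - tQ^-1) * tQ ^+ d * qint tQ d.+1 *: (uK ^+ d.+1 * KAP 0 d.+1)
   = ((tQ - tQ^-1) * tQ ^+ d) *: (uK ^+ d * KAP 0 d * (uK * kbr tQ uK uKinv (- d%:Z))).
  rewrite -scalerA; congr (_ *: _).
  rewrite (kapSr tQ uK_Kinv uKinv_K) sub0r UR scalerA mulfV ?scale1r ?qintQ_neq0 //.
  by rewrite exprSr -!mulrA; congr (_ * _); rewrite mulrA -k_kap -?mulrA ?kbr_kap // ?uK_Kinv ?uKinv_K.
by rewrite scalerA.
Qed.

Lemma prod_sub_gq (F : fieldType) (t : F) (t0 : t != 0)
    (tgen : forall n, (0 < n)%N -> t ^+ (n * 2) != 1) (n : int) d :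
  \prod_(x < d) ((t ^ n) ^+ 2 - (t ^+ 2) ^+ x)
  = \prod_(x < d) ((t - t^-1) * t ^+ x * qint t x.+1) * ((t ^ n) ^+ d * gq t n d).
Proof.
have t1 := generic_subV_neq0 t0 tgen.
elim: d => [|d IH]; first by rewrite !big_ord0 !mul1r.
rewrite gqSr !big_ord_recr /= IH -(exprM t 2 d) mulnC (exprM t d 2).
have h : qint t d.+1 != 0 by apply: qint_neq0.
have -> : qint t (n - d%:Z) = (t ^ n / t ^+ d - t ^+ d / t ^ n) / (t - t^-1).
  by rewrite /qint !(expfz_split t0) invf_div -exprnP.
have hn : t ^ n != 0 by rewrite expfz_neq0.
have hd : t ^+ d != 0 by rewrite expf_neq0.
rewrite [_ ^+ d.+1]exprS; move: (qint t d.+1) (t ^ n) (t ^+ d) (t - t^-1) h hn hd t1 => u v w y u0 v0 w0 y0.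
by field; rewrite u0 v0 w0 y0.
Qed.

Lemma kprod_coef_div (F : fieldType) (t phi c u : F) (m : nat) :
  t != 0 -> t - t^-1 != 0 -> phi != 0 -> phi * c = t ^+ (m.+1 * 2) - 1 ->
  phi^-1 * (u * ((t - t^-1) * t ^+ m * qint t m.+1)) = t^-1 * c * u.
Proof.
move=> t0 t1 phi0 phic; have w0 := expf_neq0 m t0.
have -> : c = (t ^+ (m.+1 * 2) - 1) / phi by rewrite -phic mulrC mulKf.
rewrite /qint -(invr_expz t) -exprnP exprM exprS.
move: (t - t^-1) t1 (t ^+ m) w0 => v v0 w w0; field.
by rewrite -?andbA ?phi0 ?v0 ?w0 ?t0.
Qed.

(** Substitute K^2 for X and t^2 for t in [prod_sub_exp_cyclotomic] and divide by Phi_l(t^2). The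
    constant B stays Laurent because Phi_l(t^2) divides the factor t^(2l) - 1 coming from
    [kprod_coef l]. The same R serves K and the scalars t^n, so that the action of [K; 0 choose l]
    can be solved for on weight vectors. *)
Lemma unrolled_numE l : (0 < l)%N -> 
  let B := tQ^-1 * (map_poly intr (cyclo_cofactor l)).[tQ ^+ 2] * kprod_coef l.-1 in
  exists R : {poly Qt}, [/\ forall i, is_laurent R`_i,
  unrolled_num l = B *: (uK ^+ l * KAP 0 l) - aeval (uK ^+ 2) R &
  forall n : int, (cyclo_at l (tQ ^+ 2))^-1 * ((tQ ^ n) ^+ (2 * l) - 1)
    = B * ((tQ ^ n) ^+ l * gq tQ n l) - R.[(tQ ^ n) ^+ 2]].
Proof.
move=> l0 B; have [R0 eR] := prod_sub_exp_cyclotomic l0.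
pose psi : {rmorphism {poly int} -> Qt} := horner_eval (tQ ^+ 2) \o map_poly intr.
have psiX : psi 'X = tQ ^+ 2 by rewrite /= map_polyX /horner_eval hornerX.
have eC : psi 'Phi_l * psi (cyclo_cofactor l) = tQ ^+ (l * 2) - 1.
  rewrite -rmorphM cyclo_cofactorE // rmorphB rmorph1; congr (_ - _).
  by rewrite rmorphXn psiX -exprM mulnC.
have ePhi : psi 'Phi_l != 0.
  apply: contraTneq (tQ_generic l0) => h; rewrite negbK -subr_eq0 -eC h mul0r //.
have e : \prod_(x < l) ('X - ((tQ ^+ 2) ^+ x)%:P) = 'X^l - 1 + psi 'Phi_l *: map_poly psi R0.
  move: (congr1 (map_poly psi) eR).
  rewrite rmorph_prod rmorphD rmorphM rmorphB /= map_polyXn rmorph1 map_polyC /= mul_polyC => <-.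
  apply: eq_bigr => x _; rewrite rmorphB /= map_polyX map_polyC /=; congr (_ - _%:P).
  by rewrite /horner_eval map_polyXn hornerXn.
have := @kprod_coef_div _ tQ (psi 'Phi_l) (psi (cyclo_cofactor l)) (kprod_coef l.-1) l.-1
  tQ_neq0 tQ_sub_neq0 ePhi.
rewrite prednK // => /(_ eC) eB.
have {}eB : (psi 'Phi_l)^-1 * kprod_coef l = B.
  rewrite /B -[(map_poly _ _).[_]]/(psi (cyclo_cofactor l)) -eB; congr (_ * _).
  by rewrite -{1}(prednK l0) /kprod_coef big_ord_recr /= prednK.
exists (map_poly psi R0); split=> [i||n].
- by rewrite coef_map; exact: is_laurent_intpoly.
- have := congr1 (aeval (uK ^+ 2)) e.
  rewrite aeval_prod kprod !aevalD aevalXn aevalZ aevalN (aevalXn _ 0) -exprM => h.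
  rewrite /unrolled_num -[cyclo_at l _]/(psi 'Phi_l).
  have {h}-> : uK ^+ (2 * l) - 1 = kprod_coef l *: (uK ^+ l * KAP 0 l)
      - psi 'Phi_l *: aeval (uK ^+ 2) (map_poly psi R0) by rewrite h addrK.
  by rewrite scalerBr !scalerA mulVf // scale1r eB.
- have := congr1 (horner^~ ((tQ ^ n) ^+ 2)) e.
  rewrite horner_prod (eq_bigr (fun x : 'I_l => (tQ ^ n) ^+ 2 - (tQ ^+ 2) ^+ x)); last first.
    by move=> x _; rewrite hornerXsubC.
  rewrite (prod_sub_gq tQ_neq0 tQ_generic) -/(kprod_coef l) !hornerD hornerXn hornerN hornerC.
  rewrite hornerZ -exprM => h; rewrite -[cyclo_at l _]/(psi 'Phi_l) -eB.
  have {h}-> : (tQ ^ n) ^+ (2 * l) - 1 = kprod_coef l * ((tQ ^ n) ^+ l * gq tQ n l)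
      - psi 'Phi_l * (map_poly psi R0).[(tQ ^ n) ^+ 2] by rewrite h addrK.
  by rewrite mulrBr (mulKf ePhi) !mulrA.
Qed.

Lemma in_Ures_unrolled l : (0 < l)%N -> in_Ures (unrolled_num l).
Proof.
move=> l0; have [R [hR -> _]] := unrolled_numE l0; apply: in_Ures_add.
  apply: in_Ures_laurent; last first.
    apply: in_Ures_mul; last exact: in_Ures_kap.
    exact/in_Ures_exp/in_Ures_K.
  apply: is_laurentM; last by apply: is_laurent_kprod_coef.
  apply: is_laurentM; first exact: (is_laurentXz (-1)).
  exact: is_laurent_intpoly.
apply/in_Ures_opp/in_Ures_sum => i _; apply: in_Ures_laurent; first exact: hR.
by do 2!apply: in_Ures_exp; exact: in_Ures_K.
Qed.

End Unrolled.

(** * Weight theory of the specialized algebra *)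

Section Specialized.
Variables (C : numFieldType) (q : C).
Hypothesis hq : q != 0.

(** Defined on all of U_t, with value that of 0 outside U_res, so that membership proofs stay out of
    the terms. *)
Definition sp (u : Ut) : LU q := specialize q (insubd (0 : Ures) u).

Lemma insubd_ures u (h : in_Ures u) : insubd (0 : Ures) u = mk_ures h.
Proof. by apply: val_inj; rewrite val_insubd; case: ures_predP. Qed.

Lemma spE u (h : in_Ures u) : specialize q (mk_ures h) = sp u.
Proof. by rewrite /sp (insubd_ures h). Qed.

Lemma sp_ures (u : Ures) : specialize q u = sp (val u).
Proof. by rewrite /sp valKd. Qed.

Lemma spD u v : in_Ures u -> in_Ures v -> sp (u + v) = sp u + sp v.
Proof.
move=> hu hv; rewrite -!spE; first exact: in_Ures_add.
move=> huv; rewrite -[RHS]pclsD -(pcls_rel (spec_add q _ _)); congr pcls.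
by congr Gen; apply: val_inj.
Qed.

Lemma spM u v : in_Ures u -> in_Ures v -> sp (u * v) = sp u * sp v.
Proof.
move=> hu hv; rewrite -!spE; first exact: in_Ures_mul.
move=> huv; rewrite -[RHS]pclsM -(pcls_rel (spec_mul q _ _)); congr pcls.
by congr Gen; apply: val_inj.
Qed.

Lemma sp1 : sp 1 = 1.
Proof.
rewrite -(spE in_Ures_1) -[RHS](pcls_rel (spec_one q)); congr pcls.
by congr Gen; apply: val_inj.
Qed.

Lemma spZ f u : is_laurent f -> in_Ures u -> sp (f *: u) = evq q f *: sp u.
Proof.
move=> [P [n ->]] hu; rewrite (evq_eq (ev_laurentq hq P n)).
rewrite -(spE hu) -(spE (in_Ures_scale P n hu)).
rewrite -[RHS]pclsM -(pcls_rel (spec_scale q _ _ _)); congr pcls.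
by congr Gen; apply: val_inj.
Qed.

Lemma sp_sum I (r : seq I) (P : pred I) (F : I -> Ut) :
  (forall i, P i -> in_Ures (F i)) ->
  sp (\sum_(i <- r | P i) F i) = \sum_(i <- r | P i) sp (F i).
Proof.
move=> h; suff [] : in_Ures (\sum_(i <- r | P i) F i) /\
  sp (\sum_(i <- r | P i) F i) = \sum_(i <- r | P i) sp (F i) by [].
elim/big_rec2: _ => [|i x y Pi [hy <-]].
  split; first exact: in_Ures0.
  by rewrite -(scale0r (1 : Ut)) spZ ?evq0 ?scale0r //; [exact: is_laurent0 | exact: in_Ures_1].
by split; [apply: in_Ures_add => //; apply: h | rewrite spD //; apply: h].
Qed.

Lemma LE_sp n : LE q n = sp (divpow uE n). Proof. exact: spE. Qed.
Lemma LF_sp n : LF q n = sp (divpow uF n). Proof. exact: spE. Qed.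
Lemma LK_sp : LK q = sp uK. Proof. exact: spE. Qed.

Lemma LU_ind (P : LU q -> Prop) :
  (forall c, P (c *: (1 : LU q))) -> (forall x y, P x -> P y -> P (x + y)) ->
  (forall x y, P x -> P y -> P (x * y)) ->
  P (LK q) -> P (sp uKinv) -> (forall n, P (LE q n)) -> (forall n, P (LF q n)) ->
  forall x, P x.
Proof.
move=> hc hD hM hK hKi hE hF; elim/presAlg_ind => // u.
rewrite -/(specialize q u) sp_ures.
suff H w : in_Ures w -> P (sp w) by apply/H/ures_predP/(uresP u).
elim=> {w u} [||n|n||u v hu Pu hv Pv|u v hu Pu hv Pv|Q n u hu Pu] //.
- by rewrite -LK_sp.
- by rewrite -LE_sp.
- by rewrite -LF_sp.
- by rewrite sp1 -[1]scale1r.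
- by rewrite spD //; apply: hD.
- by rewrite spM //; apply: hM.
- rewrite spZ //; last by exists Q, n.
  by rewrite -[sp u]mul1r (@pres_scalerAl C); apply: hM.
Qed.

End Specialized.

Section Homs.
Variables (C : numFieldType) (q : C).
Hypothesis hq : q != 0.

Lemma spKiK (M : LUmod q) v : act M (sp q uKinv) (act M (LK q) v) = v.
Proof.
rewrite -actMv LK_sp -spM // ?uKinv_K ?sp1 ?act1v //;
  [exact: in_Ures_Kinv | exact: in_Ures_K].
Qed.

Lemma spKKi (M : LUmod q) v : act M (LK q) (act M (sp q uKinv) v) = v.
Proof.
rewrite -actMv LK_sp -spM // ?uK_Kinv ?sp1 ?act1v //;
  [exact: in_Ures_K | exact: in_Ures_Kinv].
Qed.

(* Stability under K, the E^(n) and the F^(n) suffices: in finite dimension K^-1 also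
   preserves a subspace preserved by K. *)
Lemma stable_gens (M : LUmod q) (U : {vspace M}) :
  (forall v, v \in U -> act M (LK q) v \in U) ->
  (forall n v, v \in U -> act M (LE q n) v \in U) ->
  (forall n v, v \in U -> act M (LF q n) v \in U) -> stable U.
Proof.
move=> hK hE hF.
have KU : (act M (LK q) @: U)%VS = U.
  apply/eqP; rewrite eqEdim; apply/andP; split.
    by apply/subvP => _ /memv_imgP[v vU ->]; apply: hK.
  rewrite limg_dim_eq //; apply/eqP; rewrite -subv0; apply/subvP => v.
  rewrite memv_cap memv_ker => /andP[_ /eqP h].
  by rewrite -(spKiK v) h linear0 mem0v.
elim/(LU_ind hq) => [c v vU|x y hx hy v vU|x y hx hy v vU|//|v|//|//].
- by rewrite actZv act1v memvZ.
- by rewrite actDv memvD ?hx ?hy.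
- by rewrite actMv hx ?hy.
- by rewrite -{1}KU => /memv_imgP[w wU ->]; rewrite spKiK.
Qed.

End Homs.

Lemma expfz_sub1_ratio (F : fieldType) (t : F) (l : nat) :
  t != 0 -> t - t^-1 != 0 -> forall n : int, qint t l%:Z != 0 ->
  (t ^ n) ^+ (2 * l) - 1
    = (t ^+ (2 * l) - 1) * (t ^ (l%:Z * (n - 1)) * (qint t (l%:Z * n) / qint t l%:Z)).
Proof.
move=> t0 t1 n; have -> : (t ^ n) ^+ (2 * l) = (t ^ (l%:Z * n)) ^+ 2.
  by rewrite mulnC exprM; congr (_ ^+ 2); rewrite mulrC -exprz_exp.
rewrite mulnC exprM mulrBr mulr1 expfzDr // /qint -!(invr_expz t) -!exprnP.
have b0 : t ^ (l%:Z * n) != 0 by rewrite expfz_neq0.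
have a0 := expf_neq0 l t0.
move: (t ^ (l%:Z * n)) (t ^+ l) (t - t^-1) b0 a0 t1 => b a u b0 a0 u0.
rewrite mulf_eq0 invr_eq0 negb_or => /andP[a1 _].
have a2 : a ^+ 2 - 1 != 0.
  by apply: contraNneq a1 => h; rewrite -[a - _](mulfK a0) mulrBl mulVf // -expr2 h mul0r.
by field; rewrite b0 u0 a0 -expr2 a2.
Qed.

Section Weights.
Variables (C : numFieldType) (q : C) (l : nat).
Hypotheses (hl : (2 <= l)%N) (hq : q != 0) (hql : l.-primitive_root (q ^+ 2)).
Let l0 : (0 < l)%N. Proof. exact: ltnW. Qed.

Lemma ev_qint_ratio_int (n : int) :
  ev q (qint tQ (l%:Z * n) / qint tQ l%:Z) (n%:~R * q ^ (l%:Z * (n - 1))).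
Proof.
case: n => u; first by rewrite -PoszM -pmulrn; apply: ev_qint_ratio.
rewrite NegzE mulrN qintN mulNr mulrNz mulNr -PoszM -pmulrn; apply: evN.
have := ev_qint_ratio hl hq hql u.+1.
have -> // : q ^ (l%:Z * (u.+1%:Z - 1)) = q ^ (l%:Z * (- u.+1%:Z - 1)).
have <- : q ^ (l%:Z * (u.+1%:Z + 1)) = q ^ (l%:Z * (- u.+1%:Z - 1)).
  by rewrite -(qpow_l hq hql) -mulrN opprD.
have -> : l%:Z * (u.+1%:Z + 1) = l%:Z * 1 + (l%:Z * 1 + l%:Z * (u.+1%:Z - 1)) by ring.
have h : q ^ (l%:Z * 1) * q ^ (l%:Z * 1) = 1.
  by rewrite -{1}(qpow_l hq hql) -expfzDr // addNr expr0z.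
by rewrite !expfzDr // mulrA h mul1r.
Qed.

Definition cof : Qt := (map_poly intr (cyclo_cofactor l)).[tQ ^+ 2].
Definition cofq : C := (map_poly intr (cyclo_cofactor l)).[q ^+ 2].

Lemma ev_cof : ev q cof cofq.
Proof. exact/ev_intpoly/evX/ev_tQ. Qed.

(** Phi_d(q^2) = 0 for a divisor d of l would give (q^2)^d = 1, hence d = l. *)
Lemma cofq_neq0 : cofq != 0.
Proof.
rewrite /cofq /cyclo_cofactor rmorph_prod horner_prod prodf_seq_neq0.
apply/allP => d; rewrite mem_rem_uniq ?divisors_uniq // inE => /andP[dl].
rewrite -dvdn_divisors // => ddl /=; apply/eqP => h.
have d0 : (0 < d)%N by apply: dvdn_gt0 ddl.
have : (q ^+ 2) ^+ d = 1.
  apply/eqP; rewrite -subr_eq0; apply/eqP.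
  have := cyclo_cofactorE d0 => /(congr1 (fun P => (map_poly (intr : int -> C) P).[q ^+ 2])).
  by rewrite rmorphM hornerM h mul0r rmorphB rmorph1 /= map_polyXn !hornerE => <-.
move/eqP; rewrite -(prim_order_dvd hql) => ld; move/eqP: dl; apply.
by apply/eqP; rewrite eqn_dvd ddl ld.
Qed.

Lemma cyclo_tQ : cyclo_at l (tQ ^+ 2) * cof = tQ ^+ (2 * l) - 1.
Proof.
rewrite /cyclo_at /cof -hornerM -rmorphM cyclo_cofactorE //= rmorphB rmorph1 /=.
by rewrite map_polyXn !hornerE -exprM.
Qed.

Lemma cyclo_tQ_neq0 : cyclo_at l (tQ ^+ 2) != 0.
Proof.
apply: contraTneq (tQ_generic l0) => h; rewrite negbK mulnC -subr_eq0 -cyclo_tQ h mul0r.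
exact: eqxx.
Qed.

Lemma ev_unrolled (n : int) :
  ev q ((cyclo_at l (tQ ^+ 2))^-1 * ((tQ ^ n) ^+ (2 * l) - 1)) (cofq * n%:~R).
Proof.
have ql : qint tQ l%:Z != 0 by apply: qintQ_neq0; rewrite eqz_nat -lt0n.
have -> : (cyclo_at l (tQ ^+ 2))^-1 * ((tQ ^ n) ^+ (2 * l) - 1)
   = cof * (tQ ^ (l%:Z * (n - 1)) * (qint tQ (l%:Z * n) / qint tQ l%:Z)).
  apply: (mulfI cyclo_tQ_neq0); rewrite mulVKf ?cyclo_tQ_neq0 // mulrA cyclo_tQ.
  exact: (expfz_sub1_ratio tQ_neq0 tQ_sub_neq0 n ql).
have -> : n%:~R = q ^ (l%:Z * (n - 1)) * (n%:~R * q ^ (l%:Z * (n - 1))) :> C.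
  by rewrite mulrCA -{1}(qpow_l hq hql) -expfzDr // addNr expr0z mulr1.
apply: evM; first exact: ev_cof.
by apply: evM; [apply: evXz => //; apply: ev_tQ | apply: ev_qint_ratio_int].
Qed.

Local Open Scope classical_set_scope.

Lemma epsqE : epsq q l = cofq.
Proof.
have h : ev q cof cofq by apply: ev_cof.
apply: (@ev_lim _ _ cof) h.
pose P : {poly C} := map_poly intr 'Phi_l \Po 'X^2.
have P0 : P != 0.
  rewrite /P comp_poly_eq0 ?size_polyXn // map_poly_eq0_id0 ?monic_neq0 ?Cyclotomic_monic //.
  by rewrite intr_eq0 lead_coef_eq0 monic_neq0 ?Cyclotomic_monic.
apply: filterS (poly_neq0_near q P0) => t; rewrite /P horner_comp hornerXn => Pt.
have -> : cof = (tQ ^+ (2 * l) - 1) / cyclo_at l (tQ ^+ 2).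
  by rewrite -cyclo_tQ mulrC mulKf // cyclo_tQ_neq0.
apply: ev_div => //; last exact/ev_intpoly/evX/ev_tQ.
by apply: evB; [exact/evX/ev_tQ | exact: ev1].
Qed.

Local Close Scope classical_set_scope.

(** K determines n only through q^n; H is what separates the integers. *)
Definition wvec (M : LUmod q) (n : int) (v : M) : Prop :=
  act M (LK q) v = q ^ n *: v /\ act M (LH q l) v = n%:~R *: v.

Lemma act_unrolled (M : LUmod q) v : act M (sp q (unrolled_num l)) v = cofq *: act M (LH q l) v.
Proof. by rewrite /LH actZv scalerA epsqE mulfV ?scale1r // cofq_neq0. Qed.

(* [u] lies in U_res and acts on every vector of weight [n] of every module by the value
   at q of [g n]. *)
Definition diag (u : Ut) (g : int -> Qt) : Prop :=
  in_Ures u /\ forall n, reg q (g n) /\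
    forall (M : LUmod q) (v : M), wvec n v -> act M (sp q u) v = evq q (g n) *: v.

Lemma diagD u v g h : diag u g -> diag v h -> diag (u + v) (fun n => g n + h n).
Proof.
move=> [hu gu] [hv gv]; split=> [|n]; first exact: in_Ures_add.
have [ru au] := gu n; have [rv av] := gv n; split=> [|M x wx]; first exact: regD.
by rewrite spD // actDv au // av // evqD // scalerDl.
Qed.

Lemma diagM u v g h : diag u g -> diag v h -> diag (u * v) (fun n => g n * h n).
Proof.
move=> [hu gu] [hv gv]; split=> [|n]; first exact: in_Ures_mul.
have [ru au] := gu n; have [rv av] := gv n; split=> [|M x wx]; first exact: regM.
by rewrite spM // actMv av // linearZ /= au // evqM // scalerA mulrC.
Qed.

Lemma diagZ f u g : is_laurent f -> diag u g -> diag (f *: u) (fun n => f * g n).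
Proof.
move=> hf [hu gu]; split=> [|n]; first exact: in_Ures_laurent.
have [ru au] := gu n; have rf := reg_laurent hq hf.
split=> [|M x wx]; first exact: regM.
by rewrite spZ // actZv au // evqM // scalerA.
Qed.

Lemma diagB u v g h : diag u g -> diag v h -> diag (u - v) (fun n => g n - h n).
Proof.
move=> hu /(diagZ (is_laurent_int (-1))) hv; have := diagD hu hv.
rewrite scaleN1r; congr diag; apply/funext => n; by rewrite mulN1r.
Qed.

Lemma diag_cancel f u g : is_laurent f -> evq q f != 0 -> in_Ures u ->
  diag (f *: u) (fun n => f * g n) -> diag u g.
Proof.
move=> hf f0 hu [_ h]; split=> // n; have [r a] := h n; have rf := reg_laurent hq hf.
have fn0 : f != 0 by apply: contraNneq f0 => ->; rewrite evq0.
have rg : reg q (g n).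
  by rewrite -(mulKf fn0 (g n)); apply: regM => //; apply: regV.
split=> // M v /a; rewrite spZ // actZv evqM // -scalerA => /(congr1 ( *:%R (evq q f)^-1)).
by rewrite !scalerK.
Qed.

Lemma diag1 : diag 1 (fun=> 1).
Proof.
split=> [|n]; first exact: in_Ures_1.
split=> [|M v _]; first exact: reg1.
by rewrite sp1 act1v evq1 scale1r.
Qed.

Lemma evq_expz (n : int) : evq q (tQ ^ n) = q ^ n.
Proof. by apply: evq_eq; apply: evXz => //; apply: ev_tQ. Qed.

Lemma diagK : diag uK (fun n => tQ ^ n).
Proof.
split=> [|n]; first exact: in_Ures_K.
split=> [|M v [wK _]]; first exact/(reg_laurent hq)/is_laurentXz.
by rewrite -LK_sp wK evq_expz.
Qed.

Lemma diagKi : diag uKinv (fun n => tQ ^ (- n)).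
Proof.
split=> [|n]; first exact: in_Ures_Kinv.
split=> [|M v [wK _]]; first exact/(reg_laurent hq)/is_laurentXz.
rewrite evq_expz -[X in act M _ X](scale1r v) -(expr0z q) -(addNr n) expfzDr // -scalerA.
by rewrite -wK linearZ /= spKiK.
Qed.

Lemma diagX u g m : diag u g -> diag (u ^+ m) (fun n => g n ^+ m).
Proof.
move=> h; elim: m => [|m IH]; first exact: diag1.
have := diagM h IH; congr diag; [by rewrite exprS | by apply/funext => n; rewrite exprS].
Qed.

Lemma diag_unrolled : diag (unrolled_num l)
  (fun n => (cyclo_at l (tQ ^+ 2))^-1 * ((tQ ^ n) ^+ (2 * l) - 1)).
Proof.
split=> [|n]; first exact: in_Ures_unrolled.
split=> [|M v [_ wH]]; first by exists (cofq * n%:~R); apply: ev_unrolled.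
by rewrite act_unrolled wH (evq_eq (ev_unrolled n)) scalerA.
Qed.

Lemma diag_sum (I : finType) (u : I -> Ut) (g : I -> int -> Qt) :
  (forall x, diag (u x) (g x)) -> diag (\sum_x u x) (fun n => \sum_x g x n).
Proof.
move=> h; split=> [|n]; first by apply: in_Ures_sum => x _; case: (h x).
have rg x : reg q (g x n) by have [_ /(_ n)[]] := h x.
split=> [|M v wv]; first exact: reg_sum.
rewrite sp_sum //; last by move=> x _; case: (h x).
rewrite act_sumv evq_sum // scaler_suml; apply: eq_bigr => x _.
by have [_ /(_ n)[_ ->]] := h x.
Qed.

Lemma diag_kap_cancel d g : diag (uK ^+ d * KAP 0 d) (fun n => (tQ ^ n) ^+ d * g n) ->
  diag (KAP 0 d) g.
Proof.
move=> /(diagM (diagX d diagKi)); congr diag.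
  rewrite mulrA; suff -> : uKinv ^+ d * uK ^+ d = 1 by rewrite mul1r.
  elim: d => [|d IH]; first by rewrite mul1r.
  by rewrite exprSr exprS mulrA -(mulrA (uKinv ^+ d)) uKinv_K mulr1.
apply/funext => n; rewrite mulrA -exprMn -expfzDr ?tQ_neq0 // addNr expr0z expr1n mul1r //.
Qed.

Lemma is_laurent_kprod_evq d : (d < l)%N -> evq q (kprod_coef d) != 0.
Proof.
move=> dl; have h : ev q (kprod_coef d) (\prod_(x < d) ((q - q^-1) * q ^+ x * qint q x.+1)).
  apply: ev_prod => x _; apply: evM; last exact: (ev_qintq hl hq hql).
  apply: evM; last exact/evX/ev_tQ.
  by apply: evB; [exact: ev_tQ | apply: evV => //; exact: ev_tQ].
rewrite (evq_eq h); apply/prodf_neq0 => x _.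
apply: mulf_neq0; first by apply: mulf_neq0; rewrite ?expf_neq0 ?(q_sub_neq0 hl hq hql).
by rewrite (qintq_nat_eq0 hl hq hql) gtnNdvd // (leq_ltn_trans _ dl).
Qed.

(** For d < l the element is a polynomial in K^2, up to a power of K and the constant
    [kprod_coef d], which is nonzero at q. For d = l this constant vanishes at q, and the action is
    recovered from H through [unrolled_numE]. *)
Lemma diag_kap0 d : (d <= l)%N -> diag (KAP 0 d) (fun n => gq tQ n d).
Proof.
rewrite leq_eqVlt => /predU1P[->|dl].
  have [R [hR eU en]] := unrolled_numE l0.
  apply: diag_kap_cancel; set B := tQ^-1 * _ * _ in eU en.
  apply: (@diag_cancel B).
  - apply: is_laurentM; last exact: is_laurent_kprod_coef.
    by apply: is_laurentM; [exact: (is_laurentXz (-1)) | exact: is_laurent_intpoly].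
  - have hB : ev q B (q^-1 * cofq * evq q (kprod_coef l.-1)).
      apply: evM; last exact/evqP/(reg_laurent hq)/is_laurent_kprod_coef.
      by apply: evM; [apply: evV => //; exact: ev_tQ | exact: ev_cof].
    by rewrite (evq_eq hB) !mulf_neq0 ?invr_eq0 ?cofq_neq0 ?is_laurent_kprod_evq ?prednK.
  - by apply: in_Ures_mul; [exact/in_Ures_exp/in_Ures_K | exact: in_Ures_kap].
  have hS : diag (aeval (uK ^+ 2) R) (fun n => R.[(tQ ^ n) ^+ 2]).
    have := @diag_sum 'I_(size R) _ _ (fun x => diagZ (hR x) (diagX x (diagX 2 diagK))).
    by congr diag; apply/funext => n; rewrite horner_coef.
  have := diagD diag_unrolled hS; rewrite eU subrK; congr diag.
  by apply/funext => n; rewrite en subrK.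
apply/diag_kap_cancel/(@diag_cancel (kprod_coef d)).
- exact: is_laurent_kprod_coef.
- exact: is_laurent_kprod_evq.
- by apply: in_Ures_mul; [exact/in_Ures_exp/in_Ures_K | exact: in_Ures_kap].
have h e : diag (\prod_(x < e) (uK ^+ 2 - (tQ ^+ 2) ^+ x *: (1 : Ut)))
    (fun n => \prod_(x < e) ((tQ ^ n) ^+ 2 - (tQ ^+ 2) ^+ x)).
  elim: e => [|e IH].
    have := diag1; congr diag; first by rewrite big_ord0.
    by apply/funext => n; rewrite big_ord0.
  have lx : is_laurent ((tQ ^+ 2) ^+ e) by rewrite -exprM; exact: (is_laurentXz (2 * e)%N).
  have := diagM IH (diagB (diagX 2 diagK) (diagZ lx diag1)).
  congr diag; first by rewrite [RHS]big_ord_recr.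
  by apply/funext => n; rewrite [RHS]big_ord_recr mulr1.
have := h d; rewrite kprod; congr diag; apply/funext => n.
by rewrite (prod_sub_gq tQ_neq0 tQ_generic).
Qed.

Lemma diag_shift_up c d : diag (KAP c d.+1) (fun n => gq tQ (n + c) d.+1) ->
  diag (KAP c d) (fun n => gq tQ (n + c) d) ->
  diag (KAP (c + 1) d.+1) (fun n => gq tQ (n + (c + 1)) d.+1).
Proof.
move=> h1 h2.
have := diagD (diagZ (is_laurentXz d.+1%:Z) h1) (diagZ (is_laurentXz (d%:Z - c)) (diagM diagKi h2)).
rewrite -(kap_shift tQ_neq0 tQ_generic uK_Kinv uKinv_K); congr diag; apply/funext => n.
rewrite addrA (gq_shift tQ_neq0 tQ_generic) (mulrA (tQ ^ (d%:Z - c))) -expfzDr ?tQ_neq0 //.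
by congr (_ + _ ^ _ * _); lia.
Qed.

Lemma diag_shift_down c d : diag (KAP (c + 1) d.+1) (fun n => gq tQ (n + (c + 1)) d.+1) ->
  diag (KAP c d) (fun n => gq tQ (n + c) d) ->
  diag (KAP c d.+1) (fun n => gq tQ (n + c) d.+1).
Proof.
move=> h1 h2; apply: (@diag_cancel (tQ ^ d.+1%:Z)); first exact: is_laurentXz.
- by rewrite evq_expz expfz_neq0.
- exact: in_Ures_kap.
have := diagB h1 (diagZ (is_laurentXz (d%:Z - c)) (diagM diagKi h2)).
rewrite (kap_shift tQ_neq0 tQ_generic uK_Kinv uKinv_K) addrK; congr diag; apply/funext => n.
rewrite addrA (gq_shift tQ_neq0 tQ_generic) (mulrA (tQ ^ (d%:Z - c))) -expfzDr ?tQ_neq0 //.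
by rewrite (_ : d%:Z - (n + c) = d%:Z - c - n) ?addrK //; lia.
Qed.

(** The case d > l comes from the product of [K; 0 choose l] and [K; -l choose d - l], since
    [d choose l] is nonzero at q; the Pascal rule takes care of c. *)
Lemma diag_kap d c : diag (KAP c d) (fun n => gq tQ (n + c) d).
Proof.
elim/ltn_ind: d c => -[|d] IH c; first exact: diag1.
suff h0 : diag (KAP 0 d.+1) (fun n => gq tQ n d.+1).
  move: c; apply: int_updown_ind => [|c hc|c hc].
  - by move: h0; congr diag; apply/funext => n; rewrite addr0.
  - by apply: diag_shift_up => //; apply: IH.
  - by apply: diag_shift_down => //; apply: IH.
have [dl|ld] := leqP d.+1 l; first exact: diag_kap0.
have ed : (l + (d.+1 - l))%N = d.+1 by rewrite subnKC // ltnW.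
apply: (@diag_cancel (gq tQ d.+1%:Z l)); first exact: is_laurent_gq.
- exact: (gqq_l_neq0 hl hq hql (ltnW ld)).
- exact: in_Ures_kap.
have dl : (d.+1 - l < d.+1)%N by rewrite ltn_subrL l0.
have := diagM (IH l ld 0) (IH _ dl (0 - l%:Z)).
rewrite (kapM tQ_neq0 tQ_generic) ed; congr diag; apply/funext => n.
by rewrite addr0 sub0r (gqM tQ_neq0 tQ_generic) ed.
Qed.

End Weights.

Lemma gq_swap (F : fieldType) (t : F) c d : gq t c d = (-1) ^+ d * gq t (d%:Z - 1 - c) d.
Proof.
elim: d c => [|d IH] c; first by rewrite mul1r.
rewrite gqS gqSr IH.
have -> : d%:Z - 1 - (c - 1) = d.+1%:Z - 1 - c by lia.
have -> : d.+1%:Z - 1 - c - d%:Z = - c by lia.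
by rewrite qintN exprS; ring.
Qed.

Section WeightTheory.
Variables (C : numFieldType) (q : C) (l : nat).
Hypotheses (hl : (2 <= l)%N) (hq : q != 0) (hql : l.-primitive_root (q ^+ 2)).
Let l0 : (0 < l)%N. Proof. exact: ltnW. Qed.
Local Notation wvec := (@wvec C q l _).
Local Notation gqq c d := (evq q (gq tQ c d)).
Implicit Types M : LUmod q.

Lemma is_laurent_unrolled_scalar (m : int) :
  is_laurent ((cyclo_at l (tQ ^+ 2))^-1 * ((tQ ^ m) ^+ (2 * l) - 1)).
Proof.
have H (u : nat) : is_laurent ((cyclo_at l (tQ ^+ 2))^-1 * ((tQ ^ u%:Z) ^+ (2 * l) - 1)).
  rewrite -exprnP -exprM mulnC exprM subrX1 -(cyclo_tQ hl) -mulrA mulKf ?(cyclo_tQ_neq0 hl) //.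
  apply: is_laurentM; first exact: is_laurent_intpoly.
  by apply: is_laurent_sum => i _; rewrite -exprM; exact: (is_laurentXz (2 * l * i)%N).
case: m => m //; rewrite NegzE.
have e : (tQ ^ (- m.+1%:Z)) ^+ (2 * l) * (tQ ^ m.+1%:Z) ^+ (2 * l) = 1.
  by rewrite -exprMn mulrC (expzK tQ_neq0) expr1n.
have -> : (tQ ^ (- m.+1%:Z)) ^+ (2 * l) - 1
    = - (tQ ^ (- m.+1%:Z)) ^+ (2 * l) * ((tQ ^ m.+1%:Z) ^+ (2 * l) - 1).
  by rewrite mulNr mulrBr mulr1 e opprB.
rewrite mulrCA; apply: is_laurentM => //; apply: is_laurentN.
by rewrite exprnP exprz_exp; apply: is_laurentXz.
Qed.

(** For H: moving [unrolled_num l] past x costs the factor t^(2lm), which is 1 at q, and an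
    additional multiple of x, which after normalization becomes m x at q. *)
Lemma wvec_shift M (x : Ut) (m n : int) (v : M) : in_Ures x ->
  uK * x = tQ ^ m *: (x * uK) -> wvec n v -> wvec (n + m) (act M (sp q x) v).
Proof.
move=> hx kx [wK wH].
have KX p : uK ^+ p * x = (tQ ^ m) ^+ p *: (x * uK ^+ p).
  elim: p => [|p IH]; first by rewrite !expr0 mul1r mulr1 scale1r.
  by rewrite exprS -mulrA IH -UR mulrA kx -UL scalerA -mulrA -exprS -exprSr.
split.
  rewrite LK_sp -actMv -spM ?kx ?spZ ?spM //; try exact: in_Ures_K;
    try (by apply: in_Ures_mul => //; exact: in_Ures_K); try exact: is_laurentXz.
  rewrite actZv actMv -LK_sp wK linearZ /= evq_expz // scalerA expfzDr // mulrC //.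
have cn := cofq_neq0 hl hql.
suff : cofq q l *: act M (LH q l) (act M (sp q x) v) = cofq q l *: ((n + m)%:~R *: act M (sp q x) v).
  by move/(congr1 ( *:%R (cofq q l)^-1)); rewrite !scalerK.
rewrite -act_unrolled // -actMv -spM //; last exact: in_Ures_unrolled.
set cm := (cyclo_at l (tQ ^+ 2))^-1 * ((tQ ^ m) ^+ (2 * l) - 1).
have -> : unrolled_num l * x = (tQ ^ m) ^+ (2 * l) *: (x * unrolled_num l) + cm *: x.
  rewrite /unrolled_num -UL mulrBl KX mul1r -UR scalerA mulrBr mulr1 !scalerBr !scalerA.
  rewrite /cm [_^-1 * (_ - 1)]mulrBr scalerBl mulr1 mulrC.
  by rewrite [(tQ ^ m) ^+ _ * _]mulrC addrA subrK.
have hU := in_Ures_unrolled l0.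
have hxU : in_Ures (x * unrolled_num l) by apply: in_Ures_mul.
have lm : is_laurent ((tQ ^ m) ^+ (2 * l)) by rewrite exprnP exprz_exp; apply: is_laurentXz.
have lc : is_laurent cm by apply: is_laurent_unrolled_scalar.
rewrite spD; [|exact: in_Ures_laurent|exact: in_Ures_laurent].
rewrite (spZ hq lm hxU) (spZ hq lc hx) (spM q hx hU) actDv !actZv actMv act_unrolled // wH !linearZ /= !scalerA -scalerDl; congr (_ *: _).
rewrite (evq_eq (ev_unrolled hl hq hql m)) exprnP exprz_exp evq_expz //.
have -> : q ^ (m * (2 * l)%:Z) = 1.
  by rewrite mulrC -exprz_exp -[q ^ _]exprnP exprM (prim_expr_order hql) exp1rz.
by rewrite mulr1 -mulrDr -intrD mulrC.
Qed.

Lemma k_dpow (x : Ut) (m : int) b : uK * x = tQ ^ m *: (x * uK) ->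
  uK * divpow x b = tQ ^ (m * b%:Z) *: (divpow x b * uK).
Proof.
move=> h; rewrite /divpow -UR -UL scalerA mulrC -scalerA; congr (_ *: _).
elim: b => [|b IH]; first by rewrite !expr0 mulr1 mul1r mulr0 expr0z scale1r.
rewrite exprS mulrA h -UL -mulrA IH -UR !scalerA -expfzDr ?tQ_neq0 // mulrA.
by congr (_ ^ _ *: _); lia.
Qed.

Lemma wvec_E M n b (v : M) : wvec n v -> wvec (n + (2 * b)%:Z) (act M (LE q b) v).
Proof.
rewrite LE_sp PoszM; apply: wvec_shift; first exact: in_Ures_E.
exact/k_dpow/(ke_comm uKinv_K uKEKz).
Qed.

Lemma wvec_F M n b (v : M) : wvec n v -> wvec (n - (2 * b)%:Z) (act M (LF q b) v).
Proof.
rewrite LF_sp PoszM -mulNr; apply: wvec_shift; first exact: in_Ures_F.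
exact/k_dpow/(kf_comm uKinv_K uKFKz).
Qed.

Lemma act_E0 M (v : M) : act M (LE q 0) v = v.
Proof. by rewrite LE_sp divpowE dpow0 sp1 act1v. Qed.

Lemma act_F0 M (v : M) : act M (LF q 0) v = v.
Proof. by rewrite LF_sp divpowE dpow0 sp1 act1v. Qed.

Lemma act_EE M a b (v : M) :
  act M (LE q a) (act M (LE q b) v) = gqq (a + b)%:Z a *: act M (LE q (a + b)) v.
Proof.
rewrite -actMv !LE_sp -spM; [|exact: in_Ures_E|exact: in_Ures_E].
rewrite !divpowE (dpowM tQ_neq0 tQ_generic) -divpowE spZ ?actZv //.
  exact: is_laurent_gq.
exact: in_Ures_E.
Qed.

Lemma act_FF M a b (v : M) :
  act M (LF q a) (act M (LF q b) v) = gqq (a + b)%:Z a *: act M (LF q (a + b)) v.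
Proof.
rewrite -actMv !LF_sp -spM; [|exact: in_Ures_F|exact: in_Ures_F].
rewrite !divpowE (dpowM tQ_neq0 tQ_generic) -divpowE spZ ?actZv //.
  exact: is_laurent_gq.
exact: in_Ures_F.
Qed.

Definition Fsub M b d (v : M) : M := if (d <= b)%N then act M (LF q (b - d)) v else 0.
Definition Esub M b d (v : M) : M := if (d <= b)%N then act M (LE q (b - d)) v else 0.

(** E^(n - d) v has weight mu + 2(n - d); together with the shift of the bracket this makes the top
    of the q-binomial mu + n - b, independent of d. *)
Lemma act_EF M n b mu (v : M) : wvec mu v ->
  act M (LE q n) (act M (LF q b) v) =
  \sum_(d < n.+1) gqq (mu + n%:Z - b%:Z) d *: Fsub b d (act M (LE q (n - d)) v).
Proof.
move=> wv; rewrite -actMv LE_sp LF_sp -spM; [|exact: in_Ures_E|exact: in_Ures_F].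
rewrite ut_commutation sp_sum //; last first.
  move=> d _; apply: in_Ures_mul; last exact: in_Ures_E.
  by apply: in_Ures_mul; [exact: in_Ures_dpsub | exact: in_Ures_kap].
rewrite act_sumv; apply: eq_bigr => d _.
have hk := in_Ures_kap d ((2 * d)%:Z - n%:Z - b%:Z).
rewrite spM; [|by apply: in_Ures_mul => //; exact: in_Ures_dpsub|exact: in_Ures_E].
rewrite spM //; last exact: in_Ures_dpsub.
rewrite !actMv -LE_sp.
have [_ /(_ (mu + (2 * (n - d))%:Z))[_ ->]] := diag_kap hl hq hql d ((2 * d)%:Z - n%:Z - b%:Z);
  last exact: wvec_E.
rewrite linearZ /=; have dn : (d <= n)%N by rewrite -ltnS.
have -> : mu + (2 * (n - d))%:Z + ((2 * d)%:Z - n%:Z - b%:Z) = mu + n%:Z - b%:Z by lia.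
congr (_ *: _); rewrite /Fsub /dpsub; case: ifP => _; first by rewrite -divpowE -LF_sp.
by rewrite -(scale0r (1 : Ut)) spZ ?evq0 ?scale0r ?act0v //; [exact: is_laurent0 | exact: in_Ures_1].
Qed.

Lemma ut_commutation_FE n b : divpow uF n * divpow uE b =
  \sum_(d < n.+1) dpsub tQ uE b d * ((-1) ^+ d *: KAP (d%:Z - 1 - ((2 * d)%:Z - n%:Z - b%:Z)) d)
    * divpow uF (n - d).
Proof.
rewrite !divpowE (commutation tQ_neq0 tQ_generic uKinv_K uK_Kinv uKFKs uKEKs uFEEF).
by apply: eq_bigr => d _; rewrite divpowE kap_swap.
Qed.

Lemma act_FE M n b mu (v : M) : wvec mu v ->
  act M (LF q n) (act M (LE q b) v) =
  \sum_(d < n.+1) gqq (n%:Z - b%:Z - mu) d *: Esub b d (act M (LF q (n - d)) v).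
Proof.
move=> wv; rewrite -actMv LE_sp LF_sp -spM; [|exact: in_Ures_F|exact: in_Ures_E].
have hE d : in_Ures (dpsub tQ uE b d).
  rewrite /dpsub; case: ifP => _; last exact: in_Ures0.
  by rewrite -divpowE; exact: in_Ures_E.
have hk d : in_Ures ((-1) ^+ d *: KAP (d%:Z - 1 - ((2 * d)%:Z - n%:Z - b%:Z)) d).
  apply: in_Ures_laurent; last exact: in_Ures_kap.
  by have := is_laurent_int ((-1) ^+ d); rewrite rmorphXn rmorphN1.
rewrite ut_commutation_FE sp_sum //; last first.
  by move=> d _; apply: in_Ures_mul; [apply: in_Ures_mul | exact: in_Ures_F].
rewrite act_sumv; apply: eq_bigr => d _.
rewrite spM; [|exact: in_Ures_mul|exact: in_Ures_F].
rewrite spM // !actMv -LF_sp.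
have ls : is_laurent ((-1) ^+ d).
  by have := is_laurent_int ((-1) ^+ d); rewrite rmorphXn rmorphN1.
have [_ /(_ (mu - (2 * (n - d))%:Z))[_ ->]] := diagZ hq ls (diag_kap hl hq hql d (d%:Z - 1 - ((2 * d)%:Z - n%:Z - b%:Z)));
  last exact: wvec_F.
rewrite linearZ /=; have dn : (d <= n)%N by rewrite -ltnS.
rewrite [gq tQ (n%:Z - b%:Z - mu) d]gq_swap.
have -> : mu - (2 * (n - d))%:Z + (d%:Z - 1 - ((2 * d)%:Z - n%:Z - b%:Z))
  = d%:Z - 1 - (n%:Z - b%:Z - mu) by lia.
congr (_ *: _); rewrite /Esub /dpsub; case: ifP => _; first by rewrite -divpowE -LE_sp.
by rewrite -(scale0r (1 : Ut)) spZ ?evq0 ?scale0r ?act0v //; [exact: is_laurent0 | exact: in_Ures_1].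
Qed.

End WeightTheory.

(** * Weights and highest weight vectors in type I modules *)

Section TypeI.
Variables (C : numFieldType) (q : C) (l : nat).
Hypotheses (hl : (2 <= l)%N) (hq : q != 0) (hql : l.-primitive_root (q ^+ 2)).
Local Notation wvec := (@wvec C q l _).
Implicit Types M : LUmod q.

Lemma wvec0 M n : wvec n (0 : M).
Proof. by split; rewrite linear0 scaler0. Qed.

Lemma wvecZ M n c (v : M) : wvec n v -> wvec n (c *: v).
Proof. by move=> [h1 h2]; split; rewrite linearZ /= ?h1 ?h2 !scalerA mulrC. Qed.

Lemma wvecD M n (v w : M) : wvec n v -> wvec n w -> wvec n (v + w).
Proof. by move=> [h1 h2] [h3 h4]; split; rewrite linearD /= ?h1 ?h2 ?h3 ?h4 scalerDr. Qed.

Lemma wvec_sum M n I (r : seq I) (P : pred I) (F : I -> M) :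
  (forall x, P x -> wvec n (F x)) -> wvec n (\sum_(x <- r | P x) F x).
Proof. by move=> h; elim/big_ind: _ => //; [exact: wvec0 | move=> v w; apply: wvecD]. Qed.

Lemma typeI_eigen M N (wt : 'I_N -> int) (W : 'I_N -> {vspace M}) n (v : M) :
  directv (\sum_x W x)%VS -> (\sum_x W x)%VS = fullv ->
  (forall x w, w \in W x -> wvec (wt x) w) ->
  act M (LH q l) v = n%:~R *: v -> (forall x, wt x != n) -> v = 0.
Proof.
move=> dW fW wW hv ne; have : v \in (\sum_x W x)%VS by rewrite fW memvf.
move=> /memv_sumP[vs hvs ev].
have z0 x : (n%:~R - (wt x)%:~R) *: vs x = 0 :> M.
  apply: (directv_sum_independent dW (fun x => (n%:~R - (wt x)%:~R) *: vs x)) => // [y _|].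
    by rewrite memvZ ?hvs.
  transitivity (\sum_y (n%:~R *: vs y - act M (LH q l) (vs y))).
    by apply: eq_bigr => y _; have [_ ->] := wW y _ (hvs y isT); rewrite scalerBl.
  by rewrite sumrB -scaler_sumr -act_suml -ev hv subrr.
rewrite ev big1 // => x _; apply/eqP; have /eqP := z0 x.
by rewrite scaler_eq0 subr_eq0 eqr_int eq_sym (negPf (ne x)).
Qed.

Lemma typeI_bound M : typeI l M ->
  exists B : nat, forall n (v : M), wvec n v -> (B < `|n|)%N -> v = 0.
Proof.
move=> [N [wt [W [_ dW fW wW]]]]; exists (\max_(x < N) `|wt x|)%N => n v [_ hv] hn.
apply: (typeI_eigen (wt := wt) dW fW _ hv) => [x w /wW[? ?]|x]; first by split.
apply: contraTneq hn => <-; rewrite -leqNgt.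
exact: (leq_bigmax (F := fun x : 'I_N => `|wt x|%N)).
Qed.

(** A Lagrange interpolation polynomial in H at the weights of M. Being an element of the algebra,
    it commutes with homomorphisms and fixes the eigenvectors of H for n in every other module
    too. *)
Lemma weight_proj M (n : int) : typeI l M -> exists p : LU q,
  (forall (N : LUmod q) (v : N), act N (LH q l) v = n%:~R *: v -> act N p v = v) /\
  (forall v : M, wvec n (act M p v)).
Proof.
move=> [N [wt [W [iwt dW fW wW]]]].
pose p := \prod_(x < N | wt x != n) (((n - wt x)%:~R)^-1 *: (LH q l - (wt x)%:~R *: (1 : LU q))).
have ap (M' : LUmod q) (m : int) (v : M') : act M' (LH q l) v = m%:~R *: v ->
    act M' p v = \prod_(x < N | wt x != n) (((n - wt x)%:~R)^-1 * (m - wt x)%:~R) *: v.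
  move=> hv; rewrite /p; elim/big_rec2: _ => [|x a b _ IH]; first by rewrite act1v scale1r.
  rewrite actMv IH linearZ /= actZv actBv hv actZv act1v -scalerBl -rmorphB !scalerA.
  by congr (_ *: _); ring.
exists p; split=> [N' v hv|v].
  rewrite (ap _ _ _ hv) big1 ?scale1r // => x xn.
  by rewrite mulVf // intr_eq0 subr_eq0 eq_sym.
have : v \in (\sum_x W x)%VS by rewrite fW memvf.
move=> /memv_sumP[vs hvs ->]; rewrite act_suml; apply: wvec_sum => x _.
have wx : wvec (wt x) (vs x) by have [] := wW x _ (hvs x isT).
have [e|ne] := eqVneq (wt x) n; first by rewrite (ap _ n _) -?e; [apply: wvecZ | case: wx].
rewrite (ap _ (wt x)); last by case: wx.
by rewrite (bigD1 x) //= subrr mulr0 mul0r scale0r; apply: wvec0.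
Qed.

(* Descending induction on P from the weight bound: with mu = 2P - i the vector w = F^(P) Y has
   weight -mu, so F^(mu) E^(mu) w = w modulo the F^(n) w with n > 0. *)
Lemma weyl_vanish M (U : {vspace M}) (i : nat) (Y : M) : typeI l M -> stable U ->
  wvec i%:Z Y -> (forall v, (0 < v)%N -> act M (LE q v) Y \in U) ->
  forall P, (i < P)%N -> act M (LF q P) Y \in U.
Proof.
move=> /typeI_bound[B hB] sU wY hE.
suff H m P : (i < P)%N -> (B + i < P + m)%N -> act M (LF q P) Y \in U.
  by move=> P iP; apply: (H (B + i).+1) => //; rewrite addnS ltnS leq_addl.
elim: m P => [|m IH] P iP hP.
  rewrite (hB _ _ (wvec_F hl hq hql P wY)) ?mem0v //; lia.
set w := act M (LF q P) Y; have ww : wvec (i%:Z - (2 * P)%:Z) w by apply: wvec_F.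
have hF n : (0 < n)%N -> act M (LF q n) w \in U.
  by move=> n0; rewrite /w act_FF // memvZ // IH; lia.
pose mu := (2 * P - i)%N; have muP : (P < mu)%N by rewrite /mu; lia.
(* Each term contains E^(mu - d) Y with d <= P < mu, so a positive divided power is applied to Y. *)
have h1 : act M (LE q mu) w \in U.
  rewrite /w (act_EF hl hq hql _ _ wY); apply: rpred_sum => d _; apply: memvZ.
  rewrite /Fsub; case: leqP => dP; last exact: mem0v.
  by apply/sU/hE; rewrite subn_gt0 (leq_ltn_trans dP).
have := sU (LF q mu) _ h1; rewrite (act_FE hl hq hql _ _ ww) big_ord_recr /=.
rewrite /Esub leqnn subnn act_E0 act_F0 (_ : mu%:Z - mu%:Z - (i%:Z - (2 * P)%:Z) = mu%:Z); last first.
  by rewrite /mu; lia.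
rewrite (gq_diag tQ_neq0 tQ_generic) evq1 scale1r => h.
set S := \sum_(x < mu) _ in h; have hS : S \in U.
  apply: rpred_sum => d _; apply: memvZ; rewrite /= ltnW ?ltn_ord //.
  by apply/sU/hF; rewrite subn_gt0.
by have := rpredB h hS; rewrite [S + w]addrC addrK.
Qed.

End TypeI.

Lemma lfD (F : fieldType) (U V : vectType F) (A : 'Hom(U, V)) x y : A (x + y) = A x + A y.
Proof. exact: linearD. Qed.

Lemma lfZ (F : fieldType) (U V : vectType F) (A : 'Hom(U, V)) c x : A (c *: x) = c *: A x.
Proof. exact: linearZ. Qed.

(** * The generic tilting module and its specialization *)

Section BasisVectors.
Variables (F : fieldType) (i j : nat).

(** The vector [bvec] over an arbitrary field, so that the module over Q(t) and its specialization
    have the same basis; over C the two are convertible. *)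
Definition bv (d : nat) (k : int) : 'rV[F]_d.+1 :=
  if (0 <= k) && (k <= d%:Z) then delta_mx 0 (inord `|k|%N) else 0.

Definition TV : vectType F := ('rV[F]_j.+1 * 'rV[F]_i.+1)%type.
Definition mv (k : int) : TV := (bv j k, 0).
Definition nv (p : int) : TV := (0, bv i p).

Lemma bv_ord d (k : 'I_d.+1) : bv d k = delta_mx 0 k.
Proof. by rewrite /bv /= lez_nat -ltnS ltn_ord inord_val. Qed.

Lemma bv_out d k : ~~ (0 <= k <= d%:Z) -> bv d k = 0.
Proof. by rewrite /bv => /negPf->. Qed.

Lemma mv_out k : ~~ (0 <= k <= j%:Z) -> mv k = 0.
Proof. by move=> h; rewrite /mv bv_out. Qed.

Lemma nv_out k : ~~ (0 <= k <= i%:Z) -> nv k = 0.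
Proof. by move=> h; rewrite /nv bv_out. Qed.

Lemma TV_basis (x : TV) :
  x = \sum_(k < j.+1) x.1 0 k *: mv k + \sum_(p < i.+1) x.2 0 p *: nv p.
Proof.
have e1 (s : 'I_j.+1 -> F) : \sum_k s k *: mv k = (\sum_k s k *: delta_mx 0 k, 0).
  rewrite (big_morph (fun y : 'rV[F]_j.+1 => (y, 0) : TV) (id1 := 0) (op1 := +%R)) //; last first.
    by move=> y z; congr pair; rewrite /= addr0.
  by apply: eq_bigr => k _; rewrite /mv bv_ord; congr pair; rewrite /= scaler0.
have e2 (s : 'I_i.+1 -> F) : \sum_k s k *: nv k = (0, \sum_k s k *: delta_mx 0 k).
  rewrite (big_morph (fun y : 'rV[F]_i.+1 => (0, y) : TV) (id1 := 0) (op1 := +%R)) //; last first.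
    by move=> y z; congr pair; rewrite /= addr0.
  by apply: eq_bigr => k _; rewrite /nv bv_ord; congr pair; rewrite /= scaler0.
rewrite e1 e2 -!row_sum_delta; case: x => y z /=.
by congr pair; rewrite /= ?addr0 ?add0r.
Qed.

Fact basis_op_linear (f : 'I_j.+1 -> TV) (g : 'I_i.+1 -> TV) :
  linear (fun x : TV => \sum_k x.1 0 k *: f k + \sum_p x.2 0 p *: g p).
Proof.
move=> c x y; rewrite scalerDr !scaler_sumr addrACA -!big_split.
by congr (_ + _); apply: eq_bigr => k _; rewrite /= !mxE scalerDl scalerA.
Qed.

Definition basis_op f g : 'End(TV) := sval (lfun_of_linear (basis_op_linear f g)).

Lemma basis_opE f g x : basis_op f g x = \sum_k x.1 0 k *: f k + \sum_p x.2 0 p *: g p.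
Proof. exact: (svalP (lfun_of_linear (basis_op_linear f g))). Qed.

Lemma basis_op_m f g k : basis_op f g (mv (k : 'I_j.+1)) = f k.
Proof.
rewrite basis_opE /mv /= [X in _ + X]big1 ?addr0; last by move=> p _; rewrite mxE scale0r.
rewrite (bigD1 k) //= bv_ord mxE !eqxx scale1r big1 ?addr0 // => k' ne.
by rewrite mxE (negPf ne) andbF scale0r.
Qed.

Lemma basis_op_n f g p : basis_op f g (nv (p : 'I_i.+1)) = g p.
Proof.
rewrite basis_opE /nv /= [X in X + _]big1 ?add0r; last by move=> k _; rewrite mxE scale0r.
rewrite (bigD1 p) //= bv_ord mxE !eqxx scale1r big1 ?addr0 // => k' ne.
by rewrite mxE (negPf ne) andbF scale0r.
Qed.

Lemma TV_lfunP (V : vectType F) (A B : 'Hom(TV, V)) :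
  (forall k : nat, (k <= j)%N -> A (mv k) = B (mv k)) ->
  (forall p : nat, (p <= i)%N -> A (nv p) = B (nv p)) -> A = B.
Proof.
move=> hm hn; apply/lfunP => x; rewrite (TV_basis x) !linearD !linear_sum /=.
by congr (_ + _); apply: eq_bigr => k _; rewrite !linearZ /= ?hm ?hn // -ltnS.
Qed.

End BasisVectors.

Section GenericTilting.
Variables (F : fieldType) (t : F).
Hypotheses (t0 : t != 0) (tgen : forall n, (0 < n)%N -> t ^+ (n * 2) != 1).
Variables i a : nat.
Hypothesis a0 : (0 < a)%N.
Local Notation j := (i + 2 * a)%N.
Local Notation V := (TV F i j).
Local Notation mv := (@mv F i j).
Local Notation nv := (@nv F i j).
Local Notation qn := (qint t).
Let t1 := generic_subV_neq0 t0 tgen.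

(** [gcoef p] is gamma_{p,1} and [wcoef] is omega_{i,1} before the limit; in the latter
    [i + 1 choose 1] has been absorbed and 1/[N] cancelled. *)
Definition gcoef (x : int) : F := qbin t (a%:Z + x - 1) x.
Definition wcoef : F := gq t (a + i)%:Z i.

Definition opK (c : int) : 'End(V) :=
  basis_op (fun k : 'I_j.+1 => t ^ (c * (j%:Z - (2 * k)%:Z)) *: mv k)
           (fun p : 'I_i.+1 => t ^ (c * (i%:Z - (2 * p)%:Z)) *: nv p).

Definition opE : 'End(V) :=
  basis_op (fun k : 'I_j.+1 => qn (j%:Z - k%:Z + 1) *: mv (k%:Z - 1))
           (fun p : 'I_i.+1 => qn (i%:Z - p%:Z + 1) *: nv (p%:Z - 1)
                                + gcoef p *: mv (p%:Z + a%:Z - 1)).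

Definition opF : 'End(V) :=
  basis_op (fun k : 'I_j.+1 => qn (k%:Z + 1) *: mv (k%:Z + 1))
           (fun p : 'I_i.+1 => qn (p%:Z + 1) *: nv (p%:Z + 1)
              + (if p == i :> nat then wcoef else 0) *: mv (p%:Z + a%:Z + 1)).

Lemma range_nat (d : nat) (x : int) : 0 <= x <= d%:Z -> exists2 k : nat, (k <= d)%N & x = k.
Proof. by case: x => // n h; exists n => //; lia. Qed.

Lemma opK_m c x : opK c (mv x) = t ^ (c * (j%:Z - 2 * x)) *: mv x.
Proof.
have [/range_nat[k kj ->]|h] := boolP (0 <= x <= j%:Z).
  rewrite -ltnS in kj; rewrite (basis_op_m _ _ (Ordinal kj)) /=.
  by congr (_ ^ (_ * _) *: _); lia.
by rewrite mv_out // linear0 scaler0.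
Qed.

Lemma opK_n c x : opK c (nv x) = t ^ (c * (i%:Z - 2 * x)) *: nv x.
Proof.
have [/range_nat[k kj ->]|h] := boolP (0 <= x <= i%:Z).
  rewrite -ltnS in kj; rewrite (basis_op_n _ _ (Ordinal kj)) /=.
  by congr (_ ^ (_ * _) *: _); lia.
by rewrite nv_out // linear0 scaler0.
Qed.

Lemma opE_m x : opE (mv x) = qn (j%:Z - x + 1) *: mv (x - 1).
Proof.
have [/range_nat[k kj ->]|h] := boolP (0 <= x <= j%:Z).
  by rewrite -ltnS in kj; rewrite (basis_op_m _ _ (Ordinal kj)).
rewrite mv_out // linear0; have [->|ne] := eqVneq x (j%:Z + 1).
  by rewrite (_ : j%:Z - (j%:Z + 1) + 1 = 0) ?qint0 ?scale0r //; lia.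
by rewrite mv_out ?scaler0 //; lia.
Qed.

Lemma opF_m x : opF (mv x) = qn (x + 1) *: mv (x + 1).
Proof.
have [/range_nat[k kj ->]|h] := boolP (0 <= x <= j%:Z).
  by rewrite -ltnS in kj; rewrite (basis_op_m _ _ (Ordinal kj)).
rewrite mv_out // linear0; have [->|ne] := eqVneq x (- 1).
  by rewrite addNr qint0 scale0r.
by rewrite mv_out ?scaler0 //; lia.
Qed.

Lemma gcoef_neg x : x < 0 -> gcoef x = 0.
Proof. by move=> x0; rewrite /gcoef /qbin leNgt x0. Qed.

Lemma opE_n x : x <= i%:Z ->
  opE (nv x) = qn (i%:Z - x + 1) *: nv (x - 1) + gcoef x *: mv (x + a%:Z - 1).
Proof.
move=> xi; have [/range_nat[k kj ->]|h] := boolP (0 <= x <= i%:Z).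
  by rewrite -ltnS in kj; rewrite (basis_op_n _ _ (Ordinal kj)).
rewrite nv_out // linear0 nv_out ?gcoef_neg ?scale0r ?scaler0 ?addr0 //; lia.
Qed.

Lemma opF_n x : x < i%:Z -> opF (nv x) = qn (x + 1) *: nv (x + 1).
Proof.
move=> xi; have [/range_nat[k kj ek]|h] := boolP (0 <= x <= i%:Z).
  rewrite ek -ltnS in kj xi *; rewrite (basis_op_n _ _ (Ordinal kj)) /= ltn_eqF; last lia.
  by rewrite scale0r addr0.
rewrite nv_out // linear0; have [->|ne] := eqVneq x (- 1).
  by rewrite addNr qint0 scale0r.
by rewrite nv_out ?scaler0 //; lia.
Qed.

Lemma opF_ni : opF (nv i) = wcoef *: mv (i%:Z + a%:Z + 1).
Proof.
rewrite (basis_op_n _ _ (Ordinal (ltnSn i))) /= eqxx nv_out ?scaler0 ?add0r //; lia.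
Qed.

(** For p < i this is the vanishing of the m-component of (EF - FE) n_p; [wcoefE] is the case p =
    i. *)
Lemma gcoefS (p : nat) : qn (p%:Z + 1) * gcoef (p%:Z + 1) = qn (p%:Z + a%:Z) * gcoef p.
Proof.
have -> : gcoef (p%:Z + 1) = gq t (a + p)%:Z p.+1.
  by rewrite -(gq_qbin t0 tgen) /gcoef; congr qbin; lia.
have -> : gcoef p = gq t ((a + p)%:Z - 1) p.
  rewrite (_ : (a + p)%:Z - 1 = (a + p).-1%:Z); last lia.
  by rewrite -(gq_qbin t0 tgen) /gcoef; congr qbin; lia.
have h : qn p.+1 != 0 by apply: (qint_neq0 t0 tgen).
rewrite gqS (_ : p%:Z + 1 = p.+1%:Z); last lia.
by rewrite mulrA mulfV // mul1r; congr (qn _ * _); lia.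
Qed.

Lemma wcoefE : qn a%:Z * wcoef = qn (i%:Z + a%:Z) * gcoef i.
Proof.
have -> : gcoef i = gq t ((a + i)%:Z - 1) i.
  rewrite (_ : (a + i)%:Z - 1 = (a + i).-1%:Z); last lia.
  by rewrite -(gq_qbin t0 tgen) /gcoef; congr qbin; lia.
have h : qn i.+1 != 0 by apply: (qint_neq0 t0 tgen).
apply: (mulfI (invr_neq0 h)); rewrite (_ : i%:Z + a%:Z = (a + i)%:Z); last lia.
by rewrite -gqS gqSr; congr (_ * (qn _ * _)); lia.
Qed.

Lemma qint_comm (x y : int) : qn (x + 1) * qn y - qn (y + 1) * qn x = qn (y - x).
Proof.
rewrite -(qint_cross t0 (x + 1) y x) (_ : x + 1 - x = 1); last lia.
by rewrite (qint1 t1) mul1r (_ : x + 1 + y - x = y + 1) ?addrK //; lia.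
Qed.

Lemma qint_sub (n : int) : (t - t^-1)^-1 * (t ^ (1 * n) - t ^ (-1 * n)) = qn n.
Proof. by rewrite mul1r mulN1r mulrC. Qed.

Lemma op_EF : (opE \o opF)%VF - (opF \o opE)%VF = (t - t^-1)^-1 *: (opK 1 - opK (-1)).
Proof.
apply: TV_lfunP => [k kj|p pi].
  rewrite scale_lfunE !add_lfunE !opp_lfunE !comp_lfunE opF_m opE_m !lfZ opE_m opF_m.
  rewrite !opK_m -scalerBl !scalerA qint_sub subrK addrK -scalerBl; congr (_ *: _).
  rewrite (_ : j%:Z - 2 * k%:Z = j%:Z - k%:Z - k%:Z); last lia.
  by rewrite -qint_comm; congr (_ * qn _ - _); lia.
rewrite scale_lfunE !add_lfunE !opp_lfunE !comp_lfunE !opK_n -scalerBl scalerA qint_sub.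
have -> : opF (opE (nv p)) = (qn (i%:Z - p%:Z + 1) * qn p) *: nv p
    + (qn (p%:Z + a%:Z) * gcoef p) *: mv (p%:Z + a%:Z).
  rewrite opE_n; last lia.
  rewrite lfD !lfZ opF_m opF_n; last lia.
  rewrite !scalerA subrK (_ : p%:Z + a%:Z - 1 + 1 = p%:Z + a%:Z); last lia.
  by rewrite (mulrC (gcoef p)).
have [pi'|] := boolP (p != i); last first.
  rewrite negbK => /eqP->; rewrite opF_ni lfZ opE_m addrK !scalerA.
  rewrite (_ : j%:Z - (i%:Z + a%:Z + 1) + 1 = a%:Z); last lia.
  rewrite (_ : i%:Z - i%:Z + 1 = 1); last lia.
  rewrite (mulrC wcoef) wcoefE opprD addrCA subrr addr0.
  by rewrite (qint1 t1) mul1r -scaleNr -qintN; congr (qn _ *: _); lia.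
rewrite opF_n; last lia.
rewrite lfZ opE_n; last lia.
rewrite scalerDr !scalerA addrK gcoefS (opprD (_ *: _)).
rewrite (_ : p%:Z + 1 + a%:Z - 1 = p%:Z + a%:Z); last lia.
rewrite addrACA subrr addr0 -scalerBl; congr (_ *: _).
rewrite (_ : i%:Z - 2 * p%:Z = i%:Z - p%:Z - p%:Z); last lia.
by rewrite -qint_comm; congr (_ * qn _ - _); lia.
Qed.

Lemma op_KK c : (opK c \o opK (- c))%VF = \1%VF.
Proof.
have e (n : int) : t ^ (- c * n) * t ^ (c * n) = 1 by rewrite mulNr mulrC -expfzDr // subrr expr0z.
by apply: TV_lfunP => [k kj|p pi]; rewrite comp_lfunE id_lfunE ?opK_m ?opK_n lfZ
  ?opK_m ?opK_n scalerA e scale1r.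
Qed.

Lemma op_KEK : (opK 1 \o opE \o opK (-1))%VF = t ^ 2 *: opE.
Proof.
apply: TV_lfunP => [k kj|p pi]; rewrite !comp_lfunE scale_lfunE.
  rewrite opK_m lfZ opE_m !lfZ opK_m !scalerA.
  by rewrite mulrAC -expfzDr //; congr (_ ^ _ * _ *: _); lia.
rewrite opK_n lfZ opE_n; last lia.
rewrite !lfZ lfD !lfZ opK_m opK_n !scalerDr !scalerA.
by congr (_ *: _ + _ *: _); rewrite mulrAC -expfzDr //; congr (_ ^ _ * _); lia.
Qed.

Lemma op_KFK : (opK 1 \o opF \o opK (-1))%VF = t ^ (-2) *: opF.
Proof.
apply: TV_lfunP => [k kj|p pi]; rewrite !comp_lfunE scale_lfunE.
  rewrite opK_m lfZ opF_m !lfZ opK_m !scalerA.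
  by rewrite mulrAC -expfzDr //; congr (_ ^ _ * _ *: _); lia.
rewrite opK_n lfZ; have [pi'|] := boolP (p != i); last first.
  rewrite negbK => /eqP->; rewrite opF_ni !lfZ opK_m !scalerA.
  by rewrite mulrAC -expfzDr //; congr (_ ^ _ * _ *: _); lia.
rewrite opF_n; last lia.
rewrite !lfZ opK_n !scalerA.
by rewrite mulrAC -expfzDr //; congr (_ ^ _ * _ *: _); lia.
Qed.

Lemma prod_qint_up (c : int) v : \prod_(1 <= b < v.+1) qn (c + b%:Z) = qfact t v * gq t (c + v%:Z) v.
Proof.
elim: v => [|v IH]; first by rewrite big_geq // qfact0 mulr1.
rewrite big_nat_recr //= IH qfactS -[_^-1 * _]/(gq t (c + v.+1%:Z) v.+1) gqS.
rewrite (_ : c + v.+1%:Z - 1 = c + v%:Z); last lia.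
have h : qn v.+1 != 0 by apply: (qint_neq0 t0 tgen).
by field.
Qed.

(** [gamF] and [omF] are the functions of t whose limits at q are gamma and omega, written with a =
    l - s - 1. *)
Definition gamF (p v : nat) : F := (qfact t v)^-1 * \sum_(0 <= u < v)
  gcoef (p%:Z - u%:Z) * (\prod_(1 <= b < u.+1) qn (i%:Z - p%:Z + b%:Z)) *
  (\prod_(u.+1 <= b < v) qn (i%:Z + a%:Z + 1 - p%:Z + b%:Z)).

Definition omF (p v : nat) : F :=
  (qn (a%:Z + i%:Z + 1))^-1 * gq t (a + p + v)%:Z (p + v) * gq t (p + v)%:Z v.

(** The recursion that E E^(v) = [v + 1] E^(v+1) imposes on the m-component of E^(v) n_p. *)
Lemma gamFS p v : gamF p v.+1 = (qn v.+1)^-1 *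
  (qn (i%:Z + a%:Z + 1 - p%:Z + v%:Z) * gamF p v + gq t (i%:Z - p%:Z + v%:Z) v * gcoef (p%:Z - v%:Z)).
Proof.
rewrite /gamF big_nat_recr //= prod_qint_up [\prod_(v.+1 <= b < v.+1) _]big_geq // mulr1 qfactS.
have -> : \sum_(0 <= u < v) gcoef (p%:Z - u%:Z) * (\prod_(1 <= b < u.+1) qn (i%:Z - p%:Z + b%:Z)) *
    (\prod_(u.+1 <= b < v.+1) qn (i%:Z + a%:Z + 1 - p%:Z + b%:Z))
  = (\sum_(0 <= u < v) gcoef (p%:Z - u%:Z) * (\prod_(1 <= b < u.+1) qn (i%:Z - p%:Z + b%:Z)) *
    (\prod_(u.+1 <= b < v) qn (i%:Z + a%:Z + 1 - p%:Z + b%:Z))) * qn (i%:Z + a%:Z + 1 - p%:Z + v%:Z).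
  rewrite mulr_suml; apply: eq_big_nat => u /andP[_ uv].
  by rewrite [\prod_(u.+1 <= b < v.+1) _]big_nat_recr //= !mulrA.
have h : qn v.+1 != 0 by apply: (qint_neq0 t0 tgen).
have h' : qfact t v != 0 by apply: (qfact_neq0 t0 tgen).
by field; rewrite h h'.
Qed.

Section DividedPowers.
Variables dE dF : nat -> 'End(V).
Hypothesis dE0 : dE 0%N = \1%VF.
Hypothesis dF0 : dF 0%N = \1%VF.
Hypothesis dES : forall v x, dE v.+1 x = (qn v.+1)^-1 *: opE (dE v x).
Hypothesis dFS : forall v x, dF v.+1 x = (qn v.+1)^-1 *: opF (dF v x).

Lemma dE_m v x : dE v (mv x) = gq t (j%:Z - x + v%:Z) v *: mv (x - v%:Z).
Proof.
elim: v => [|v IH]; first by rewrite dE0 id_lfunE /= scale1r subr0.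
rewrite dES IH lfZ opE_m !scalerA gqS.
rewrite (_ : j%:Z - x + v.+1%:Z - 1 = j%:Z - x + v%:Z); last lia.
rewrite (_ : x - v%:Z - 1 = x - v.+1%:Z); last lia.
rewrite (_ : j%:Z - (x - v%:Z) + 1 = j%:Z - x + v.+1%:Z); last lia.
by congr (_ *: _); ring.
Qed.

Lemma dF_m v x : dF v (mv x) = gq t (x + v%:Z) v *: mv (x + v%:Z).
Proof.
elim: v => [|v IH]; first by rewrite dF0 id_lfunE /= scale1r addr0.
rewrite dFS IH lfZ opF_m !scalerA gqS.
rewrite (_ : x + v.+1%:Z - 1 = x + v%:Z); last lia.
rewrite (_ : x + v%:Z + 1 = x + v.+1%:Z); last lia.
by congr (_ *: _); ring.
Qed.

Lemma dE_n v (p : nat) : (p <= i)%N -> dE v (nv p) =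
  gq t (i%:Z - p%:Z + v%:Z) v *: nv (p%:Z - v%:Z) + gamF p v *: mv (p%:Z + a%:Z - v%:Z).
Proof.
move=> pi; elim: v => [|v IH].
  by rewrite dE0 id_lfunE /= scale1r subr0 /gamF big_geq // mulr0 scale0r addr0.
rewrite dES IH lfD !lfZ opE_m opE_n; last lia.
rewrite !scalerDr !scalerA gqS gamFS -addrA.
rewrite (_ : i%:Z - p%:Z + v.+1%:Z - 1 = i%:Z - p%:Z + v%:Z); last lia.
rewrite (_ : p%:Z - v%:Z - 1 = p%:Z - v.+1%:Z); last lia.
rewrite (_ : p%:Z - v%:Z + a%:Z - 1 = p%:Z + a%:Z - v.+1%:Z); last lia.
rewrite (_ : p%:Z + a%:Z - v%:Z - 1 = p%:Z + a%:Z - v.+1%:Z); last lia.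
rewrite (_ : i%:Z - (p%:Z - v%:Z) + 1 = i%:Z - p%:Z + v.+1%:Z); last lia.
rewrite (_ : j%:Z - (p%:Z + a%:Z - v%:Z) + 1 = i%:Z + a%:Z + 1 - p%:Z + v%:Z); last lia.
rewrite -scalerDl; by congr (_ *: _ + _ *: _); ring.
Qed.

Lemma dF_n v (p : nat) : (p <= i)%N -> dF v (nv p) =
  gq t (p + v)%:Z v *: nv (p + v)%:Z
  + (if (i < p + v)%N then omF p v else 0) *: mv (p + a + v)%:Z.
Proof.
move=> pi; elim: v => [|v IH].
  by rewrite dF0 id_lfunE addn0 /= scale1r ltnNge pi scale0r addr0.
rewrite dFS IH; have hv : qn v.+1 != 0 by apply: (qint_neq0 t0 tgen).
have gS : gq t (p + v.+1)%:Z v.+1 = (qn v.+1)^-1 * (qn (p + v).+1 * gq t (p + v)%:Z v).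
  by rewrite gqS addnS (_ : (p + v).+1%:Z - 1 = (p + v)%:Z) //; lia.
have gaS : gq t (a + p + v.+1)%:Z (p + v.+1)
    = (qn (p + v).+1)^-1 * (qn (a + p + v).+1 * gq t (a + p + v)%:Z (p + v)).
  by rewrite !addnS gqS (_ : (a + p + v).+1%:Z - 1 = (a + p + v)%:Z) //; lia.
(* As long as p + v < i the vector stays among the n's, and beyond i it stays among the m's. The
   coefficient [wcoef] enters only at the passage p + v = i. *)
have [h1|h1|h1] := ltngtP (p + v)%N i.
- rewrite scale0r addr0 lfZ opF_n; last lia.
  rewrite (_ : (i < p + v.+1)%N = false); last lia.
  rewrite scale0r addr0 !scalerA gS (_ : (p + v)%:Z + 1 = (p + v).+1%:Z); last lia.
  by rewrite addnS; congr (_ *: _); ring.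
- rewrite nv_out ?scaler0 ?add0r; last lia.
  rewrite [nv (p + v.+1)%N]nv_out ?scaler0 ?add0r; last lia.
  rewrite (_ : (i < p + v.+1)%N); last lia.
  rewrite lfZ opF_m !scalerA (_ : (p + a + v)%:Z + 1 = (p + a + v.+1)%:Z); last lia.
  congr (_ *: _); rewrite /omF gS gaS.
  have hp : qn (p + v).+1 != 0 by apply: (qint_neq0 t0 tgen).
  have hN : qn (a%:Z + i%:Z + 1) != 0 by apply: (qint_neq0 t0 tgen); lia.
  rewrite (_ : (p + a + v.+1)%:Z = (a + p + v).+1%:Z); last lia.
  by field; rewrite hv hp hN.
rewrite h1 (_ : (i < p + v.+1)%N); last lia.
rewrite scale0r addr0 lfZ opF_ni [nv (p + v.+1)%N]nv_out ?scaler0 ?add0r; last lia.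
rewrite !scalerA (_ : i%:Z + a%:Z + 1 = (p + a + v.+1)%:Z); last lia.
congr (_ *: _); rewrite /omF gS gaS h1 /wcoef (_ : (a + p + v)%N = (a + i)%N); last lia.
have hp : qn i.+1 != 0 by apply: (qint_neq0 t0 tgen).
have hN : qn (a%:Z + i%:Z + 1) != 0 by apply: (qint_neq0 t0 tgen); lia.
rewrite (_ : (a + i).+1%:Z = a%:Z + i%:Z + 1); last lia.
by field; rewrite hv hp hN.
Qed.

Lemma opK_dE_n c v (p : nat) : (p <= i)%N -> opK c (dE v (nv p))
  = t ^ (c * (i%:Z - 2 * p%:Z + 2 * v%:Z)) *: dE v (nv p).
Proof.
move=> pi; rewrite (dE_n v pi) lfD !lfZ opK_m opK_n scalerDr !scalerA.
by congr (_ *: _ + _ *: _); rewrite mulrC; congr (_ ^ (_ * _) * _); lia.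
Qed.

End DividedPowers.

End GenericTilting.

Lemma scale1_comp (F : fieldType) (V : vectType F) (A : 'End(V)) c :
  ((c *: \1) \o A)%VF = c *: A.
Proof. by rewrite -comp_lfunZl comp_lfun1l. Qed.

Lemma sub_rel_op (F : fieldType) (V : vectType F) (A B D E : 'End(V)) (u : F) :
  u != 0 -> A - B = u^-1 *: (D - E) ->
  D + ((-1 *: \1) \o E)%VF = ((u *: \1) \o (A + ((-1 *: \1) \o B)))%VF.
Proof. by move=> u0 e; rewrite !scale1_comp !scaleN1r e scalerA mulfV ?scale1r. Qed.

Lemma kap_action (F : fieldType) (t : F) (X : Type) (rels : nc_expr F X -> nc_expr F X -> Prop)
    (M : fdmod rels) (k ki : presAlg rels) (n c : int) d (v : M) : t != 0 ->
  act M k v = t ^ n *: v -> act M ki v = t ^ (- n) *: v ->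
  act M (kap t k ki c d) v = gq t (n + c) d *: v.
Proof.
move=> t0 hK hKi; elim: d c => [|d IH] c; first by rewrite scale1r -[RHS](act1v (M := M)).
rewrite kapS actZv actMv IH lfZ kbrE actZv actBv !actZv hK hKi !scalerA -scalerBl !scalerA.
rewrite gqS (_ : n + (c - 1) = n + c - 1); last lia.
rewrite /qint -!expfzDr // (_ : - c + - n = - (n + c)) ?(addrC c n); last lia.
by congr (_ *: _); ring.
Qed.

Section GenericModule.
Variables i a : nat.
Hypothesis a0 : (0 < a)%N.
Local Notation j := (i + 2 * a)%N.
Local Notation V := (TV Qt i j).

Definition gen_op (g : uq_gen) : 'End(V) :=
  match g with
  | GE => opE tQ i a | GF => opF tQ i a | GK => opK tQ i a 1 | GKinv => opK tQ i a (-1)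
  end.

Fact gen_op_rel x y : uq_rel x y -> expr_op gen_op x = expr_op gen_op y.
Proof.
case=> /=.
- by rewrite scale1_comp; exact: (op_KEK tQ_neq0 tQ_generic i a0).
- by rewrite scale1_comp; exact: (op_KFK tQ_neq0 tQ_generic i a0).
- by rewrite scale1r; exact: (op_KK tQ_neq0 i a 1).
- by rewrite scale1r; have := op_KK tQ_neq0 i a (-1); rewrite opprK.
exact: sub_rel_op tQ_sub_neq0 (op_EF tQ_neq0 tQ_generic i a0).
Qed.

Definition genT : module_on uq_rel V := gen_module gen_op_rel.
Definition GT : fdmod uq_rel := FdMod genT.

Lemma GTE u v : act GT u v = genT u v. Proof. by []. Qed.

Lemma genT_E : genT uE = opE tQ i a. Proof. exact: gen_module_gen. Qed.
Lemma genT_F : genT uF = opF tQ i a. Proof. exact: gen_module_gen. Qed.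
Lemma genT_K : genT uK = opK tQ i a 1. Proof. exact: gen_module_gen. Qed.
Lemma genT_Ki : genT uKinv = opK tQ i a (-1). Proof. exact: gen_module_gen. Qed.

Lemma genT_dpow0 x : genT (divpow x 0) = \1%VF.
Proof. by rewrite divpowE dpow0 action1. Qed.

Lemma genT_dpowS x v y :
  genT (divpow x v.+1) y = (qint tQ v.+1)^-1 *: genT x (genT (divpow x v) y).
Proof.
rewrite -[genT x _]comp_lfunE -actionM !divpowE (dpowS tQ_neq0 tQ_generic) actionZ scale_lfunE.
by rewrite scalerA mulVf ?scale1r // qintQ_neq0.
Qed.

Let dES v y : genT (divpow uE v.+1) y = (qint tQ v.+1)^-1 *: opE tQ i a (genT (divpow uE v) y).
Proof. by rewrite genT_dpowS genT_E. Qed.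
Let dFS v y : genT (divpow uF v.+1) y = (qint tQ v.+1)^-1 *: opF tQ i a (genT (divpow uF v) y).
Proof. by rewrite genT_dpowS genT_F. Qed.

Definition genE_m := dE_m tQ_neq0 tQ_generic a0 (genT_dpow0 uE) dES.
Definition genF_m := dF_m tQ_neq0 tQ_generic a0 (genT_dpow0 uF) dFS.
Definition genE_n := dE_n tQ_neq0 tQ_generic a0 (genT_dpow0 uE) dES.
Definition genF_n := dF_n tQ_neq0 tQ_generic a0 (genT_dpow0 uF) dFS.
Definition genK_En := opK_dE_n tQ_neq0 tQ_generic a0 (genT_dpow0 uE) dES.

End GenericModule.

(** * The lattice of vectors regular at q and its specialization *)

Section RegularVectors.
Variables (C : numFieldType) (q : C).
Variables i j : nat.
Local Notation VQ := (TV Qt i j).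
Local Notation VC := (TV C i j).
Local Notation reg := (reg q).
Local Notation evq := (evq q).

Definition regv (x : VQ) : Prop := (forall k, reg (x.1 0 k)) /\ (forall p, reg (x.2 0 p)).
Definition sv (x : VQ) : VC := (\row_k evq (x.1 0 k), \row_p evq (x.2 0 p)).

Lemma regv0 : regv 0.
Proof. by split=> k; rewrite mxE; apply: reg0. Qed.

Lemma regvD x y : regv x -> regv y -> regv (x + y).
Proof. by move=> [h1 h2] [h3 h4]; split=> k; rewrite mxE; apply: regD. Qed.

Lemma regvZ c x : reg c -> regv x -> regv (c *: x).
Proof. by move=> hc [h1 h2]; split=> k; rewrite mxE; apply: regM. Qed.

Lemma regv_sum I (r : seq I) (P : pred I) (F : I -> VQ) :
  (forall x, P x -> regv (F x)) -> regv (\sum_(x <- r | P x) F x).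
Proof. by move=> h; elim/big_ind: _ => //; [exact: regv0 | exact: regvD]. Qed.

Lemma sv0 : sv 0 = 0.
Proof. by congr pair; apply/rowP => k; rewrite !mxE evq0. Qed.

Lemma svD x y : regv x -> regv y -> sv (x + y) = sv x + sv y.
Proof. by move=> [h1 h2] [h3 h4]; congr pair; apply/rowP => k; rewrite !mxE evqD. Qed.

Lemma svZ c x : reg c -> regv x -> sv (c *: x) = evq c *: sv x.
Proof. by move=> hc [h1 h2]; congr pair; apply/rowP => k; rewrite !mxE evqM. Qed.

Lemma sv_sum I (r : seq I) (P : pred I) (F : I -> VQ) : (forall x, P x -> regv (F x)) ->
  sv (\sum_(x <- r | P x) F x) = \sum_(x <- r | P x) sv (F x).
Proof.
move=> h; suff [] : regv (\sum_(x <- r | P x) F x) /\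
  sv (\sum_(x <- r | P x) F x) = \sum_(x <- r | P x) sv (F x) by [].
elim/big_rec2: _ => [|x y z Px [hy <-]]; first by split; [exact: regv0 | exact: sv0].
by split; [apply: regvD => //; apply: h | rewrite svD //; apply: h].
Qed.

Lemma reg_bool (b : bool) : reg b%:R.
Proof. by case: b; [exact: reg1 | exact: reg0]. Qed.

Lemma evq_bool (b : bool) : evq b%:R = b%:R.
Proof. by case: b; [exact: evq1 | exact: evq0]. Qed.

Lemma reg_bv d k l : reg (@bv Qt d k 0 l).
Proof. by rewrite /bv; case: ifP => _; rewrite mxE; [apply: reg_bool | apply: reg0]. Qed.

Lemma evq_bv d k l : evq (@bv Qt d k 0 l) = @bv C d k 0 l.
Proof. by rewrite /bv; case: ifP => _; rewrite !mxE; [apply: evq_bool | apply: evq0]. Qed.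

Lemma regv_m k : regv (mv Qt i j k).
Proof. by split=> l; [apply: reg_bv | rewrite mxE; apply: reg0]. Qed.

Lemma regv_n p : regv (nv Qt i j p).
Proof. by split=> l; [rewrite mxE; apply: reg0 | apply: reg_bv]. Qed.

Lemma sv_m k : sv (mv Qt i j k) = mv C i j k.
Proof.
by congr pair; apply/rowP => l; rewrite !mxE /= ?evq_bv // evq0.
Qed.

Lemma sv_n p : sv (nv Qt i j p) = nv C i j p.
Proof.
by congr pair; apply/rowP => l; rewrite !mxE /= ?evq_bv // evq0.
Qed.

Lemma regv_coef_m c k : 0 <= k <= j%:Z -> regv (c *: mv Qt i j k) -> reg c.
Proof.
move=> hk [/(_ (inord `|k|%N)) + _]; rewrite mxE /mv /= /bv hk mxE !eqxx mulr1 //.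
Qed.

Definition RegOp (A : 'End(VQ)) : Prop := forall x, regv x -> regv (A x).

Lemma RegOp_basis (A : 'End(VQ)) :
  (forall k : nat, (k <= j)%N -> regv (A (mv Qt i j k))) ->
  (forall p : nat, (p <= i)%N -> regv (A (nv Qt i j p))) -> RegOp A.
Proof.
move=> hm hn x [h1 h2]; rewrite (TV_basis x) lfD !linear_sum /=.
by apply: regvD; apply: regv_sum => k _; rewrite lfZ; apply: regvZ => //;
  [apply: hm | apply: hn]; rewrite -ltnS.
Qed.

Definition spop (A : 'End(VQ)) : 'End(VC) :=
  basis_op (fun k : 'I_j.+1 => sv (A (mv Qt i j k))) (fun p : 'I_i.+1 => sv (A (nv Qt i j p))).

Lemma spopE A x : RegOp A -> regv x -> spop A (sv x) = sv (A x).
Proof.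
move=> hA [h1 h2]; rewrite basis_opE {3}(TV_basis x) lfD !linear_sum /=.
have rm (k : 'I_j.+1) : regv (A (x.1 0 k *: mv Qt i j k)).
  by rewrite lfZ; apply: regvZ => //; apply/hA/regv_m.
have rn (p : 'I_i.+1) : regv (A (x.2 0 p *: nv Qt i j p)).
  by rewrite lfZ; apply: regvZ => //; apply/hA/regv_n.
rewrite svD; [|exact: regv_sum|exact: regv_sum].
rewrite !sv_sum //; congr (_ + _); apply: eq_bigr => k _; rewrite lfZ svZ ?mxE //;
  apply: hA; [exact: regv_m | exact: regv_n].
Qed.

Lemma spop_unique A (B : 'End(VC)) : RegOp A -> (forall x, regv x -> B (sv x) = sv (A x)) ->
  B = spop A.
Proof.
move=> hA h; apply: TV_lfunP => k _; rewrite -?sv_m -?sv_n h ?spopE //;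
  first [exact: regv_m | exact: regv_n].
Qed.

End RegularVectors.

Section Specialization.
Variables (C : numFieldType) (q : C) (l : nat).
Hypotheses (hl : (2 <= l)%N) (hq : q != 0) (hql : l.-primitive_root (q ^+ 2)).
Variables i a r : nat.
Hypothesis a0 : (0 < a)%N.
Hypothesis al : (a < l)%N.
Hypothesis hN : (i + a + 1)%N = (l * r.+1)%N.
Local Notation j := (i + 2 * a)%N.
Local Notation VC := (TV C i j).
Local Notation rho := (genT i a0).
Local Notation mv := (@mv Qt i j).
Local Notation nv := (@nv Qt i j).
Local Notation reg := (reg q).
Local Notation regv := (@regv C q i j).
Local Notation RegOp := (@RegOp C q i j).

Lemma regopK c : RegOp (opK tQ i a c).
Proof.
by apply: RegOp_basis => k _; rewrite ?opK_m ?opK_n; apply: regvZ;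
  try exact/(reg_laurent hq)/is_laurentXz; first [exact: regv_m | exact: regv_n].
Qed.

Lemma reg_gcoef x : reg (gcoef tQ a x).
Proof.
case: x => p; last by rewrite gcoef_neg //; apply: reg0.
have -> : gcoef tQ a p = gq tQ (a + p).-1%:Z p.
  by rewrite -(gq_qbin tQ_neq0 tQ_generic) /gcoef; congr qbin; lia.
exact: reg_gq.
Qed.

Let opEm x := opE_m tQ_neq0 tQ_generic i a0 x.
Let opEn x := @opE_n _ _ tQ_neq0 tQ_generic i a a0 x.

Lemma regopE : RegOp (rho uE).
Proof.
apply: RegOp_basis => k hk; rewrite genT_E.
  by rewrite opEm; apply: regvZ; [exact: reg_qint hl hq hql _ | exact: regv_m].
rewrite opEn //; apply: regvD; apply: regvZ;
  [exact: reg_qint hl hq hql _ | exact: regv_n | exact: reg_gcoef | exact: regv_m].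
Qed.

Lemma regopE_small v : (v < l)%N -> RegOp (rho (divpow uE v)).
Proof.
elim: v => [|v IH] vl x hx; first by rewrite genT_dpow0 id_lfunE.
rewrite genT_dpowS; apply: regvZ; last by apply/regopE/IH => //; apply: ltnW.
apply: regV; first exact: reg_qint hl hq hql _.
by rewrite (evq_qint hl hq hql) (qintq_nat_eq0 hl hq hql) gtnNdvd.
Qed.

Lemma regE_m v k : regv (rho (divpow uE v) (mv k)).
Proof. by rewrite genE_m; apply: regvZ; [exact: reg_gq hq _ _ | exact: regv_m]. Qed.

Lemma regF_m v k : regv (rho (divpow uF v) (mv k)).
Proof. by rewrite genF_m; apply: regvZ; [exact: reg_gq hq _ _ | exact: regv_m]. Qed.

(** For v <= a < l the denominator [v]! is invertible at q; for v > a the index a - v of m is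
    negative. *)
Lemma regE_n0 v : regv (rho (divpow uE v) (nv 0)).
Proof.
have [va|av] := leqP v a; first exact/(regopE_small (leq_ltn_trans va al))/regv_n.
rewrite (genE_n a0 v (leq0n i)) mv_out; last lia.
by rewrite scaler0 addr0; apply: regvZ; [exact: reg_gq hq _ _ | exact: regv_n].
Qed.

Lemma nv_F p : (p <= i)%N -> nv p = rho (divpow uF p) (nv 0).
Proof.
move=> pi; rewrite (genF_n a0 p (leq0n i)) !add0n ltnNge pi scale0r addr0.
by rewrite (gq_diag tQ_neq0 tQ_generic) scale1r.
Qed.

(** The sum that defines gamma_{p,v} is not visibly regular. Since n_p = F^(p) n_0, the commutation
    formula reduces the claim to divided powers of E on n_0, followed by divided powers of F on n_0
    or on the m's. *)
Lemma regE_n v p : (p <= i)%N -> regv (rho (divpow uE v) (nv p)).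
Proof.
move=> pi; rewrite (nv_F pi) -comp_lfunE -actionM ut_commutation.
rewrite -GTE act_sumv; apply: regv_sum => d _.
rewrite (@actMv _ _ _ _ (_ * _)) (@actMv _ _ _ _ (dpsub _ _ _ _)).
have dv : (d <= v)%N by rewrite -ltnS.
have hw n := genK_En a0 n (v - d) (leq0n i).
rewrite (kap_action (n := i%:Z + 2 * (v - d)%:Z) _ _ tQ_neq0); first last.
- by rewrite !GTE genT_Ki hw mulr0 subr0 mulN1r.
- by rewrite !GTE genT_K hw mulr0 subr0 mul1r.
rewrite lfZ; apply: regvZ; first exact: reg_gq hq _ _.
rewrite /dpsub; case: leqP => dp; last by rewrite act0v; apply: regv0.
rewrite -divpowE; have [->|dv'] := eqVneq (v - d)%N 0%N.
  rewrite !GTE genT_dpow0 id_lfunE (genF_n a0 _ (leq0n i)) add0n ltnNge leq_subLR.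
  rewrite (leq_trans pi (leq_addl _ _)) scale0r addr0.
  by apply: regvZ; [exact: reg_gq hq _ _ | exact: regv_n].
have hE : act (GT i a0) (divpow uE (v - d)) (nv 0) = gamF tQ i a 0 (v - d) *: mv (a%:Z - (v - d)%:Z).
  rewrite GTE (genE_n a0 _ (leq0n i)) nv_out ?scaler0 ?add0r //; lia.
have := regE_n0 (v - d); rewrite -GTE hE => hr.
have [hk|hk] := boolP (0 <= a%:Z - (v - d)%:Z <= j%:Z); last first.
  by rewrite mv_out // scaler0 linear0; apply: regv0.
rewrite lfZ; apply: regvZ; first exact: regv_coef_m hk hr.
exact: regF_m.
Qed.

(** With P = p + v, the numerator [a + P]...[P + 1] of [a + P choose a] contains [N], N = i + a + 1,
    exactly because i < P <= i + a. It cancels 1/[N], and [a]! is nonzero at q as a < l. *)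
Lemma reg_omF p v : (p <= i)%N -> (i < p + v)%N -> (p + v <= i + a)%N -> reg (omF tQ i a p v).
Proof.
move=> pi h1 h2; rewrite /omF; apply: regM; last exact: reg_gq hq _ _.
set P := (p + v)%N in h1 h2 *.
have xa : (P - i.+1 < a)%N by lia.
have -> : gq tQ (a + p + v)%:Z P = gq tQ (a + P)%:Z a.
  by rewrite -addnA -/P -(gq_sym tQ_neq0 tQ_generic).
have e : (qint tQ (a%:Z + i%:Z + 1))^-1 * gq tQ (a + P)%:Z a
   = (\prod_(x < a | x != Ordinal xa) qint tQ ((a + P)%:Z - x%:Z)) / qfact tQ a.
  have := gq_fact tQ_neq0 tQ_generic (a + P)%:Z a; rewrite (bigD1 (Ordinal xa)) //=.
  rewrite (_ : (a + P)%:Z - (P - i.+1)%:Z = a%:Z + i%:Z + 1); last lia.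
  have hn : qint tQ (a%:Z + i%:Z + 1) != 0 by apply: qintQ_neq0; lia.
  move=> h; apply: (mulfI hn); rewrite (mulVKf hn) mulrA -h.
  by rewrite [RHS]mulrC (mulKf (qfactQ_neq0 a)).
rewrite e; apply: regM.
  by apply: reg_prod => x _; exact: reg_qint hl hq hql _.
by apply: regV; [exact: reg_qfact hl hq hql _ | exact: qfactq_neq0 hl hq hql _ al].
Qed.

Lemma regF_n v p : (p <= i)%N -> regv (rho (divpow uF v) (nv p)).
Proof.
move=> pi; rewrite genF_n //; apply: regvD.
  by apply: regvZ; [exact: reg_gq hq _ _ | exact: regv_n].
case: ltnP => h; last by rewrite scale0r; apply: regv0.
have [h'|h'] := leqP (p + v) (i + a); last first.
  by rewrite mv_out ?scaler0; [apply: regv0 | lia].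
by apply: regvZ; [exact: reg_omF | exact: regv_m].
Qed.

Lemma regop_ures u : in_Ures u -> RegOp (rho u).
Proof.
elim=> {u} [||n|n||u v _ hu _ hv|u v _ hu _ hv|P n u _ hu].
- by rewrite genT_K; apply: regopK.
- by rewrite genT_Ki; apply: regopK.
- by apply: RegOp_basis => k hk; [apply: regE_m | apply: regE_n].
- by apply: RegOp_basis => k hk; [apply: regF_m | apply: regF_n].
- by move=> x hx; rewrite action1 id_lfunE.
- by move=> x hx; rewrite actionD add_lfunE; apply: regvD; [apply: hu | apply: hv].
- by move=> x hx; rewrite actionM comp_lfunE; apply/hu/hv.
- move=> x hx; rewrite actionZ scale_lfunE; apply: regvZ; last exact: hu.
  by apply: (reg_laurent hq); exists P, n.
Qed.

Definition sp_gen (u : Ures) : 'End(VC) := spop q (rho (val u)).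

Lemma regop_Ures (u : Ures) : RegOp (rho (val u)).
Proof. exact/regop_ures/ures_predP/(uresP u). Qed.

Fact sp_gen_rel x y : spec_rel q x y -> expr_op sp_gen x = expr_op sp_gen y.
Proof.
case=> [u v|u v||P n u] /=; apply/esym/spop_unique; try exact: regop_Ures; move=> x0 hx.
- rewrite add_lfunE !spopE; try exact: regop_Ures; try by [].
  by rewrite actionD add_lfunE svD //; apply: regop_Ures.
- rewrite comp_lfunE !spopE; try exact: regop_Ures; try by [].
  by rewrite actionM comp_lfunE.
- by rewrite scale1r id_lfunE action1 id_lfunE.
rewrite scale1_comp scale_lfunE spopE //; last exact: regop_Ures.
rewrite actionZ scale_lfunE svZ; last exact: regop_Ures.
  by rewrite (evq_eq (ev_laurentq hq P n)).
by apply: (reg_laurent hq); exists P, n.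
Qed.

Definition spT : module_on (spec_rel q) (Tspace C i j) := gen_module sp_gen_rel.

Lemma spTE u x : in_Ures u -> regv x -> spT (sp q u) (sv q x) = sv q (rho u x).
Proof.
move=> hu hx; rewrite -(spE q hu) [spT _]gen_module_gen /sp_gen spopE //.
exact: regop_ures.
Qed.

End Specialization.

(** * The limits of the statement as values of rational functions *)

Section LimitValues.
Variables (C : numFieldType).
Implicit Types (t q : C).

Lemma qfact_le_neq0 t m n : (m <= n)%N -> qfact t n != 0 -> qfact t m != 0.
Proof.
move=> mn; apply: contraNneq => h.
elim: n mn => [|n IH]; first by rewrite leqn0 => /eqP<-; rewrite h.
by rewrite leq_eqVlt => /predU1P[<-|/IH e]; rewrite ?h // qfactS mulf_eq0 e orbT.
Qed.

Lemma ev_qbin t (m n : int) : t != 0 -> t - t^-1 != 0 -> qfact t `|m| != 0 ->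
  ev t (qbin tQ m n) (qbin t m n).
Proof.
move=> t0 t1 hm; rewrite /qbin; case: ifP => [/andP[n0 nm]|_]; last exact: ev0.
have h1 : qfact t `|n| != 0 by apply: (qfact_le_neq0 _ hm); lia.
have h2 : qfact t `|m - n| != 0 by apply: (qfact_le_neq0 _ hm); lia.
apply: ev_div; [by rewrite mulf_neq0 | exact: ev_qfact |].
by apply: evM; apply: ev_qfact.
Qed.

Local Open Scope classical_set_scope.

Lemma qbinq_gq q (m n : nat) : q != 0 -> qbinq q m%:Z n%:Z = evq q (gq tQ m%:Z n).
Proof.
move=> hq; apply: (@ev_lim _ _ (gq tQ m%:Z n)); last exact/evqP/(reg_gq hq).
apply: filterS (near_generic q m) => t [t0 t1 hm].
by rewrite -(gq_qbin tQ_neq0 tQ_generic); apply: ev_qbin.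
Qed.

Variables (q : C) (l s i : nat).
Hypothesis hs : (s < l - 1)%N.
Local Notation a := (l - s - 1)%N.

Lemma near_gamma p v :
  \forall t \near q^', ev t (gamF tQ i a p v) (gamma_fun l s i p v t).
Proof.
apply: filterS (near_generic q (l + p + v)) => t [t0 t1 hm].
have hf n : (n <= l + p + v)%N -> qfact t n != 0 by move=> h; apply: qfact_le_neq0 hm.
apply: evM.
  by apply: evV; [apply: hf; lia | apply: ev_qfact].
apply: ev_sum => u _; apply: evM; first (apply: evM).
- rewrite /gcoef (_ : a%:Z + (p%:Z - u%:Z) - 1 = l%:Z - s%:Z + p%:Z - u%:Z - 2); last lia.
  have [pu|up] := leP u%:Z p%:Z; first by apply: ev_qbin => //; apply: hf; lia.
  rewrite /qbin ifF; last lia.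
  by rewrite ifF; [exact: ev0 | lia].
- by apply: ev_prod => b _; apply: ev_qint.
- apply: ev_prod => b _.
  rewrite (_ : i%:Z + a%:Z + 1 - p%:Z + b%:Z = i%:Z + l%:Z - s%:Z - p%:Z + b%:Z); last lia.
  exact: ev_qint.
Qed.

Lemma near_omega p v :
  \forall t \near q^', ev t (omF tQ i a p v) (omega_fun l s i p v t).
Proof.
apply: filterS (near_generic q (l + i + p + v)) => t [t0 t1 hm].
have hf n : (n <= l + i + p + v)%N -> qfact t n != 0 by move=> h; apply: qfact_le_neq0 hm.
rewrite /omF /omega_fun -!(gq_qbin tQ_neq0 tQ_generic) !PoszD.
apply: evM; first (apply: evM).
- rewrite (_ : a%:Z + i%:Z + 1 = l%:Z - s%:Z + i%:Z); last lia.
  apply: evV; last exact: ev_qint.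
  have : qfact t (l - s + i) != 0 by apply: hf; lia.
  rewrite (_ : (l - s + i)%N = (l - s + i).-1.+1); last lia.
  rewrite qfactS mulf_eq0 negb_or => /andP[+ _].
  by rewrite (_ : (l - s + i).-1.+1%:Z = l%:Z - s%:Z + i%:Z) //; lia.
- rewrite (_ : a%:Z + p%:Z + v%:Z = l%:Z - s%:Z + p%:Z + v%:Z - 1); last lia.
  by apply: ev_qbin => //; apply: hf; lia.
- by apply: ev_qbin => //; apply: hf; lia.
Qed.

End LimitValues.

Lemma unrolled_action (M : fdmod uq_rel) l n (v : M) : act M uK v = tQ ^ n *: v ->
  act M (unrolled_num l) v = ((cyclo_at l (tQ ^+ 2))^-1 * ((tQ ^ n) ^+ (2 * l) - 1)) *: v.
Proof.
move=> hK; have hX m : act M (uK ^+ m) v = (tQ ^ n) ^+ m *: v.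
  elim: m => [|m IH]; first by rewrite !expr0 act1v scale1r.
  by rewrite exprSr actMv hK lfZ IH scalerA -exprS.
by rewrite /unrolled_num actZv actBv hX act1v -scalerA scalerBl scale1r.
Qed.

Section TiltingAtQ.
Variables (C : numFieldType) (q : C) (l s i r : nat).
Hypotheses (hl : (2 <= l)%N) (hq : q != 0) (hql : l.-primitive_root (q ^+ 2)).
Hypotheses (hs : (s < l - 1)%N) (hi : i = (r * l + s)%N).
Local Notation a := (l - s - 1)%N.
Local Notation j := (i + 2 * a)%N.
Local Notation gqq c d := (evq q (gq tQ c d)).
Local Notation M_ := (mvec C i j).
Local Notation N_ := (nvec C i j).
Local Notation regv := (@regv C q i j).

Lemma a_gt0 : (0 < a)%N. Proof. clear -hs; lia. Qed.
Lemma a_lt_l : (a < l)%N. Proof. clear -hl hs; lia. Qed.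
Lemma N_eq : (i + a + 1)%N = (l * r.+1)%N.
Proof. by rewrite hi mulnS mulnC; clear -hs; lia. Qed.

Definition Tq : module_on (spec_rel q) (Tspace C i j) :=
  spT hl hq hql a_gt0 a_lt_l N_eq.
Definition TM : LUmod q := FdMod Tq.

Local Notation rho := (genT i a_gt0).

Lemma TqE u x : in_Ures u -> regv x -> Tq (sp q u) (sv q x) = sv q (rho u x).
Proof. exact: spTE. Qed.

Lemma Tq_m u k : in_Ures u -> Tq (sp q u) (M_ k) = sv q (rho u (mv Qt i j k)).
Proof. by move=> hu; rewrite -TqE ?sv_m //; apply: regv_m. Qed.

Lemma Tq_n u p : in_Ures u -> Tq (sp q u) (N_ p) = sv q (rho u (nv Qt i j p)).
Proof. by move=> hu; rewrite -TqE ?sv_n //; apply: regv_n. Qed.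

Lemma T_K_m (k : int) : Tq (LK q) (M_ k) = q ^ (j%:Z - 2 * k) *: M_ k.
Proof.
rewrite LK_sp Tq_m; last exact: in_Ures_K.
rewrite genT_K opK_m mul1r svZ ?evq_expz ?sv_m //; last exact: regv_m.
exact/(reg_laurent hq)/is_laurentXz.
Qed.

Lemma T_K_n (p : int) : Tq (LK q) (N_ p) = q ^ (i%:Z - 2 * p) *: N_ p.
Proof.
rewrite LK_sp Tq_n; last exact: in_Ures_K.
rewrite genT_K opK_n mul1r svZ ?evq_expz ?sv_n //; last exact: regv_n.
exact/(reg_laurent hq)/is_laurentXz.
Qed.

Lemma T_E_m v (k : int) : Tq (LE q v) (M_ k) = gqq (j%:Z - k + v%:Z) v *: M_ (k - v%:Z).
Proof.
rewrite LE_sp Tq_m; last exact: in_Ures_E.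
by rewrite genE_m svZ ?sv_m //; [exact: reg_gq | exact: regv_m].
Qed.

Lemma T_F_m v (k : int) : Tq (LF q v) (M_ k) = gqq (k + v%:Z) v *: M_ (k + v%:Z).
Proof.
rewrite LF_sp Tq_m; last exact: in_Ures_F.
by rewrite genF_m svZ ?sv_m //; [exact: reg_gq | exact: regv_m].
Qed.

(** Read off from the stability of the lattice: subtracting the n-component of E^(v) n_p leaves a
    regular multiple of a basis vector. *)
Lemma reg_gamF p v : (p <= i)%N -> 0 <= p%:Z + a%:Z - v%:Z <= j%:Z -> reg q (gamF tQ i a p v).
Proof.
move=> pi hk; apply: (regv_coef_m hk (i := i)).
have := regE_n hl hq hql a_gt0 a_lt_l N_eq v pi; rewrite genE_n // => h.
have h' : regv (- (gq tQ (i%:Z - p%:Z + v%:Z) v *: nv Qt i j (p%:Z - v%:Z))).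
  rewrite -scaleNr; apply: regvZ; last exact: regv_n.
  exact/regN/(reg_gq hq).
by have := regvD h' h; rewrite addrA addNr add0r.
Qed.

Lemma T_E_n v p : (p <= i)%N -> Tq (LE q v) (N_ p) =
  gqq (i%:Z - p%:Z + v%:Z) v *: N_ (p%:Z - v%:Z)
  + evq q (gamF tQ i a p v) *: M_ (p%:Z + a%:Z - v%:Z).
Proof.
move=> pi; rewrite LE_sp Tq_n; last exact: in_Ures_E.
have h1 := reg_gq hq (i%:Z - p%:Z + v%:Z) v.
rewrite genE_n //; have [hk|hk] := boolP (0 <= p%:Z + a%:Z - v%:Z <= j%:Z).
  have h2 := reg_gamF pi hk.
  rewrite svD ?svZ ?sv_n ?sv_m //; try exact: regv_n; try exact: regv_m;
    by apply: regvZ => //; first [exact: regv_n | exact: regv_m].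
(* Here [gamF] may have a pole; the default value of [evq] is harmless because it multiplies the
   zero vector. *)
rewrite mv_out // scaler0 addr0 svZ ?sv_n //; last exact: regv_n.
rewrite [M_ _](_ : _ = 0) ?scaler0 ?addr0 //; exact: (@mv_out C i j).
Qed.

Lemma T_F_n v p : (p <= i)%N -> Tq (LF q v) (N_ p) =
  gqq (p + v)%:Z v *: N_ (p + v)%:Z
  + (if (i < p + v)%N then evq q (omF tQ i a p v) else 0) *: M_ (p + a + v)%:Z.
Proof.
move=> pi; rewrite LF_sp Tq_n; last exact: in_Ures_F.
have h1 := reg_gq hq (p + v)%:Z v.
rewrite genF_n //; case: ltnP => h; last first.
  by rewrite !scale0r !addr0 svZ ?sv_n //; exact: regv_n.
have [h'|h'] := leqP (p + v) (i + a).
  have h2 : reg q (omF tQ i a p v) by apply: (reg_omF hl hq hql a_gt0 a_lt_l N_eq).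
  rewrite svD ?svZ ?sv_n ?sv_m //; try exact: regv_n; try exact: regv_m;
    by apply: regvZ => //; first [exact: regv_n | exact: regv_m].
rewrite mv_out ?scaler0 ?addr0; last lia.
rewrite svZ ?sv_n //; last exact: regv_n.
rewrite [M_ _](_ : _ = 0) ?scaler0 ?addr0 //; apply: (@mv_out C i j); lia.
Qed.

Lemma T_unrolled n (x : TV Qt i j) : regv x -> rho uK x = tQ ^ n *: x ->
  Tq (LH q l) (sv q x) = n%:~R *: sv q x.
Proof.
move=> hx hK; rewrite /LH actionZ scale_lfunE -/(sp q _) TqE //; last exact: in_Ures_unrolled (ltnW hl).
rewrite -GTE (@unrolled_action (GT i a_gt0) l n x hK) svZ //; last by exists (cofq q l * n%:~R); apply: ev_unrolled.
rewrite (evq_eq (ev_unrolled hl hq hql n)) scalerA epsqE // mulrA mulVf ?mul1r //.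
exact: cofq_neq0 hl hql.
Qed.

Lemma T_H_m (k : int) : Tq (LH q l) (M_ k) = (j%:Z - 2 * k)%:~R *: M_ k.
Proof.
have := @T_unrolled (j%:Z - 2 * k) (mv Qt i j k) (regv_m _ _ _ _); rewrite sv_m; apply.
by rewrite genT_K opK_m mul1r.
Qed.

Lemma T_H_n (p : int) : Tq (LH q l) (N_ p) = (i%:Z - 2 * p)%:~R *: N_ p.
Proof.
have := @T_unrolled (i%:Z - 2 * p) (nv Qt i j p) (regv_n _ _ _ _); rewrite sv_n; apply.
by rewrite genT_K opK_n mul1r.
Qed.

Lemma Tq_limits : limits_exist q l s i j.
Proof.
move=> p v pi; split=> [hk|hk hv].
  apply/cvg_ex; exists (evq q (gamF tQ i a p v)).
  apply: ev_cvg; first exact: near_gamma.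
  by apply/evqP/reg_gamF => //; move: hk; rewrite /idxE; lia.
apply/cvg_ex; exists (evq q (omF tQ i a p v)).
apply: ev_cvg; first exact: near_omega.
apply/evqP/(reg_omF hl hq hql a_gt0 a_lt_l N_eq) => //; move: hk hv; rewrite /idxF; lia.
Qed.

Lemma Tq_formulas : tilting_formulas l s Tq.
Proof.
split=> [k kj|p pi]; split.
- by rewrite T_K_m; congr (_ ^ _ *: _); lia.
- move=> v; split; last by rewrite T_F_m -PoszD qbinq_gq.
  rewrite T_E_m (_ : j%:Z - k%:Z + v%:Z = (j - k + v)%:Z); last lia.
  by rewrite qbinq_gq.
- by rewrite T_K_n; congr (_ ^ _ *: _); lia.
move=> v; split.
  rewrite T_E_n // (_ : i%:Z - p%:Z + v%:Z = (i - p + v)%:Z); last lia.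
  rewrite qbinq_gq // (_ : p%:Z + a%:Z - v%:Z = idxE l s p v); last by rewrite /idxE; lia.
  congr (_ + _); have [hk|hk] := boolP (0 <= idxE l s p v <= j%:Z); last first.
    by rewrite [M_ _](_ : _ = 0) ?scaler0 //; exact: (@mv_out C i j).
  congr (_ *: _); rewrite /gamma; apply/esym/ev_lim; first exact: near_gamma.
  by apply/evqP/reg_gamF => //; move: hk; rewrite /idxE; lia.
rewrite T_F_n // -PoszD qbinq_gq // (_ : (p + a + v)%:Z = idxF l s p v); last by rewrite /idxF; lia.
congr (_ + _); have [hk|hk] := boolP (0 <= idxF l s p v <= j%:Z); last first.
  by rewrite [M_ _](_ : _ = 0) ?scaler0 //; exact: (@mv_out C i j).
congr (_ *: _); rewrite /omega (_ : (i%:Z - p%:Z < v%:Z) = (i < p + v)%N); last lia.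
case: ifP => // h; apply/esym/ev_lim; first exact: near_omega.
apply/evqP/(reg_omF hl hq hql a_gt0 a_lt_l N_eq) => //; move: hk; rewrite /idxF; lia.
Qed.

Lemma tilting_unique (T T' : module_on (spec_rel q) (Tspace C i j)) :
  tilting_formulas l s T -> tilting_formulas l s T' -> forall x : LU q, T' x = T x.
Proof.
move=> [hm hn] [hm' hn'].
have hK : T' (LK q) = T (LK q).
  apply: TV_lfunP => k hk; first by have [-> _] := hm _ hk; have [-> _] := hm' _ hk.
  by have [-> _] := hn _ hk; have [-> _] := hn' _ hk.
elim/(LU_ind hq) => [c|x y hx hy|x y hx hy|||v|v].
- by rewrite !actionZ !action1.
- by rewrite !actionD hx hy.
- by rewrite !actionM hx hy.
- exact: hK.
(* The formulas do not mention K^-1, but it is determined as the inverse of K. *)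
- apply/lfunP => x; have := @spKiK C q (FdMod T) (T' (sp q uKinv) x).
  rewrite /act /= -hK => <-; congr (T _ _).
  exact: (@spKKi C q (FdMod T')).
- apply: TV_lfunP => k hk.
    by have [_ /(_ v)[-> _]] := hm _ hk; have [_ /(_ v)[-> _]] := hm' _ hk.
  by have [_ /(_ v)[-> _]] := hn _ hk; have [_ /(_ v)[-> _]] := hn' _ hk.
- apply: TV_lfunP => k hk.
    by have [_ /(_ v)[_ ->]] := hm _ hk; have [_ /(_ v)[_ ->]] := hm' _ hk.
  by have [_ /(_ v)[_ ->]] := hn _ hk; have [_ /(_ v)[_ ->]] := hn' _ hk.
Qed.

Lemma wvec_m (k : int) : wvec l (j%:Z - 2 * k) (M_ k : TM).
Proof. by split; [exact: T_K_m | exact: T_H_m]. Qed.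

Lemma wvec_n (p : int) : wvec l (i%:Z - 2 * p) (N_ p : TM).
Proof. by split; [exact: T_K_n | exact: T_H_n]. Qed.

End TiltingAtQ.

Section TypeICriterion.
Variables (C : numFieldType) (q : C) (l : nat).
Implicit Types M N : LUmod q.

Definition wspace M (n : int) : {vspace M} :=
  (lker (act M (LK q) - q ^ n *: \1%VF) :&: lker (act M (LH q l) - n%:~R *: \1%VF))%VS.

Lemma wspaceP M n v : reflect (wvec l n v) (v \in wspace M n).
Proof.
rewrite memv_cap !memv_ker !add_lfunE !opp_lfunE !scale_lfunE !id_lfunE !subr_eq0.
by apply: (iffP andP) => -[h1 h2]; split; apply/eqP.
Qed.

Lemma act_prodH M (I : finType) (P : pred I) (c : I -> int) (m : int) (v : M) :
  act M (LH q l) v = m%:~R *: v ->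
  act M (\prod_(x | P x) (LH q l - (c x)%:~R *: (1 : LU q))) v
    = (\prod_(x | P x) (m - c x)%:~R) *: v.
Proof.
move=> hv; elim/big_rec2: _ => [|x a b _ IH]; first by rewrite act1v scale1r.
by rewrite actMv IH linearZ /= actBv hv actZv act1v -scalerBl -rmorphB scalerA mulrC.
Qed.

(** Independence of the weight spaces: the product of the H - wt x over x <> x0 kills every term of
    a linear relation except the one at x0. Duplicates are removed from [s] because type I requires
    distinct weights. *)
Lemma typeI_span M (s : seq int) :
  (forall U : {vspace M}, (forall n v, n \in s -> wvec l n v -> v \in U) -> U = fullv) ->
  typeI l M.
Proof.
move=> h; pose s' := undup s; pose wt (x : 'I_(size s')) := nth 0 s' x.
have iwt : injective wt.
  by move=> x y /eqP; rewrite nth_uniq ?undup_uniq // => /eqP/val_inj.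
exists (size s'), wt, (fun x => wspace M (wt x)); split=> //.
- apply/directv_sum_independent => us hus su0 x0 _.
  pose p := \prod_(x | x != x0) (LH q l - (wt x)%:~R *: (1 : LU q)).
  have e x : act M p (us x) = (\prod_(y | y != x0) (wt x - wt y)%:~R) *: us x.
    by apply: act_prodH; have /wspaceP[] := hus x isT.
  have := congr1 (act M p) su0; rewrite linear0 act_suml (bigD1 x0) //= big1; last first.
    by move=> x xx0; rewrite e (bigD1 x) //= subrr mul0r scale0r.
  rewrite addr0 e => /eqP; rewrite scaler_eq0 => /orP[/prodf_eq0[y yx]|/eqP//].
  by rewrite intr_eq0 subr_eq0 (inj_eq iwt) eq_sym (negPf yx).
- apply: h => n v ns wv.
  have ix : (index n s' < size s')%N by rewrite index_mem mem_undup.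
  have := sumv_sup (Ordinal ix) (P := xpredT) (Vs := fun x => wspace M (wt x)) isT (subvv _).
  by move/subvP; apply; apply/wspaceP; rewrite /wt /= nth_index ?mem_undup.
by move=> x v /wspaceP[].
Qed.

Lemma typeI_dsum M N : typeI l M -> typeI l N -> typeI l (dsum M N).
Proof.
move=> [n1 [wt1 [W1 [_ _ f1 h1]]]] [n2 [wt2 [W2 [_ _ f2 h2]]]].
apply: (@typeI_span _ ([seq wt1 x | x : 'I_n1] ++ [seq wt2 x | x : 'I_n2])) => U hU.
have hl (v : M) : ((v, 0) : dsum M N) \in U.
  have : v \in (\sum_x W1 x)%VS by rewrite f1 memvf.
  move=> /memv_sumP[vs hvs ->].
  rewrite (big_morph (fun y : M => (y, 0) : dsum M N) (id1 := 0) (op1 := +%R)) //; last first.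
    by move=> y z; congr pair; rewrite /= addr0.
  apply: rpred_sum => x _; apply: (hU (wt1 x)).
    by rewrite mem_cat; apply/orP; left; apply/mapP; exists x; rewrite ?mem_enum.
  have [hH hK] := h1 x _ (hvs x isT).
  by split; rewrite dsumE /= ?hH ?hK linear0; congr pair; rewrite /= scaler0.
have hr (v : N) : ((0, v) : dsum M N) \in U.
  have : v \in (\sum_x W2 x)%VS by rewrite f2 memvf.
  move=> /memv_sumP[vs hvs ->].
  rewrite (big_morph (fun y : N => (0, y) : dsum M N) (id1 := 0) (op1 := +%R)) //; last first.
    by move=> y z; congr pair; rewrite /= addr0.
  apply: rpred_sum => x _; apply: (hU (wt2 x)).
    by rewrite mem_cat; apply/orP; right; apply/mapP; exists x; rewrite ?mem_enum.
  have [hH hK] := h2 x _ (hvs x isT).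
  by split; rewrite dsumE /= ?hH ?hK linear0; congr pair; rewrite /= scaler0.
apply/eqP; rewrite eqEsubv subvf; apply/subvP => -[v w] _.
have -> : (v, w) = ((v, 0) : dsum M N) + (0, w) by congr pair; rewrite /= ?addr0 ?add0r.
exact: memvD.
Qed.

End TypeICriterion.

Section Projections.
Variables (F : fieldType) (U V : vectType F).

Fact fst_linear : linear (fun x : U * V => x.1). Proof. by []. Qed.
Fact snd_linear : linear (fun x : U * V => x.2). Proof. by []. Qed.
Fact inl_linear : linear (fun x : U => (x, 0) : U * V).
Proof. by move=> c x y; congr pair; rewrite /= scaler0 addr0. Qed.
Fact inr_linear : linear (fun x : V => (0, x) : U * V).
Proof. by move=> c x y; congr pair; rewrite /= scaler0 addr0. Qed.

Definition lfst : 'Hom((U * V)%type, U) := sval (lfun_of_linear fst_linear).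
Definition lsnd : 'Hom((U * V)%type, V) := sval (lfun_of_linear snd_linear).
Definition linl : 'Hom(U, (U * V)%type) := sval (lfun_of_linear inl_linear).
Definition linr : 'Hom(V, (U * V)%type) := sval (lfun_of_linear inr_linear).

Lemma lfstE x : lfst x = x.1. Proof. exact: (svalP (lfun_of_linear fst_linear)). Qed.
Lemma lsndE x : lsnd x = x.2. Proof. exact: (svalP (lfun_of_linear snd_linear)). Qed.
Lemma linlE x : linl x = (x, 0). Proof. exact: (svalP (lfun_of_linear inl_linear)). Qed.
Lemma linrE x : linr x = (0, x). Proof. exact: (svalP (lfun_of_linear inr_linear)). Qed.

End Projections.

(** * Modules on a product U x V in which U x 0 is a submodule *)

Section SubQuotient.
Variables (k : fieldType) (X : Type) (rels : nc_expr k X -> nc_expr k X -> Prop).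
Variables (U V : vectType k) (T : module_on rels (U * V)%type).
Hypothesis T_fst : forall x u, (T x (u, 0)).2 = 0.

Definition fst_action x : 'End(U) := (@lfst k U V \o T x \o linl U V)%VF.
Definition snd_action x : 'End(V) := (@lsnd k U V \o T x \o linr U V)%VF.

Lemma fst_actionE x u : T x (u, 0) = (fst_action x u, 0).
Proof. by rewrite !comp_lfunE linlE lfstE [LHS]surjective_pairing T_fst. Qed.

Lemma snd_actionE x z : (T x z).2 = snd_action x z.2.
Proof.
have e : z = (z.1, 0) + (0, z.2) by case: z => u v; congr pair; rewrite /= ?addr0 ?add0r.
rewrite {1}e lfD fst_actionE !comp_lfunE linrE lsndE /= add0r //.
Qed.

Fact fst_action1 : fst_action 1 = \1%VF.
Proof. by apply/lfunP => u; have := fst_actionE 1 u; rewrite action1 !id_lfunE => -[<-]. Qed.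

Fact fst_actionM x y : fst_action (x * y) = (fst_action x \o fst_action y)%VF.
Proof.
apply/lfunP => u; have := fst_actionE (x * y) u.
by rewrite actionM (comp_lfunE (T x)) !fst_actionE => -[<-]; rewrite [RHS]comp_lfunE.
Qed.

Fact fst_actionP c x y : fst_action (c *: x + y) = c *: fst_action x + fst_action y.
Proof.
apply/lfunP => u; have := fst_actionE (c *: x + y) u.
by rewrite actionP !add_lfunE !scale_lfunE !fst_actionE => -[<-].
Qed.

Definition fst_module : module_on rels U := ModuleOn fst_action1 fst_actionM fst_actionP.

Fact snd_action1 : snd_action 1 = \1%VF.
Proof. by apply/lfunP => v; rewrite -(snd_actionE 1 (0, v)) action1 !id_lfunE. Qed.

Fact snd_actionM x y : snd_action (x * y) = (snd_action x \o snd_action y)%VF.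
Proof.
apply/lfunP => v; rewrite -(snd_actionE (x * y) (0, v)) actionM (comp_lfunE (T x)).
by rewrite !snd_actionE [RHS]comp_lfunE.
Qed.

Fact snd_actionP c x y : snd_action (c *: x + y) = c *: snd_action x + snd_action y.
Proof.
apply/lfunP => v; rewrite -(snd_actionE (c *: x + y) (0, v)) actionP !add_lfunE !scale_lfunE.
by rewrite /= !snd_actionE.
Qed.

Definition snd_module : module_on rels V := ModuleOn snd_action1 snd_actionM snd_actionP.

Variable S : submodule (FdMod T).
Hypothesis S_fst : forall z : U * V, (z \in (S : {vspace FdMod T})) = (z.2 == 0).

Lemma submod_fst : isomorphic (submod S) (FdMod fst_module).
Proof.
pose f : 'Hom(submod S, FdMod fst_module) := (@lfst k U V \o linfun (@vsval k (FdMod T) S))%VF.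
have fE w : f w = (vsval w).1 by rewrite comp_lfunE lfunE lfstE.
have w2 (w : submod S) : vsval w = (f w, 0).
  have := subvsP w; rewrite S_fst => /eqP h; rewrite fE.
  by rewrite [LHS]surjective_pairing h.
exists f; split.
  move=> x w; rewrite [LHS]fE [act _ _ _]/(sub_action S x w) sub_actionE w2.
  by rewrite [act _ _ _]fst_actionE.
exists (fun u => vsproj S ((u, 0) : FdMod T)) => [w|u].
  by apply: val_inj; rewrite /= vsprojK -w2 // subvsP.
by rewrite fE vsprojK // S_fst.
Qed.

Lemma quotmod_snd : isomorphic (quotmod S) (FdMod snd_module).
Proof.
pose f : 'Hom(quotmod S, FdMod snd_module) :=
  (@lsnd k U V \o linfun (@vsval k (FdMod T) (S^C)%VS))%VF.
have fE w : f w = (vsval w).2 by rewrite comp_lfunE lfunE lsndE.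
have fq (z : FdMod T) : f (quot_proj S z) = z.2.
  have := quot_decomp S z; rewrite S_fst /= subr_eq0 => /eqP->.
  by rewrite fE.
exists f; split.
  move=> x w; have -> : act (quotmod S) x w = quot_proj S (act (FdMod T) x (vsval w)).
    by rewrite quot_projM quot_projK.
  by rewrite fq fE; exact: snd_actionE.
exists (fun v => quot_proj S ((0, v) : FdMod T)) => [w|v]; last exact: fq.
rewrite -[RHS]quot_projK; apply/eqP; rewrite -subr_eq0 -linearB quot_proj_eq0 S_fst /=.
by rewrite fE subrr.
Qed.

End SubQuotient.

(** * Structure of T_q(i) *)

Section MaximalSubmodules.
Variables (k : fieldType) (X : Type) (rels : nc_expr k X -> nc_expr k X -> Prop).
Variable M : fdmod rels.

Lemma bigcap_submoduleP (P : submodule M -> Prop) v :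
  v \in (bigcap_submodule P : {vspace M}) <->
  (forall W : submodule M, P W -> v \in (W : {vspace M})).
Proof. exact: (svalP (cid (bigcap_submodule_ex P)) v). Qed.

Lemma maximal_submodule_ex : (fullv : {vspace M}) <> 0%VS -> exists U : submodule M, maximal_submodule U.
Proof.
move=> full0; pose pr n := `[< exists U : submodule M, (U : {vspace M}) <> fullv /\ \dim U = n >].
have st0 : stable (M := M) 0%VS by move=> x v; rewrite !memv0 => /eqP->; rewrite linear0.
have ex : exists n, pr n by exists (\dim (0%VS : {vspace M})); apply/asboolP; exists (Submodule st0); split=> // /esym.
have ub n : pr n -> (n <= \dim (fullv : {vspace M}))%N.
  by move=> /asboolP[U [_ <-]]; rewrite dimvS ?subvf.
case: (ex_maxnP ex ub) => n /asboolP[U [pU dU]] maxn; exists U; split=> // W UW.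
have [->|/eqP nW] := eqVneq (W : {vspace M}) fullv; first by right.
left; apply/esym/eqP; rewrite eqEdim UW dU; apply: maxn; apply/asboolP.
by exists W.
Qed.

(** A generator lies in no maximal submodule, and a maximal submodule exists because M is nonzero of
    finite dimension. *)
Lemma not_in_radical v : v <> 0 ->
  (forall U : submodule M, v \in (U : {vspace M}) -> (U : {vspace M}) = fullv) ->
  v \notin (radical M : {vspace M}).
Proof.
move=> v0 gen; have [|U mU] := maximal_submodule_ex.
  by move=> f0; apply: v0; apply/eqP; rewrite -memv0 -f0 memvf.
apply/negP => /bigcap_submoduleP/(_ U mU)/gen; by case: mU.
Qed.

End MaximalSubmodules.

Section TiltingStructure.
Variables (C : numFieldType) (q : C) (l s i r : nat).
Hypotheses (hl : (2 <= l)%N) (hq : q != 0) (hql : l.-primitive_root (q ^+ 2)).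
Hypotheses (hs : (s < l - 1)%N) (hi : i = (r * l + s)%N).
Local Notation a := (l - s - 1)%N.
Local Notation j := (i + 2 * a)%N.
Local Notation gqq c d := (evq q (gq tQ c d)).
Local Notation M_ := (mvec C i j).
Local Notation N_ := (nvec C i j).
Local Notation Tq := (Tq hl hq hql hs hi).
Local Notation TM := (TM hl hq hql hs hi).

Lemma Tspace_basis (z : Tspace C i j) :
  z = \sum_(k < j.+1) z.1 0 k *: M_ k + \sum_(p < i.+1) z.2 0 p *: N_ p.
Proof. exact: (TV_basis (z : TV C i j)). Qed.

Lemma TME x v : act TM x v = Tq x v. Proof. by []. Qed.

Lemma Tq_fst x u : (Tq x (u, 0)).2 = 0.
Proof.
pose U : {vspace TM} := lker (@lsnd C _ _).
have memU z : (z \in U) = (z.2 == 0) by rewrite memv_ker lsndE.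
have mU (A : 'End(TM)) : (forall k, A (M_ k) \in U) -> forall v, v \in U -> A v \in U.
  move=> hA v; rewrite memU => /eqP v2; rewrite (Tspace_basis v) lfD !linear_sum /=.
  apply: memvD; apply: rpred_sum => k _; first by rewrite lfZ memvZ.
  by rewrite v2 mxE scale0r linear0 mem0v.
have mM k : M_ k \in U by rewrite memU.
suff st : stable U by have := st x (u, 0); rewrite !memU eqxx => /(_ isT)/eqP.
apply: (stable_gens hq) => [|n|n]; apply: mU => k.
- by rewrite [act _ _ _]T_K_m memvZ.
- by rewrite [act _ _ _]T_E_m memvZ.
- by rewrite [act _ _ _]T_F_m memvZ.
Qed.

Definition Dj : module_on (spec_rel q) 'rV[C]_j.+1 := fst_module Tq_fst.
Definition Di : module_on (spec_rel q) 'rV[C]_i.+1 := snd_module Tq_fst.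

Lemma DjE x u : Tq x (u, 0) = (Dj x u, 0).
Proof. exact: (fst_actionE Tq_fst). Qed.

Lemma DiE x z : (Tq x z).2 = Di x z.2.
Proof. exact: (snd_actionE Tq_fst). Qed.

Lemma Dj_weyl : weyl_formulas Dj.
Proof.
have [hm _] := Tq_formulas hl hq hql hs hi.
move=> k kj; have [hK hEF] := hm k kj; split.
  by move: hK; rewrite /mvec DjE => -[->].
by move=> n; have [hE hF] := hEF n; split; [move: hE | move: hF]; rewrite /mvec DjE => -[->].
Qed.

Lemma Di_weyl : weyl_formulas Di.
Proof.
have [_ hn] := Tq_formulas hl hq hql hs hi.
move=> p pi; have [hK hEF] := hn p pi; split.
  by have := congr1 snd hK; rewrite DiE.
move=> n; have [hE hF] := hEF n.
by split; [have := congr1 snd hE | have := congr1 snd hF]; rewrite DiE => -> /=; rewrite scaler0 addr0.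
Qed.

Definition genM : submodule TM :=
  @generated _ _ _ TM (fun x => exists2 k : nat, (k <= j)%N & x = M_ k).

Lemma genM_fst (z : Tspace C i j) : (z \in (genM : {vspace TM})) = (z.2 == 0).
Proof.
have st : stable (M := TM) (lker (@lsnd C 'rV[C]_j.+1 'rV[C]_i.+1)).
  move=> x v; rewrite !memv_ker !lsndE => /eqP v2.
  by rewrite [act _ _ _]/(Tq x v) DiE v2 linear0.
apply/idP/eqP => [/bigcap_submoduleP/(_ (Submodule st))|z2].
  have h v : (exists2 k : nat, (k <= j)%N & v = M_ k) -> v \in lker (@lsnd C 'rV[C]_j.+1 'rV[C]_i.+1).
    by move=> [k _ ->]; rewrite memv_ker lsndE.
  by move=> /(_ h); rewrite memv_ker lsndE => /eqP.
apply/bigcap_submoduleP => W hW; rewrite (Tspace_basis z).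
apply: memvD; apply: rpred_sum => k _; last by rewrite z2 mxE scale0r mem0v.
by apply/memvZ/hW; exists (val k) => //; rewrite -ltnS; exact: ltn_ord.
Qed.

Lemma genM_sub : isomorphic (submod genM) (FdMod Dj).
Proof. exact: submod_fst genM_fst. Qed.

Lemma genM_quot : isomorphic (quotmod genM) (FdMod Di).
Proof. exact: quotmod_snd genM_fst. Qed.

Lemma typeI_TM : typeI l TM.
Proof.
pose sw := [seq j%:Z - 2 * (k%:Z) | k <- iota 0 j.+1] ++ [seq i%:Z - 2 * (k%:Z) | k <- iota 0 i.+1].
apply: (@typeI_span _ _ _ _ sw) => U hU.
apply/eqP; rewrite eqEsubv subvf; apply/subvP => z _; rewrite (Tspace_basis z).
apply: memvD; apply: rpred_sum => k _; apply: memvZ.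
  apply: (hU (j%:Z - 2 * k%:Z)); last exact: wvec_m.
  by rewrite mem_cat; apply/orP; left; apply/mapP; exists (val k) => //; rewrite mem_iota /= add0n.
apply: (hU (i%:Z - 2 * k%:Z)); last exact: wvec_n.
by rewrite mem_cat; apply/orP; right; apply/mapP; exists (val k) => //; rewrite mem_iota /= add0n.
Qed.

(** For p = 0 only the summand u = 0 survives. It leaves the factors [N + b] with 0 < b < a < l,
    which are nonzero at q since l divides N. *)
Lemma gam0_neq0 : evq q (gamF tQ i a 0 a) != 0.
Proof.
have a0 := a_gt0 hs.
have -> : gamF tQ i a 0 a = (qfact tQ a)^-1 * \prod_(1 <= b < a) qint tQ (i%:Z + a%:Z + 1 + b%:Z).
  rewrite /gamF [\sum_(0 <= u < a) _]big_ltn // [\sum_(1 <= u < a) _]big1_seq ?addr0; last first.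
    move=> u; rewrite mem_index_iota => /andP[_ /andP[u0 _]]; rewrite gcoef_neg ?mul0r //; lia.
  congr (_ * _); rewrite [\prod_(1 <= b < 1) _]big_geq // mulr1.
  rewrite (_ : gcoef tQ a (0%:Z - 0%:Z) = 1) ?mul1r; last first.
    rewrite /gcoef (_ : a%:Z + (0%:Z - 0%:Z) - 1 = (a - 1)%:Z); last lia.
    by rewrite subrr (gq_qbin tQ_neq0 tQ_generic _ 0).
  by apply: eq_bigr => b _; congr qint; lia.
have h : ev q ((qfact tQ a)^-1 * \prod_(1 <= b < a) qint tQ (i%:Z + a%:Z + 1 + b%:Z))
    ((evq q (qfact tQ a))^-1 * \prod_(1 <= b < a) qint q (i%:Z + a%:Z + 1 + b%:Z)).
  apply: evM; last by apply: ev_prod => b _; exact: ev_qintq hl hq hql _.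
  apply: evV; last exact/evqP/(reg_qfact hl hq hql).
  exact: qfactq_neq0 hl hq hql _ (a_lt_l hl hs).
rewrite (evq_eq h) mulf_neq0 ?invr_eq0 ?(qfactq_neq0 hl hq hql (a_lt_l hl hs)) //.
rewrite prodf_seq_neq0; apply/allP => b; rewrite mem_index_iota /= => /andP[b0 ba].
rewrite (_ : i%:Z + a%:Z + 1 + b%:Z = l%:Z * r.+1%:Z + b%:Z); last first.
  by rewrite -PoszM -(N_eq hs hi); lia.
rewrite (qintq_addl hq hql) mulf_neq0 ?expfz_neq0 // (qintq_nat_eq0 hl hq hql).
by rewrite gtnNdvd // (ltn_trans ba) // (a_lt_l hl hs).
Qed.

(** The last factor of the numerator is [j - a + 1] = [N]. *)
Lemma gqq_ja : gqq j%:Z a = 0.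
Proof.
have a0 := a_gt0 hs; have al := a_lt_l hl hs; have eN := N_eq hs hi.
apply: (gqq_eq0 hl hq hql al); exists a.-1; first lia.
have -> : (j - a.-1)%N = (l * r.+1)%N by rewrite -eN; lia.
by rewrite dvdn_mulr //=; lia.
Qed.

(* E^(a) maps n_0 + d m_a to a nonzero multiple of m_0, since [j choose a] vanishes at q. *)
Lemma T_generated (W : submodule TM) d : (N_ 0 + d *: M_ a : TM) \in (W : {vspace TM}) ->
  (W : {vspace TM}) = fullv.
Proof.
move=> h; have a0 := a_gt0 hs.
have hm0 : M_ 0 \in (W : {vspace TM}).
  have := submodP (LE q a) h; rewrite TME lfD lfZ (T_E_n hl hq hql hs hi _ (leq0n i)) T_E_m.
  rewrite (_ : j%:Z - a%:Z + a%:Z = j%:Z); last lia.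
  rewrite gqq_ja scale0r scaler0 addr0 [N_ (0%:Z - _)](_ : _ = 0); last first.
    by apply: (@nv_out C i j); lia.
  rewrite scaler0 add0r (_ : 0%:Z + a%:Z - a%:Z = 0); last lia.
  move=> /(memvZ (evq q (gamF tQ i a 0 a))^-1).
  by rewrite scalerA mulVf ?gam0_neq0 // scale1r.
have hm (k : nat) : M_ k \in (W : {vspace TM}).
  have := submodP (LF q k) hm0; rewrite TME T_F_m add0r.
  by rewrite (gq_diag tQ_neq0 tQ_generic) evq1 scale1r.
have hn0 : N_ 0 \in (W : {vspace TM}).
  by have := rpredB h (memvZ d (hm a)); rewrite addrK.
have hn (p : nat) : (p <= i)%N -> N_ p \in (W : {vspace TM}).
  move=> pi; have := submodP (LF q p) hn0; rewrite TME (T_F_n hl hq hql hs hi _ (leq0n i)).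
  by rewrite !add0n ltnNge pi scale0r addr0 (gq_diag tQ_neq0 tQ_generic) evq1 scale1r.
apply/eqP; rewrite eqEsubv subvf; apply/subvP => z _; rewrite (Tspace_basis z).
by apply: memvD; apply: rpred_sum => k _; rewrite memvZ ?hm ?hn // -ltnS.
Qed.

End TiltingStructure.

Section CoverMap.
Variables (C : numFieldType) (q : C) (l s i r : nat).
Hypotheses (hl : (2 <= l)%N) (hq : q != 0) (hql : l.-primitive_root (q ^+ 2)).
Hypotheses (hs : (s < l - 1)%N) (hi : i = (r * l + s)%N).
Local Notation a := (l - s - 1)%N.
Local Notation j := (i + 2 * a)%N.
Local Notation M_ := (mvec C i j).
Local Notation N_ := (nvec C i j).
Local Notation TM := (TM hl hq hql hs hi).
Local Notation DiM := (FdMod (Di hl hq hql hs hi)).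

Lemma Di_generated (W : submodule DiM) :
  (bvec C i 0 : DiM) \in (W : {vspace DiM}) -> (W : {vspace DiM}) = fullv.
Proof.
move=> h0.
have hp (p : nat) : (p <= i)%N -> (bvec C i p : DiM) \in (W : {vspace DiM}).
  move=> pi; have := submodP (LF q p) h0.
  have [_ /(_ p)[_]] := Di_weyl hl hq hql hs hi (leq0n i).
  rewrite [act _ _ _]/(Di hl hq hql hs hi (LF q p) _) => ->.
  by rewrite add0r qbinq_gq // (gq_diag tQ_neq0 tQ_generic) evq1 scale1r.
apply/eqP; rewrite eqEsubv subvf; apply/subvP => z _.
rewrite [z](row_sum_delta (z : 'rV[C]_i.+1)); apply: rpred_sum => k _; apply: memvZ.
by have := hp k (ltn_ord k); rewrite /bvec lez_nat /= -ltnS ltn_ord inord_val.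
Qed.

(** Compare coordinates in H w = i w: the weight i occurs only at p = 0 and, as j - 2a = i, at k =
    a. *)
Lemma wvec_i_coord (w : TM) : wvec l i%:Z w -> exists c d, w = c *: N_ 0 + d *: M_ a.
Proof.
move=> [_ hw]; have wb := Tspace_basis w.
exists (w.2 0 0), (w.1 0 (inord a)).
pose z : TM := (\row_k (w.1 0 k * (j%:Z - 2 * k%:Z)%:~R), \row_p (w.2 0 p * (i%:Z - 2 * p%:Z)%:~R)).
have e : i%:Z%:~R *: w = z.
  rewrite -hw {1}wb lfD !linear_sum /= (Tspace_basis z); congr (_ + _); apply: eq_bigr => k _.
    by rewrite lfZ TME T_H_m scalerA mxE.
  by rewrite lfZ TME T_H_n scalerA mxE.
have e1 (k : 'I_j.+1) : k != a :> nat -> w.1 0 k = 0.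
  move=> ka; have := congr1 (fun x : Tspace C i j => x.1 0 k) e.
  rewrite !mxE mulrC => /eqP; rewrite -subr_eq0 -mulrBr mulf_eq0 => /orP[/eqP//|].
  by rewrite -rmorphB intr_eq0; lia.
have e2 (k : 'I_i.+1) : k != 0 -> w.2 0 k = 0.
  move=> k0; have := congr1 (fun x : Tspace C i j => x.2 0 k) e.
  rewrite !mxE mulrC => /eqP; rewrite -subr_eq0 -mulrBr mulf_eq0 => /orP[/eqP//|].
  by rewrite -rmorphB intr_eq0; move: k0; rewrite -val_eqE /=; lia.
rewrite {1}wb addrC (bigD1 (0 : 'I_i.+1)) //= big1 ?addr0; last first.
  by move=> k k0; rewrite e2 ?scale0r.
have aj : (a < j.+1)%N by lia.
rewrite (bigD1 (inord a)) //= inordK // big1 ?addr0 // => k ka.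
rewrite e1 ?scale0r //; by apply: contraNneq ka => ka; apply/eqP/val_inj; rewrite /= inordK.
Qed.

Definition cover_map : 'Hom(TM, top DiM) :=
  (quot_proj (radical DiM) \o @lsnd C 'rV[C]_j.+1 'rV[C]_i.+1)%VF.

Lemma cover_mapE z : cover_map z = quot_proj (radical DiM) z.2.
Proof. by rewrite /cover_map comp_lfunE lsndE. Qed.

Lemma cover_map_hom : is_hom cover_map.
Proof. by move=> x v; rewrite !cover_mapE TME DiE; exact: (quot_projM (radical DiM)). Qed.

Lemma cover_map_surj : limg cover_map = fullv.
Proof.
apply/eqP; rewrite eqEsubv subvf; apply/subvP => w _.
have <- : cover_map ((0, vsval w) : TM) = w by rewrite cover_mapE; exact: quot_projK.
by rewrite memv_img ?memvf.
Qed.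

(** Write n_0 = x + w with x in the kernel and w in W. Projecting to weight i turns w into c n_0 + d
    m_a, still in W. If c were 0, then n_0 would lie in the kernel, because m_a does; but the image
    of n_0 in Delta_q(i) is a generator, hence not in the radical. *)
Lemma cover_map_superfluous : superfluous (lker cover_map).
Proof.
move=> W full; have [p [p1 p2]] := weight_proj i%:Z (typeI_TM hl hq hql hs hi).
have kst x v : v \in lker cover_map -> act TM x v \in lker cover_map.
  by rewrite !memv_ker cover_map_hom => /eqP->; rewrite linear0.
have : (N_ 0 : TM) \in (lker cover_map + W)%VS by rewrite full memvf.
move=> /memv_addP[x xk [w wW en]].
have [c [d e]] := wvec_i_coord (p2 w).
have kM : (M_ a : TM) \in lker cover_map by rewrite memv_ker cover_mapE linear0.
have c0 : c != 0.
  apply/eqP => c0.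
  have : (N_ 0 : TM) \in lker cover_map.
    rewrite -(p1 TM (N_ 0)); last by have [_] := wvec_n hl hq hql hs hi 0; rewrite mulr0 subr0.
    rewrite en lfD e c0 scale0r add0r memvD ?memvZ //; exact: kst.
  rewrite memv_ker cover_mapE quot_proj_eq0; apply/negP/not_in_radical => /=; last exact: Di_generated.
  move=> /(congr1 (fun x : 'rV[C]_i.+1 => x 0 0)); rewrite [bvec _ _ _](@bv_ord C i ord0) !mxE !eqxx.
  by apply/eqP/oner_neq0.
apply: (@T_generated _ _ _ _ _ _ hl hq hql hs hi W (c^-1 * d)).
have := memvZ c^-1 (submodP p wW); rewrite e scalerDr !scalerA mulVf // scale1r; exact.
Qed.

End CoverMap.

(** * Projectivity *)

Section Sequences.
Variables (F : fieldType) (t : F).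
Hypotheses (t0 : t != 0) (tgen : forall n, (0 < n)%N -> t ^+ (n * 2) != 1).
Local Notation qn := (qint t).
Let t1 : t - t^-1 != 0 := generic_subV_neq0 t0 tgen.

(* If [y] has weight [i], then E^(n) maps sum_b c_b F^(b) E^(b+v) y to
   sum_b c'_b F^(b) E^(b+v+n) y with c' = shiftE i n v c. *)
Definition shiftE (i n v : nat) (c : nat -> F) (b : nat) : F :=
  \sum_(d < n.+1) c (b + d)%N * (gq t (i + b + d + 2 * v + n)%:Z d * gq t (b + v + n)%:Z (n - d)).

Lemma shiftE1 i v c b :
  shiftE i 1 v c b = c b * qn (b + v + 1)%:Z + c b.+1 * qn (i + b + 2 * v + 2)%:Z.
Proof.
rewrite /shiftE big_ord_recl big_ord1 lift0 addn0 subn0 subnn.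
rewrite (_ : (i + b + 2 * v + 2)%N = (i + b + 1 + 2 * v + 1)%N); last lia.
by rewrite -[nat_of_ord 0]/0%N !(gq1 t1) -[gq t _ 0]/1 mul1r -[gq t _ 0]/1 mulr1 -[nat_of_ord ord0]/0%N (addn1 b).
Qed.

Lemma eq_shiftE i n v c c' : c =1 c' -> shiftE i n v c =1 shiftE i n v c'.
Proof. by move=> e b; apply: eq_bigr => d _; rewrite e. Qed.

Lemma shiftE_lin i n v (x : F) c c' b :
  shiftE i n v (fun k => c k + x * c' k) b = shiftE i n v c b + x * shiftE i n v c' b.
Proof.
rewrite /shiftE mulr_sumr -big_split; apply: eq_bigr => d _ /=.
by rewrite mulrDl -(mulrA x).
Qed.

Lemma shiftEZ i n v (x : F) c b :
  shiftE i n v (fun k => x * c k) b = x * shiftE i n v c b.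
Proof. by rewrite /shiftE mulr_sumr; apply: eq_bigr => d _; rewrite -mulrA. Qed.

Lemma gq_three_term (Z : int) (n d : nat) :
  qn (n%:Z - d%:Z) * gq t Z d.+1 + qn (Z + n%:Z - d%:Z + 1) * gq t Z d = qn n.+1%:Z * gq t (Z + 1) d.+1.
Proof.
rewrite gqSr gqS addrK.
have h : qn d.+1%:Z != 0 by apply: qint_neq0.
have := qint_cross t0 (n.+1%:Z) (Z + 1) d.+1%:Z.
rewrite (_ : n.+1%:Z - d.+1%:Z = n%:Z - d%:Z); last lia.
rewrite (_ : Z + 1 - d.+1%:Z = Z - d%:Z); last lia.
rewrite (_ : n.+1%:Z + (Z + 1) - d.+1%:Z = Z + n%:Z - d%:Z + 1); last lia.
move=> e; apply: (mulfI h); rewrite mulrDr mulrCA (mulVKf h) mulrCA [RHS]mulrCA (mulVKf h).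
rewrite mulrA [RHS]mulrA -e; ring.
Qed.

(** The coefficient form of E E^(n) = [n + 1] E^(n+1). Over Q(t) it reduces every [shiftE i n] to
    the case n = 1. *)
Lemma shiftES i n v c b :
  qn n.+1%:Z * shiftE i n.+1 v c b = shiftE i 1 (v + n) (shiftE i n v c) b.
Proof.
pose f D := c (b + D)%N * (gq t (i + b + D + 2 * v + n)%:Z D * gq t (b + v + n)%:Z (n - D))
  * qn (b + (v + n) + 1)%:Z.
pose g D := c (b.+1 + D)%N * (gq t (i + b.+1 + D + 2 * v + n)%:Z D * gq t (b.+1 + v + n)%:Z (n - D))
  * qn (i + b + 2 * (v + n) + 2)%:Z.
(* Both sides are combinations of the c (b + D) with D <= n + 1: [A D] comes from entry b of the
   inner shift, [B D] from entry b + 1, and [gq_three_term] adds them. *)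
pose A D := if (D <= n)%N then f D else 0.
pose B D := if D is D'.+1 then g D' else 0.
transitivity (\sum_(D < n.+2) (A D + B D)).
  rewrite /shiftE mulr_sumr; apply: eq_bigr => -[D /= Dn] _.
  have fE : (D <= n)%N -> f D = qn (n.+1%:Z - D%:Z) * (c (b + D)%N * (gq t (i + b + D + 2 * v + n)%:Z D
      * gq t (b + v + n.+1)%:Z (n.+1 - D))).
    move=> Dn'; rewrite /f subSn // gqS (_ : (b + v + n.+1)%:Z - 1 = (b + v + n)%:Z); last lia.
    rewrite (_ : n.+1%:Z - D%:Z = (n - D).+1%:Z); last lia.
    have h : qn (n - D).+1%:Z != 0 by apply: qint_neq0.
    rewrite (_ : (b + (v + n) + 1)%N = (b + v + n.+1)%N); last lia.
    by field.
  have -> : A D = qn (n.+1%:Z - D%:Z) * (c (b + D)%N * (gq t (i + b + D + 2 * v + n)%:Z D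
      * gq t (b + v + n.+1)%:Z (n.+1 - D))).
    rewrite /A; case: leqP => [|nD]; first exact: fE.
    by rewrite (_ : n.+1%:Z - D%:Z = 0) ?qint0 ?mul0r //; lia.
  case: D Dn {fE} => [|D] Dn.
    by rewrite addr0 subr0.
  rewrite /B /g subSS (_ : (b.+1 + D)%N = (b + D.+1)%N); last lia.
  rewrite (_ : (i + b.+1 + D + 2 * v + n)%N = (i + b + D.+1 + 2 * v + n)%N); last lia.
  rewrite (_ : (b.+1 + v + n)%N = (b + v + n.+1)%N); last lia.
  have := gq_three_term (i + b + D.+1 + 2 * v + n)%:Z n D.
  rewrite (_ : n%:Z - D%:Z = n.+1%:Z - D.+1%:Z); last lia.
  rewrite (_ : _ - D%:Z + 1 = (i + b + 2 * (v + n) + 2)%:Z); last lia.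
  rewrite (_ : (i + b + D.+1 + 2 * v + n)%:Z + 1 = (i + b + D.+1 + 2 * v + n.+1)%:Z); last lia.
  move=> e; rewrite mulrCA (mulrA (qn n.+1%:Z)) -e; ring.
rewrite big_split /= shiftE1 /shiftE; congr (_ + _).
  rewrite big_ord_recr /= /A ltnn addr0 mulr_suml; apply: eq_bigr => D _.
  by rewrite -ltnS ltn_ord.
rewrite big_ord_recl add0r mulr_suml; apply: eq_bigr => D _.
by rewrite lift0.
Qed.

Variables (i a : nat).
Local Notation j := (i + 2 * a)%N.

(* The normalized solutions of shiftE i 1 v c = 0 for v = a and v = 0. *)
Definition zeta (k : nat) : F := \prod_(x < k) - (qn (a + x.+1)%:Z / qn (j + x.+2)%:Z).
Definition psi (k : nat) : F := \prod_(x < k) - (qn x.+1%:Z / qn (i + x.+2)%:Z).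

(* The coefficients of F^(m) applied to sum_b zeta_b F^(b) E^(b+a) y. *)
Definition zetaF (m b : nat) : F := gq t b%:Z m * zeta (b - m).

Definition theta (b : nat) : F := psi b + (gq t j%:Z a)^-1 * zetaF a b.

Lemma zetaS k : zeta k.+1 = - (qn (a + k.+1)%:Z / qn (j + k.+2)%:Z) * zeta k.
Proof. by rewrite /zeta big_ord_recr [RHS]mulrC. Qed.

Lemma psiS k : psi k.+1 = - (qn k.+1%:Z / qn (i + k.+2)%:Z) * psi k.
Proof. by rewrite /psi big_ord_recr [RHS]mulrC. Qed.

Lemma shiftE1_psi b : shiftE i 1 0 psi b = 0.
Proof.
rewrite shiftE1 psiS addn0 muln0 addn0 addn1 (_ : (i + b + 2)%N = (i + b.+2)%N); last lia.
have h : qn (i + b.+2)%:Z != 0 by apply: qint_neq0 => //; lia.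
by field.
Qed.

Lemma shiftE1_zeta b : shiftE i 1 a zeta b = 0.
Proof.
rewrite shiftE1 zetaS (_ : (i + b + 2 * a + 2)%N = (j + b.+2)%N); last lia.
rewrite (_ : (b + a + 1)%N = (a + b.+1)%N); last lia.
have h : qn (j + b.+2)%:Z != 0 by apply: qint_neq0 => //; lia.
by field.
Qed.

(** The coefficient form of E F^(m+1) Z = [j - m] F^(m) Z, for Z of weight j killed by E. *)
Lemma shiftE1_zetaF m b : (m < a)%N ->
  shiftE i 1 (a - m.+1) (zetaF m.+1) b = qn (j - m)%:Z * zetaF m b.
Proof.
move=> ma; rewrite shiftE1 /zetaF subSS.
have [bm|mb] := ltnP b m.
  rewrite !(@gq_gt _ t b) ?(@gq_gt _ t b.+1); [|lia..].
  by rewrite !mul0r mulr0 addr0.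
move: mb; rewrite leq_eqVlt => /orP[/eqP<-|mb].
  rewrite (@gq_gt _ t m) // !(gq_diag t0 tgen) !mul0r add0r !mul1r mulrC.
  by congr (qn _%:Z * _); lia.
have [k ->] : exists k, b = (m.+1 + k)%N by exists (b - m.+1)%N; lia.
rewrite (_ : (m.+1 + k - m.+1)%N = k); last lia.
rewrite (_ : (m.+1 + k - m)%N = k.+1); last lia.
rewrite zetaS (gqS t (m.+1 + k).+1%:Z) gqSr.
rewrite (_ : (m.+1 + k).+1%:Z - 1 = (m.+1 + k)%:Z); last lia.
rewrite (_ : (m.+1 + k)%:Z - m%:Z = k.+1%:Z); last lia.
rewrite (_ : (m.+1 + k + (a - m.+1) + 1)%N = (a + k.+1)%N); last lia.
(* This reads [m + k + 2] [j - m + k + 1] = [m + 1] [j - m] + [k + 1] [j + k + 2]. *)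
have := qint_cross t0 (m.+1%:Z) (j - m)%:Z (- k.+1%:Z).
rewrite (_ : m.+1%:Z - - k.+1%:Z = (m.+1 + k).+1%:Z); last lia.
rewrite (_ : (j - m)%:Z - - k.+1%:Z = (i + (m.+1 + k) + 2 * (a - m.+1) + 2)%:Z); last lia.
rewrite (_ : m.+1%:Z + (j - m)%:Z - - k.+1%:Z = (j + k.+2)%:Z); last lia.
rewrite qintN.
have h : qn (j + k.+2)%:Z != 0 by apply: qint_neq0 => //; lia.
have h' : qn m.+1%:Z != 0 by apply: qint_neq0.
move: (qn (j + k.+2)%:Z) (qn m.+1%:Z) h h' => J M h h' e.
transitivity ((- qn (a + k.+1)%:Z * gq t (m.+1 + k)%:Z m * zeta k) * (M * qn (j - m)%:Z) / (M * J)).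
  by rewrite -e; field; rewrite h h'.
by field; rewrite h h'.
Qed.

Lemma shiftE_zeta n b : (0 < n)%N -> shiftE i n a zeta b = 0.
Proof.
case: n => // n _; elim: n b => [|n IH] b; first exact: shiftE1_zeta.
apply: (mulfI (qint_neq0 t0 tgen (n := n.+2%:Z) isT)); rewrite shiftES mulr0 shiftE1.
by rewrite !IH !mul0r addr0.
Qed.

(** The coefficient form of E^(v) Y = mu F^(a - v) Z. For v = 1 the part psi contributes nothing;
    each further E sends F^(m) Z to a multiple of F^(m - 1) Z. *)
Lemma shiftE_theta_ex v : (0 < v <= a)%N ->
  exists mu, forall b, shiftE i v 0 theta b = mu * zetaF (a - v) b.
Proof.
elim: v => // -[_ a0|v IH va].
  exists ((gq t j%:Z a)^-1 * qn (j - a.-1)%:Z) => b; rewrite /theta shiftE_lin shiftE1_psi add0r.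
  case: (a) a0 (shiftE1_zetaF (m := a.-1) b) => // a' _ /=; rewrite ltnSn subnn => -> //.
  by rewrite subn1 mulrA.
have [mu h] := IH (ltac:(lia)); exists ((qn v.+2%:Z)^-1 * (mu * qn (j - (a - v.+2))%:Z)) => b.
have nz : qn v.+2%:Z != 0 by apply: qint_neq0.
apply: (mulfI nz); rewrite shiftES (eq_shiftE _ _ _ h) shiftEZ add0n.
have := @shiftE1_zetaF (a - v.+2) b (ltac:(lia)).
rewrite (_ : (a - (a - v.+2).+1)%N = v.+1); last lia.
rewrite (_ : (a - v.+2).+1 = a - v.+1)%N; last lia.
by move=> ->; move: (qn v.+2%:Z) nz => x nz; rewrite mulrA [in RHS]mulrA (mulVKf nz).
Qed.

Lemma zetaF_diag m : zetaF m m = 1.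
Proof. by rewrite /zetaF subnn (gq_diag t0 tgen) mul1r /zeta big_ord0. Qed.

(** The factor mu is rewritten as entry a - v of the shifted sequence, where [zetaF] is 1. In this
    form it is regular at q as soon as theta is, although the construction of mu divides by
    [j choose a]. *)
Lemma shiftE_theta v b : (0 < v <= a)%N ->
  shiftE i v 0 theta b = shiftE i v 0 theta (a - v) * zetaF (a - v) b.
Proof. by move=> /shiftE_theta_ex[mu h]; rewrite !h zetaF_diag mulr1. Qed.

(** At v = a the shifted sequence is a multiple of zeta, which every further E kills. *)
Lemma shiftE_theta_gt v b : (0 < a)%N -> (a < v)%N -> shiftE i v 0 theta b = 0.
Proof.
move=> a0; elim: v b => // v IH b; rewrite ltnS leq_eqVlt => av.
apply: (mulfI (qint_neq0 t0 tgen (n := v.+1%:Z) isT)); rewrite shiftES mulr0 add0n.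
move: av => /orP[/eqP<-|av]; last by rewrite shiftE1 !IH // !mul0r addr0.
have h c : shiftE i a 0 theta c = shiftE i a 0 theta 0 * zeta c.
  by rewrite shiftE_theta ?a0 ?leqnn // subnn /zetaF subn0 mul1r.
by rewrite (eq_shiftE _ _ _ h) shiftEZ shiftE1_zeta mulr0.
Qed.

End Sequences.

Section GqShift.
Variables (C : numFieldType) (q : C) (l : nat).
Hypotheses (hl : (2 <= l)%N) (hq : q != 0) (hql : l.-primitive_root (q ^+ 2)).

(** [d]! is nonzero at q, and the shift by lm multiplies each of the d factors of the numerator by
    q^(lm). *)
Lemma gqq_addl (m c : int) d : (d < l)%N ->
  evq q (gq tQ (l%:Z * m + c) d) = (q ^ (l%:Z * m)) ^+ d * evq q (gq tQ c d).
Proof.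
move=> dl; have f0 := qfactq_neq0 hl hq hql dl.
have h c' : evq q (qfact tQ d) * evq q (gq tQ c' d) = \prod_(x < d) qint q (c' - x%:Z).
  rewrite -evqM; [|exact: reg_qfact hl hq hql _|exact: reg_gq hq _ _].
  rewrite (gq_fact tQ_neq0 tQ_generic); apply: evq_eq.
  by apply: ev_prod => x _; exact: ev_qintq hl hq hql _.
apply: (mulfI f0); rewrite h mulrCA h.
have -> : (q ^ (l%:Z * m)) ^+ d = \prod_(x < d) q ^ (l%:Z * m) by rewrite prodr_const card_ord.
rewrite -big_split.
by apply: eq_bigr => x _; rewrite -addrA (qintq_addl hq hql).
Qed.

End GqShift.

(** * Closed form of theta from index a on, with a + 1 written for a *)

Section ThetaFormula.
Variables (F : fieldType) (t : F).
Hypotheses (t0 : t != 0) (tgen : forall n, (0 < n)%N -> t ^+ (n * 2) != 1).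
Variables (i a : nat).
Local Notation qn := (qint t).
Local Notation N := (i + a.+1 + 1)%N.
Local Notation j := (i + 2 * a.+1)%N.
Local Notation u y := (qn (N + y)%:Z / qn y%:Z).

(** In this form, with a negative top, psi can be evaluated at q by [gqq_addl]. *)
Lemma psiE k : psi t i k = (gq t (- (i.+2)%:Z) k)^-1.
Proof.
elim: k => [|k IH]; first by rewrite /psi big_ord0 invr1.
rewrite psiS IH gqSr (_ : - i.+2%:Z - k%:Z = - (i + k.+2)%:Z); last by clear; lia.
rewrite qintN; move: (qn _) (qn _) (gq _ _ _) => x y g.
by rewrite !invfM invrK invrN; ring.
Qed.

Lemma zetaE k : zeta t i a.+1 k = (-1) ^+ k * \prod_(x < k) (u (a.+1 + x.+1))^-1.
Proof.
have -> : (-1) ^+ k = \prod_(x < k) (-1 : F) by rewrite prodr_const card_ord.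
rewrite /zeta -big_split /=; apply: eq_bigr => x _.
by rewrite invf_div mulN1r; congr (- (_ / qn _%:Z)); clear; lia.
Qed.

Lemma psi_add k : psi t i (a.+1 + k) =
  - ((-1) ^+ k * (qn a.+1%:Z / qn N%:Z) * gq t (a.+1 + k)%:Z a.+1
     * (psi t i a * \prod_(x < k) (u x.+1)^-1)).
Proof.
elim: k => [|k IH].
  rewrite addn0 (gq_diag t0 tgen) big_ord0 mul1r !mulr1 psiS.
  by rewrite (_ : (i + a.+2)%N = N); [rewrite mulNr | lia].
rewrite addnS psiS IH big_ord_recr exprS.
rewrite (gq_sym t0 tgen a.+1 k) -addnS (gq_sym t0 tgen a.+1 k.+1) (gqS t (a.+1 + k.+1)%:Z).
rewrite (_ : (a.+1 + k.+1)%:Z - 1 = (a.+1 + k)%:Z); last lia.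
rewrite (_ : (i + (a.+1 + k.+1).+1)%N = (N + k.+1)%N) /=; last lia.
have h : qn k.+1%:Z != 0 by apply: qint_neq0.
have h' : qn (N + k.+1)%:Z != 0 by apply: qint_neq0 => //; lia.
move: (qn k.+1%:Z) (qn (N + k.+1)%:Z) (qn N%:Z)^-1 h h' => x y z h h'.
by field; rewrite h h'.
Qed.

(** [psi_add] extracts [a + 1]/[N] from psi, and [j choose a + 1] = [j choose a] [N]/[a + 1]
    extracts it from the other summand. The pole at q is thus isolated in 1/[N], and regularity
    becomes the vanishing of the cofactor at q. *)
Lemma theta_add k : theta t i a.+1 (a.+1 + k) =
  (-1) ^+ k * (qn a.+1%:Z / qn N%:Z) * gq t (a.+1 + k)%:Z a.+1
  * ((gq t j%:Z a)^-1 * \prod_(x < k) (u (a.+1 + x.+1))^-1 - psi t i a * \prod_(x < k) (u x.+1)^-1).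
Proof.
rewrite /theta psi_add /zetaF addKn zetaE (gqSr t j%:Z).
rewrite (_ : j%:Z - a%:Z = N%:Z); last lia.
move: (qn _) (qn _) (gq _ _ _) (gq _ _ _) => x y g h.
by rewrite !invfM invrK; ring.
Qed.

End ThetaFormula.

(** * Regularity of zeta and theta at q *)

Section SequencesAtQ.
Variables (C : numFieldType) (q : C) (l s i r : nat).
Hypotheses (hl : (2 <= l)%N) (hq : q != 0) (hql : l.-primitive_root (q ^+ 2)).
Hypotheses (hs : (s < l - 1)%N) (hi : i = (r * l + s)%N).
Local Notation a := (l - s - 1)%N.
Local Notation j := (i + 2 * a)%N.
Local Notation gqq c d := (evq q (gq tQ c d)).
Local Notation qn := (qint tQ).
Local Notation Q := (q ^ (l%:Z * r.+1%:Z)).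

Definition unit_ratio (y : nat) : Qt := qn (l * r.+1 + y)%:Z / qn y%:Z.
Local Notation u := unit_ratio.

Lemma unit_ratioP y : (0 < y)%N ->
  [/\ reg q (u y), evq q (u y) != 0 & ~~ (l %| y)%N -> evq q (u y) = Q].
Proof.
move=> y0; have [v hv [v0 hv']] := ratio_unit hl hq hql r.+1 y0.
by rewrite (evq_eq hv); split=> //; exists v.
Qed.

Lemma prod_unit_ratio k m : ev q (\prod_(x < k) (u (m + x.+1))^-1) (\prod_(x < k) evq q (u (m + x.+1)))^-1.
Proof.
elim: k => [|k IH]; first by rewrite !big_ord0 invr1; exact: ev1.
rewrite big_ord_recr [X in ev _ _ X^-1]big_ord_recr [X in ev _ _ X]invfM; apply: evM => //.
have [h1 h2 _] := @unit_ratioP (m + k.+1)%N (ltac:(lia)).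
by apply: evV => //; apply: evqP.
Qed.

Lemma reg_zeta k : reg q (zeta tQ i a k).
Proof.
have a0 := a_gt0 hs; have eN := N_eq hs hi; rewrite -(prednK a0) zetaE; apply: regM.
  by apply: (reg_laurent hq); have := is_laurent_int ((-1) ^+ k); rewrite rmorphXn rmorphN1.
exists (\prod_(x < k) evq q (u (a + x.+1)))^-1.
by rewrite (prednK a0) eN; apply: prod_unit_ratio.
Qed.

Lemma ev_gq_ja : evq q (gq tQ j%:Z a.-1) = Q ^+ a.-1.
Proof.
have a0 := a_gt0 hs; have al := a_lt_l hl hs; have eN := N_eq hs hi.
rewrite (_ : j%:Z = l%:Z * r.+1%:Z + a.-1%:Z); last by rewrite -PoszM -eN; lia.
rewrite (gqq_addl hl hq hql); last lia.
by rewrite (gq_diag tQ_neq0 tQ_generic) evq1 mulr1.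
Qed.

(** -(i + 2) = -N + (a - 1), while j = N + (a - 1) in [ev_gq_ja]. The equality of the two values is
    what makes the singular parts of theta cancel. *)
Lemma ev_gq_i : evq q (gq tQ (- i.+2%:Z) a.-1) = Q ^+ a.-1.
Proof.
have a0 := a_gt0 hs; have al := a_lt_l hl hs; have eN := N_eq hs hi.
rewrite (_ : - i.+2%:Z = l%:Z * (- r.+1%:Z) + a.-1%:Z); last by rewrite mulrN -PoszM -eN; lia.
rewrite (gqq_addl hl hq hql); last lia.
by rewrite (gq_diag tQ_neq0 tQ_generic) evq1 mulr1 mulrN (qpow_l hq hql).
Qed.

(** As -(i + 2) = -N + (a - 1), the denominator is at q a unit times [a - 1 choose k], which is
    nonzero for k <= a - 1 < l. *)
Lemma reg_psi k : (k < a)%N -> reg q (psi tQ i k).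
Proof.
have al := a_lt_l hl hs; have eN := N_eq hs hi.
move=> ka; rewrite psiE; apply: regV; first exact: reg_gq hq _ _.
have lr : l%:Z * r.+1%:Z = (i + a + 1)%:Z by rewrite -PoszM eN.
rewrite (_ : - i.+2%:Z = l%:Z * (- r.+1%:Z) + a.-1%:Z); last by rewrite mulrN lr; lia.
rewrite (gqq_addl hl hq hql); last lia.
rewrite mulf_neq0 ?expf_neq0 ?expfz_neq0 //.
have := congr1 (evq q) (gq_fact tQ_neq0 tQ_generic a.-1%:Z k).
rewrite evqM; [|exact: reg_qfact hl hq hql _|exact: reg_gq hq _ _] => e.
have : evq q (qfact tQ k) * gqq a.-1%:Z k != 0.
  rewrite e; have h : ev q (\prod_(x < k) qn (a.-1%:Z - x%:Z)) (\prod_(x < k) qint q (a.-1%:Z - x%:Z)).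
    by apply: ev_prod => x _; exact: ev_qintq hl hq hql _.
  rewrite (evq_eq h); apply/prodf_neq0 => -[x xk] _ /=.
  rewrite subzn ?(qintq_nat_eq0 hl hq hql); last lia.
  by rewrite gtnNdvd //; lia.
by rewrite mulf_eq0 negb_or => /andP[].
Qed.

(* In [theta_add] the q-binomial vanishes at q if l divides one of k+1, ..., k+a; otherwise all
   the ratios involved take the value q^N, and the difference vanishes. *)
Lemma reg_theta b : reg q (theta tQ i a b).
Proof.
have a0 := a_gt0 hs; have al := a_lt_l hl hs; have eN := N_eq hs hi.
have [ba|ab] := ltnP b a.
  by rewrite /theta /zetaF (gq_gt _ ba) mul0r mulr0 addr0; exact: reg_psi.
rewrite -(subnKC ab); move: (b - a)%N => {b ab} k.
have := theta_add tQ_neq0 tQ_generic i a.-1 k; rewrite (prednK a0) eN => ->.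
have sgn : reg q ((-1) ^+ k).
  by apply: (reg_laurent hq); have := is_laurent_int ((-1) ^+ k); rewrite rmorphXn rmorphN1.
have e1 := prod_unit_ratio k a; have e2 : ev q (\prod_(x < k) (u x.+1)^-1) (\prod_(x < k) evq q (u x.+1))^-1.
  exact: (prod_unit_ratio k 0).
have Q0 : Q ^+ a.-1 != 0 by rewrite expf_neq0 ?expfz_neq0.
have e3 : ev q (gq tQ j%:Z a.-1)^-1 (Q ^+ a.-1)^-1.
  by rewrite -ev_gq_ja; apply: evV; [rewrite ev_gq_ja | apply/evqP/(reg_gq hq)].
have e4 : ev q (psi tQ i a.-1) (Q ^+ a.-1)^-1.
  by rewrite psiE -ev_gq_i; apply: evV; [rewrite ev_gq_i | apply/evqP/(reg_gq hq)].
have e5 := evB (evM e3 e1) (evM e4 e2).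
set X := _ - _ in e5 *; set g := gq _ _ _.
have rg : reg q g by apply: reg_gq hq _ _.
have ra : reg q (qn a%:Z) by apply: reg_qint hl hq hql _.
suff h : ev q (g * X) 0.
  have := reg_div_qint hl hq hql (ltn0Sn r) h => h'.
  have -> (x y z w v : Qt) : x * (y * z) * w * v = x * y * (w * v * z).
    by rewrite -!mulrA; do 2 congr (_ * _); rewrite [LHS]mulrC mulrA.
  by apply: regM => //; apply: regM.
have [/existsP[y /andP[y0 ly]]|no] := boolP [exists y : 'I_a.+1, (0 < y)%N && (l %| k + y)%N].
  have g0 : evq q g = 0.
    apply: (gqq_eq0 hl hq hql al); exists (a - y)%N; first by have := ltn_ord y; lia.
    by rewrite (_ : (a + k - (a - y) = k + y)%N) ?ly /=; have := ltn_ord y; lia.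
  by have := evM (evqP rg) e5; rewrite g0 mul0r.
(* Split the product of the first a + k ratios after a and after k. The blocks with indices 1, ...,
   a and k + 1, ..., k + a contain no multiple of l, so both equal Q^a and can be cancelled. *)
suff z : (\prod_(x < k) evq q (u (a + x.+1))) = \prod_(x < k) evq q (u x.+1).
  by have := evM (evqP rg) e5; rewrite z subrr mulr0.
have uQ y : (0 < y)%N -> ~~ (l %| y)%N -> evq q (u y) = Q by move=> /unit_ratioP[_ _ h] /h.
have p1 : \prod_(x < a) evq q (u x.+1) = Q ^+ a.
  rewrite -[RHS](_ : \prod_(x < a) Q = _); last by rewrite prodr_const card_ord.
  by apply: eq_bigr => -[x xa] _; rewrite uQ // gtnNdvd //= (leq_trans _ al).
have p2 : \prod_(x < a) evq q (u (k + x.+1)) = Q ^+ a.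
  rewrite -[RHS](_ : \prod_(x < a) Q = _); last by rewrite prodr_const card_ord.
  apply: eq_bigr => -[x xa] _; rewrite uQ //=; first by rewrite addnS.
  apply: contraNN no => h; apply/existsP; exists (inord x.+1).
  by rewrite inordK.
have sp m n : \prod_(x < m + n) evq q (u x.+1) =
    (\prod_(x < m) evq q (u x.+1)) * \prod_(x < n) evq q (u (m + x.+1)).
  by rewrite big_split_ord; congr (_ * _); apply: eq_bigr => x _; rewrite addnS.
have := sp k a; rewrite addnC sp p1 p2 mulrC; apply: mulIf.
by rewrite expf_neq0 ?expfz_neq0.
Qed.

End SequencesAtQ.

Lemma sum_shift (V : nmodType) (h : nat -> V) d K : (forall b, (K <= b + d)%N -> h b = 0) ->
  \sum_(b < K) (if (d <= b)%N then h (b - d)%N else 0) = \sum_(b < K) h b.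
Proof.
have [Kd|dK] := leqP K d => h0.
  rewrite !big1 // => b _; first by rewrite h0 // (leq_trans Kd) ?leq_addl.
  by rewrite leqNgt (leq_trans (ltn_ord b) Kd).
have eK : K = (d + (K - d))%N by rewrite subnKC // ltnW.
move: (K - d)%N eK h0 => m -> h0; rewrite big_split_ord /= big1 ?add0r; last first.
  by move=> b _; rewrite leqNgt ltn_ord.
rewrite addnC big_split_ord /= [X in _ + X]big1 ?addr0; last first.
  by move=> b _; rewrite h0 //; clear; lia.
by apply: eq_bigr => b _; rewrite leq_addr addKn.
Qed.

(** * Submodules generated by a vector that is highest weight modulo U *)

Section HighestWeight.
Variables (C : numFieldType) (q : C) (l : nat).
Hypotheses (hl : (2 <= l)%N) (hq : q != 0) (hql : l.-primitive_root (q ^+ 2)).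

Lemma lfun_add_sub (V : vectType C) (A : 'End(V)) (U S : {vspace V}) (X : seq V) :
  {in U, forall v, A v \in S} -> {in X, forall v, A v \in S} ->
  {in (U + <<X>>)%VS, forall v, A v \in S}.
Proof.
move=> hU hX v /(memv_img A); rewrite limgD limg_span; apply: subvP.
rewrite subv_add; apply/andP; split.
  by apply/subvP => _ /memv_imgP[w wU ->]; exact: hU.
by apply/span_subvP => _ /mapP[w wX ->]; exact: hX.
Qed.

(** Used twice: for Z of weight j over U = 0, then for Y of weight i over the submodule obtained
    from Z. *)
Definition hw_span (M : LUmod q) (U : {vspace M}) (i : nat) (Y : M) : {vspace M} :=
  (U + <<[seq act M (LF q p) Y | p <- iota 0 i.+1]>>)%VS.

Lemma hw_span_mem (M : LUmod q) (U : {vspace M}) i Y : typeI l M -> stable U -> wvec l i%:Z Y ->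
  (forall v, (0 < v)%N -> act M (LE q v) Y \in U) ->
  forall p, act M (LF q p) Y \in hw_span U i Y.
Proof.
move=> tM sU wY hE p; have [pi|ip] := leqP p i.
  apply: (subvP (addvSr _ _)); apply/memv_span/mapP; exists p => //.
  by rewrite mem_iota /= add0n ltnS.
by apply: (subvP (addvSl _ _)); exact: (weyl_vanish hl hq hql tM sU wY hE ip).
Qed.

(** In the expansion of E^(n) F^(p) Y into the F^(p - d) E^(n - d) Y, the terms with d < n lie in U
    and d = n gives F^(p - n) Y. Under F, the vectors with index beyond i fall into U by
    [weyl_vanish]. *)
Lemma hw_span_stable (M : LUmod q) (U : {vspace M}) i Y : typeI l M -> stable U -> wvec l i%:Z Y ->
  (forall v, (0 < v)%N -> act M (LE q v) Y \in U) -> stable (hw_span U i Y).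
Proof.
move=> tM sU wY hE; have hF := hw_span_mem tM sU wY hE.
have US v : v \in U -> v \in hw_span U i Y by apply: (subvP (addvSl _ _)).
apply: (stable_gens hq) => [|n|n]; apply: lfun_add_sub.
- by move=> v vU; apply/US/sU.
- by move=> _ /mapP[p _ ->]; have [-> _] := wvec_F hl hq hql p wY; apply: memvZ.
- by move=> v vU; apply/US/sU.
- move=> _ /mapP[p _ ->]; rewrite (act_EF hl hq hql _ _ wY); apply: rpred_sum => d _; apply: memvZ.
  rewrite /Fsub; case: leqP => dp; last exact: mem0v.
  have [nd|nd] := posnP (n - d)%N; first by rewrite nd act_E0.
  by apply/US/sU/hE.
- by move=> v vU; apply/US/sU.
- by move=> _ /mapP[p _ ->]; rewrite act_FF // memvZ.
Qed.

Lemma dim_hw_span (M : LUmod q) (U : {vspace M}) i Y : (\dim (hw_span U i Y) <= \dim U + i.+1)%N.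
Proof.
have [h _] := dimv_add_leqif U <<[seq act M (LF q p) Y | p <- iota 0 i.+1]>>.
apply: leq_trans h _; rewrite leq_add2l.
by apply: leq_trans (dim_span _) _; rewrite size_map size_iota.
Qed.

End HighestWeight.

Section GraphHom.
Variables (k : fieldType) (X : Type) (rels : nc_expr k X -> nc_expr k X -> Prop).
Variables (P M : fdmod rels).

(** Surjectivity and the bound on the dimension make the first projection bijective on S, so that S
    is the graph of a homomorphism. *)
Lemma graph_hom (S : {vspace dsum P M}) : stable S ->
  (forall x : P, exists2 z : dsum P M, z \in S & z.1 = x) -> (\dim S <= \dim {: P})%N ->
  exists2 h : 'Hom(P, M), is_hom h & forall z : dsum P M, z \in S -> h z.1 = z.2.
Proof.
move=> sS onto dS.
have im : (@lfst k P M @: S)%VS = fullv.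
  apply/eqP; rewrite eqEsubv subvf; apply/subvP => x _; have [z zS <-] := onto x.
  by rewrite -[z.1]lfstE memv_img.
have ker z : z \in S -> z.1 = 0 -> z = 0.
  move=> zS z1; have := limg_ker_dim (@lfst k P M) S; rewrite im => e.
  move: dS; rewrite -e -[X in (_ <= X)%N]add0n leq_add2r leqn0 dimv_eq0 => /eqP e0; apply/eqP; rewrite -memv0 -e0 memv_cap zS memv_ker.
  by rewrite lfstE z1 eqxx.
pose g x := sval (cid2 (onto x)).
have gS x : g x \in S by rewrite /g; case: cid2.
have g1 x : (g x).1 = x by rewrite /g; case: cid2.
have uniq z : z \in S -> g z.1 = z.
  move=> zS; apply/eqP; rewrite -subr_eq0; apply/eqP/ker; first by rewrite rpredB.
  by rewrite /= g1 subrr.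
have lin : linear (fun x : P => (g x).2 : M).
  move=> c x y; have := uniq (c *: g x + g y); rewrite memvD ?memvZ // => /(_ isT).
  by rewrite /= !g1 => ->.
have [h hE] := lfun_of_linear lin; exists h => [x v|z zS]; last by rewrite hE uniq.
have := uniq (act (dsum P M) x (g v)); rewrite sS // dsumE /= => /(_ isT).
by rewrite !hE g1 => ->.
Qed.

End GraphHom.

Section SequenceOperators.
Variables (C : numFieldType) (q : C) (l : nat).
Hypotheses (hl : (2 <= l)%N) (hq : q != 0) (hql : l.-primitive_root (q ^+ 2)).
Local Notation gqq c d := (evq q (gq tQ c d)).

(** The sum over all b, cut at a K from which on E^(b) y = 0. The coefficients stay in Q(t) until
    the end, so that [shiftE] can be applied to them there. *)
Definition seqop (M : LUmod q) (K v : nat) (c : nat -> Qt) (y : M) : M :=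
  \sum_(b < K) evq q (c b) *: act M (LF q b) (act M (LE q (b + v)) y).

Lemma seqop_hom (M N : LUmod q) (g : 'Hom(M, N)) K v c y : is_hom g ->
  g (seqop K v c y) = seqop K v c (g y).
Proof.
by move=> hg; rewrite /seqop linear_sum /=; apply: eq_bigr => b _; rewrite lfZ !hg.
Qed.

Lemma wvec_seqop (M : LUmod q) K v c (i : nat) (y : M) : wvec l i%:Z y ->
  wvec l (i + 2 * v)%:Z (seqop K v c y).
Proof.
move=> wy; apply: wvec_sum => b _; apply: wvecZ.
have := wvec_F hl hq hql b (wvec_E hl hq hql (b + v) wy).
by rewrite (_ : _ - _ = (i + 2 * v)%:Z) //; lia.
Qed.

Variables (M : LUmod q) (K i : nat) (y : M).
Hypothesis wy : wvec l i%:Z y.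
Hypothesis yK : forall b, (K <= b)%N -> act M (LE q b) y = 0.

Lemma reg_shiftE n v c : (forall b, reg q (c b)) -> forall b, reg q (shiftE tQ i n v c b).
Proof.
move=> rc b; apply: reg_sum => d _; apply: regM => //; apply: regM; exact: reg_gq hq _ _.
Qed.

Lemma act_E_seqop n v c : (forall b, reg q (c b)) ->
  act M (LE q n) (seqop K v c y) = seqop K (v + n) (shiftE tQ i n v c) y.
Proof.
move=> rc.
pose h d b := (evq q (c (b + d)%N) * (gqq (i + b + d + 2 * v + n)%:Z d * gqq (b + v + n)%:Z (n - d)))
  *: act M (LF q b) (act M (LE q (b + (v + n))) y).
transitivity (\sum_(b < K) \sum_(d < n.+1) if (d <= b)%N then h d (b - d)%N else 0).
  rewrite /seqop linear_sum /=; apply: eq_bigr => b _; rewrite lfZ.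
  rewrite (act_EF hl hq hql _ _ (wvec_E hl hq hql (b + v) wy)) scaler_sumr.
  apply: eq_bigr => -[d dn] _; rewrite /= /Fsub; case: leqP => db; last by rewrite !scaler0.
  rewrite act_EE // lfZ /h !scalerA -!mulrA subnK //.
  rewrite (_ : i%:Z + (2 * (b + v))%:Z + n%:Z - b%:Z = (i + (b - d) + d + 2 * v + n)%:Z); last lia.
  rewrite (_ : (n - d + (b + v))%N = (b - d + (v + n))%N); last lia.
  by rewrite addnA.
(* Since d <= n, replacing b by b + d changes the range only by terms that contain some E^(b') y
   with b' >= K. *)
have sh (d : 'I_n.+1) : \sum_(b < K) (if (d <= b)%N then h d (b - d)%N else 0) = \sum_(b < K) h d b.
  apply: sum_shift => b Kb; have dn := ltn_ord d.
  by rewrite /h [act M (LE q _) y]yK ?linear0 ?scaler0 //; lia.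
rewrite exchange_big /= (eq_bigr _ (fun d _ => sh d)).
rewrite exchange_big /=; apply: eq_bigr => b _; rewrite -scaler_suml; congr (_ *: _).
rewrite evq_sum; last by move=> d _; apply: regM => //; apply: regM; exact: reg_gq hq _ _.
apply: eq_bigr => d _; rewrite !evqM //; try exact: reg_gq hq _ _.
by apply: regM; exact: reg_gq hq _ _.
Qed.

Lemma act_F_seqop m v c : (m <= v)%N -> (forall b, reg q (c b)) ->
  act M (LF q m) (seqop K v c y) = seqop K (v - m) (fun b => gq tQ b%:Z m * c (b - m)%N) y.
Proof.
move=> mv rc.
pose h b := (evq q (c b) * gqq (m + b)%:Z m) *: act M (LF q (m + b)) (act M (LE q (b + v)) y).
transitivity (\sum_(b < K) h b).
  rewrite /seqop linear_sum /=; apply: eq_bigr => b _.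
  by rewrite lfZ act_FF // /h scalerA.
rewrite -(@sum_shift _ _ m); last first.
  by move=> b Kb; rewrite /h yK ?linear0 ?scaler0 //; lia.
apply: eq_bigr => b _; case: leqP => mb; last first.
  by rewrite (gq_gt _ mb) mul0r evq0 scale0r.
rewrite /h subnKC // evqM //; last exact: reg_gq hq _ _.
by rewrite mulrC (_ : (b - m + v)%N = (b + (v - m))%N) //; lia.
Qed.

End SequenceOperators.

Section LiftVectors.
Variables (C : numFieldType) (q : C) (l s i r : nat).
Hypotheses (hl : (2 <= l)%N) (hq : q != 0) (hql : l.-primitive_root (q ^+ 2)).
Hypotheses (hs : (s < l - 1)%N) (hi : i = (r * l + s)%N).
Local Notation a := (l - s - 1)%N.
Variables (M : LUmod q) (K : nat) (y : M).
Hypothesis wy : wvec l i%:Z y.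
Hypothesis yK : forall b, (K <= b)%N -> act M (LE q b) y = 0.
Local Notation Y := (seqop K 0 (theta tQ i a) y).
Local Notation Z := (seqop K a (zeta tQ i a) y).

Lemma seqop_eq0 v c : (forall b, c b = 0) -> seqop K v c y = 0.
Proof. by move=> c0; apply: big1 => b _; rewrite c0 evq0 scale0r. Qed.

Lemma E_zeta n : (0 < n)%N -> act M (LE q n) Z = 0.
Proof.
move=> n0; rewrite (act_E_seqop hl hq hql wy yK); last exact: reg_zeta hl hq hql hs hi.
by apply: seqop_eq0 => b; exact: shiftE_zeta tQ_neq0 tQ_generic _ _ _ _ n0.
Qed.

Lemma E_theta v : (0 < v)%N -> exists c k, act M (LE q v) Y = c *: act M (LF q k) Z.
Proof.
have rt := reg_theta hl hq hql hs hi; have rz := reg_zeta hl hq hql hs hi.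
move=> v0; rewrite (act_E_seqop hl hq hql wy yK) // add0n.
have [va|av] := leqP v a; last first.
  exists 0, 0%N; rewrite scale0r; apply: seqop_eq0 => b.
  by apply: shiftE_theta_gt => //; [exact: tQ_neq0 | exact: tQ_generic | exact: a_gt0].
exists (evq q (shiftE tQ i v 0 (theta tQ i a) (a - v))), (a - v)%N.
rewrite (act_F_seqop hl hq hql yK) ?leq_subr // /seqop scaler_sumr.
apply: eq_bigr => b _; rewrite scalerA subKn //; congr (_ *: _).
rewrite (shiftE_theta tQ_neq0 tQ_generic) ?v0 // evqM //; first exact: reg_shiftE.
by apply: regM => //; exact: reg_gq hq _ _.
Qed.

End LiftVectors.

Section Projectivity.
Variables (C : numFieldType) (q : C) (l s i r : nat).
Hypotheses (hl : (2 <= l)%N) (hq : q != 0) (hql : l.-primitive_root (q ^+ 2)).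
Hypotheses (hs : (s < l - 1)%N) (hi : i = (r * l + s)%N).
Local Notation a := (l - s - 1)%N.
Local Notation j := (i + 2 * a)%N.
Local Notation M_ := (mvec C i j).
Local Notation N_ := (nvec C i j).
Local Notation Tq := (Tq hl hq hql hs hi).
Local Notation TM := (TM hl hq hql hs hi).

(** theta_0 = 1, and for b > 0 the vector E^(b) n_0 has no n-component, so F^(b) E^(b) n_0 is a
    multiple of m_a. *)
Lemma theta_N K : exists d, seqop K.+1 0 (theta tQ i a) (N_ 0 : TM) = N_ 0 + d *: M_ a.
Proof.
have a0 := a_gt0 hs.
have hb (b : nat) : exists e, act TM (LF q b.+1) (act TM (LE q b.+1) (N_ 0)) = e *: M_ a.
  have nz : N_ (0%:Z - b.+1%:Z) = 0 by rewrite [LHS](_ : _ = 0) //; apply: (@nv_out C i j); lia.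
  rewrite !TME (T_E_n hl hq hql hs hi _ (leq0n i)) nz.
  rewrite scaler0 add0r lfZ T_F_m scalerA subrK add0r.
  by eexists.
have th0 : theta tQ i a 0 = 1.
  have g0 : gq tQ 0%:Z a = 0 by apply: gq_gt.
  by rewrite /theta /zetaF g0 mul0r mulr0 addr0 /psi big_ord0.
rewrite /seqop big_ord_recl act_F0 act_E0 -[nat_of_ord ord0]/0%N th0 evq1 scale1r.
have [d ->] : exists d, \sum_(b < K) evq q (theta tQ i a (lift ord0 b)) *:
   act TM (LF q (lift ord0 b)) (act TM (LE q (lift ord0 b + 0)) (N_ 0)) = d *: M_ a.
  elim/big_ind: _ => [|_ _ [d ->] [e ->]|b _].
  - by exists 0; rewrite scale0r.
  - by exists (d + e); rewrite scalerDl.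
  by rewrite addn0 lift0; have [e ->] := hb b; rewrite scalerA; eexists.
by exists d.
Qed.

Lemma dim_TM : \dim {: TM} = (j.+1 + i.+1)%N.
Proof. by rewrite dimvf [LHS]/(1 * j.+1 + 1 * i.+1)%N !mul1n. Qed.

Lemma TM_projective : projective_in (@typeI _ q l) TM.
Proof.
move=> M N g f tM tN hg hf sg; have a0 := a_gt0 hs.
have wN0 : wvec l i%:Z (N_ 0 : TM) by have := wvec_n hl hq hql hs hi 0; rewrite mulr0 subr0.
have [p [p1 p2]] := weight_proj i%:Z tM.
have [y0 _ gy0] : exists2 y0, y0 \in fullv & f (N_ 0) = g y0.
  by apply/memv_imgP; rewrite sg memvf.
(* The preimage must be a weight vector; projecting it keeps its image, because f n_0 has weight i
   already. *)
pose y := act M p y0.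
have gy : g y = f (N_ 0).
  by rewrite /y hg -gy0 p1 // -hf; have [_ ->] := wN0; rewrite lfZ.
pose X := dsum TM M; have tX : typeI l X := typeI_dsum (typeI_TM hl hq hql hs hi) tM.
pose yy : X := (N_ 0, y).
have wyy : wvec l i%:Z yy.
  have [k1 h1] := wN0; have [k2 h2] := p2 y0.
  by split; rewrite dsumE /= ?k1 ?k2 ?h1 ?h2.
have [B hB] := typeI_bound tX.
(* E^(b) raises the weight by 2b, beyond the bound B on the weights of X. *)
have yK b : (B.+1 <= b)%N -> act X (LE q b) yy = 0.
  by move=> Bb; apply: hB (wvec_E hl hq hql b wyy) _; lia.
pose Y := seqop B.+1 0 (theta tQ i a) yy; pose Z := seqop B.+1 a (zeta tQ i a) yy.
have wY : wvec l i%:Z Y by have := wvec_seqop hl hq hql B.+1 0 (theta tQ i a) wyy; rewrite addn0.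
have wZ : wvec l j%:Z Z by have := wvec_seqop hl hq hql B.+1 a (zeta tQ i a) wyy.
have st0 : stable (M := X) 0%VS by move=> x v; rewrite !memv0 => /eqP->; rewrite linear0.
have EZ n : (0 < n)%N -> act X (LE q n) Z \in 0%VS.
  by move=> n0; rewrite (E_zeta hl hq hql hs hi wyy yK n0) mem0v.
pose U := hw_span 0 j Z; pose S := hw_span U i Y.
have sU : stable U := hw_span_stable hl hq hql tX st0 wZ EZ.
have EY v : (0 < v)%N -> act X (LE q v) Y \in U.
  move=> v0; have [c [k ->]] := E_theta hl hq hql hs hi wyy yK v0.
  by apply/memvZ/(hw_span_mem hl hq hql tX st0 wZ EZ).
have sS : stable S := hw_span_stable hl hq hql tX sU wY EY.
have YS : Y \in S by have := hw_span_mem hl hq hql tX sU wY EY 0; rewrite act_F0.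
have dS : (\dim S <= \dim {: TM})%N.
  rewrite dim_TM; apply: leq_trans (dim_hw_span _ _ _) _; rewrite leq_add2r.
  by apply: leq_trans (dim_hw_span _ _ _) _; rewrite dimv0.
have Y1 : Y.1 = seqop B.+1 0 (theta tQ i a) (N_ 0 : TM).
  pose pi1 : 'Hom(X, TM) := @lfst C TM M.
  have h1 : is_hom pi1 by move=> x v; rewrite !lfstE dsumE.
  by have := seqop_hom B.+1 0 (theta tQ i a) yy h1; rewrite !lfstE.
have Y2 : Y.2 = seqop B.+1 0 (theta tQ i a) y.
  pose pi2 : 'Hom(X, M) := @lsnd C TM M.
  have h2 : is_hom pi2 by move=> x v; rewrite !lsndE dsumE.
  by have := seqop_hom B.+1 0 (theta tQ i a) yy h2; rewrite !lsndE.
have [d Yd] := theta_N B.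
have onto (x : TM) : exists2 z : X, z \in S & z.1 = x.
  have st : stable (M := TM) (@lfst C TM M @: S)%VS.
    move=> b _ /memv_imgP[z zS ->]; apply/memv_imgP; exists (act X b z); first exact: sS.
    by rewrite !lfstE dsumE.
  have full : (Submodule st : {vspace TM}) = fullv.
    apply: (@T_generated _ _ _ _ _ _ hl hq hql hs hi _ d); rewrite -Yd -Y1 -[Y.1]lfstE.
    exact: memv_img.
  have : x \in (Submodule st : {vspace TM}) by rewrite full memvf.
  by move=> /memv_imgP[z zS ->]; exists z => //; rewrite lfstE.
have [h hh hE] := graph_hom sS onto dS.
exists h; split=> //; apply/lfunP => x.
(* The locus where g h and f agree is a submodule. It contains the generator Y.1: h maps Y.1 to Y.2,
   and g Y.2 and f Y.1 are the same expression in g y = f n_0. *)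
have st : stable (M := TM) (lker ((g \o h)%VF - f)).
  move=> b v; rewrite !memv_ker !add_lfunE !opp_lfunE !comp_lfunE hh hg hf -linearB /=.
  by move=> /eqP->; rewrite linear0.
have full : (Submodule st : {vspace TM}) = fullv.
  apply: (@T_generated _ _ _ _ _ _ hl hq hql hs hi _ d); rewrite -Yd -Y1 /=.
  rewrite memv_ker add_lfunE opp_lfunE comp_lfunE hE // Y1 Y2.
  by rewrite (seqop_hom _ _ _ _ hg) (seqop_hom _ _ _ _ hf) gy subrr.
have : x \in (Submodule st : {vspace TM}) by rewrite full memvf.
by rewrite /= memv_ker add_lfunE opp_lfunE subr_eq0 => /eqP.
Qed.

End Projectivity.

Theorem theorem4p4 (R : realType) (q : R[i]) (l i r s : nat)
    (hl : (2 <= l)%N) (hq : q != 0) (hql : l.-primitive_root (q ^+ 2))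
    (hs : (s < l - 1)%N) (hi : i = (r * l + s)%N) :
  let j := (i + 2 * (l - s - 1))%N in
  limits_exist q l s i j /\
  exists T : module_on (spec_rel q) (Tspace R[i] i j),
    [/\ tilting_formulas l s T,
        forall T' : module_on (spec_rel q) (Tspace R[i] i j),
          tilting_formulas l s T' -> forall a : LU q, T' a = T a,
        exists (Di : module_on (spec_rel q) 'rV[R[i]]_i.+1)
               (Dj : module_on (spec_rel q) 'rV[R[i]]_j.+1),
          let M := @generated _ _ _ (FdMod T)
                     (fun x => exists2 k : nat, (k <= j)%N & x = mvec R[i] i j k) in
          [/\ weyl_formulas Di, weyl_formulas Dj,
              projective_cover (@typeI _ q l) (FdMod T) (top (FdMod Di)),
              isomorphic (submod M) (FdMod Dj) &
              isomorphic (quotmod M) (FdMod Di)],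
        forall k : nat, (k <= j)%N ->
          T (LH q l) (mvec R[i] i j k)
            = (j%:Z - (2 * k)%:Z)%:~R *: mvec R[i] i j k &
        forall p : nat, (p <= i)%N ->
          T (LH q l) (nvec R[i] i j p)
            = (i%:Z - (2 * p)%:Z)%:~R *: nvec R[i] i j p].
Proof.
move=> j; split; first exact: Tq_limits hl hq hql hs hi.
exists (Tq hl hq hql hs hi); split.
- exact: Tq_formulas.
- by move=> T' hT'; apply: tilting_unique hT'; [exact: hq | exact: Tq_formulas].
- exists (Di hl hq hql hs hi), (Dj hl hq hql hs hi); split.
  + exact: Di_weyl.
  + exact: Dj_weyl.
  + split; [exact: typeI_TM | exact: TM_projective |].
    exists (cover_map hl hq hql hs hi).
    by split; [exact: cover_map_hom | exact: cover_map_surj | exact: cover_map_superfluous].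
  + exact: genM_sub.
  + exact: genM_quot.
- by move=> k _; rewrite T_H_m PoszM.
- by move=> p _; rewrite T_H_n PoszM.
Qed.
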